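(* Assume (A1) and (A2) of the context. Let $(\bar u_1(\cdot),\bar u_2(\cdot))\in\mathcal A_1\times\mathcal A_2$ be an admissible control with corresponding state process $(\bar x(\cdot),\bar y(\cdot),\bar z(\cdot))$, i.e. the unique solution of the state equation (S) with $(u_1,u_2)=(\bar u_1,\bar u_2)$. For $i=1,2$ let $(\bar p^i(\cdot),\bar q^i(\cdot),\bar k^i(\cdot))$ be the unique solution of the adjoint equation (ADJ) corresponding to $(\bar u_1,\bar u_2;\bar x,\bar y,\bar z)$. Suppose that: (i) for almost all $(t,\omega)\in[0,T]\times\Omega$, the map $(x,y,z,u_1)\mapsto H_1(t,x,y,z,u_1,\bar u_2(t),\bar p^1(t),\bar q^1(t),\bar k^1(t))$ is convex in $(x,y,z,u_1)$, and the map $(x,y,z,u_2)\mapsto H_2(t,x,y,z,\bar u_1(t),u_2,\bar p^2(t),\bar q^2(t),\bar k^2(t))$ is convex in $(x,y,z,u_2)$; (ii) for $i=1,2$, the functions $\phi_i:\mathbb R^n\to\mathbb R$ and $h_i:\mathbb R^m\to\mathbb R$ are convex; (iii) for almost all $(t,\omega)\in[0,T]\times\Omega$, $$\min_{u_1\in U_1}H_1(t,\bar x(t),\bar y(t),\bar z(t),u_1,\bar u_2(t),\bar p^1(t),\bar q^1(t),\bar k^1(t))=H_1(t,\bar x(t),\bar y(t),\bar z(t),\bar u_1(t),\bar u_2(t),\bar p^1(t),\bar q^1(t),\bar k^1(t))$$ and $$\min_{u_2\in U_2}H_2(t,\bar x(t),\bar y(t),\bar z(t),\bar u_1(t),u_2,\bar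 p^2(t),\bar q^2(t),\bar k^2(t))=H_2(t,\bar x(t),\bar y(t),\bar z(t),\bar u_1(t),\bar u_2(t),\bar p^2(t),\bar q^2(t),\bar k^2(t)).$$ Then $(\bar u_1(\cdot),\bar u_2(\cdot))$ is an open-loop Nash equilibrium point, i.e. $J_1(\bar u_1,\bar u_2)=\inf_{u_1\in\mathcal A_1}J_1(u_1,\bar u_2)$ and $J_2(\bar u_1,\bar u_2)=\inf_{u_2\in\mathcal A_2}J_2(\bar u_1,u_2)$.
   Context: **Setting.** $(\Omega,\mathcal F,\{\mathcal F_t\}_{t\ge0},P)$ is a complete probability space carrying a $d$-dimensional standard Brownian motion $B$, with $\{\mathcal F_t\}$ its natural filtration augmented by all $P$-null sets; $T>0$ is fixed. For a Euclidean space $E$ with inner product $\langle\cdot,\cdot\rangle$ (trace inner product for matrices) and norm $|\cdot|$: $L^2(\Omega,\mathcal F_T,P;E)$ is the set of square-integrable $\mathcal F_T$-measurable $E$-valued random variables; $M^2(0,T;E)$ is the set of $\mathcal F_t$-adapted $E$-valued processes $\varphi$ with $E\int_0^T|\varphi(t)|^2dt<\infty$; $\mathcal S^2(0,T;E)$ is the set of continuous $\mathcal F_t$-adapted $E$-valued processes with $E\sup_{0\le t\le T}|\varphi(t)|^2<\infty$. **Controls.** $U_1\subset\mathbb R^{k_1}$, $U_2\subset\mathbb R^{k_2}$ are nonempty convex sets. $\mathcal A_i$ is the set of $\mathcal F_t$-adapted $U_i$-valued processes $u_i$ with $E\int_0^T|u_i(t)|^2dt<\infty$. Elements of $\mathcal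 A_1\times\mathcal A_2$ are the admissible controls. **State equation (S).** Given $a\in\mathbb R^n$, $\xi\in L^2(\Omega,\mathcal F_T,P;\mathbb R^m)$ and (measurable) maps $b,\sigma,f$ from $[0,T]\times\mathbb R^n\times\mathbb R^m\times\mathbb R^{m\times d}\times U_1\times U_2$ to $\mathbb R^n$, $\mathbb R^{n\times d}$, $\mathbb R^m$ respectively, $$\begin{cases}dx(t)=b(t,x(t),y(t),z(t),u_1(t),u_2(t))\,dt+\sigma(t,x(t),y(t),z(t),u_1(t),u_2(t))\,dB(t),\\ dy(t)=-f(t,x(t),y(t),z(t),u_1(t),u_2(t))\,dt+z(t)\,dB(t),\\ x(0)=a,\quad y(T)=\xi.\end{cases}$$ **Costs.** For $i=1,2$, with $l_i:[0,T]\times\mathbb R^n\times\mathbb R^m\times\mathbb R^{m\times d}\times U_1\times U_2\to\mathbb R$ (measurable), $\phi_i:\mathbb R^n\to\mathbb R$, $h_i:\mathbb R^m\to\mathbb R$, $$J_i(u_1,u_2)=E\Big[\int_0^Tl_i(t,x(t),y(t),z(t),u_1(t),u_2(t))\,dt+\phi_i(x(T))+h_i(y(0))\Big],$$ where $(x,y,z)$ is the state process for $(u_1,u_2)$. Each player $i$ minimizes $J_i$. **(A1)** $b,\sigma,f$ are continuously differentiable in $(x,y,z,u_1,u_2)$ with bounded derivatives, and the following Lipschitz and monotonicity conditions hold. There are a full-rank matrix $G\in\mathbb R^{m\times n}$ and constants $\beta_1,\beta_2\ge0$ with $\beta_1+\beta_2>0$, and moreover $\beta_1>0$ if $m>n$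 and $\beta_2>0$ if $n>m$, such that for every admissible control $(u_1,u_2)$, writing $\lambda=(x,y,z)$ and $$A(t,\lambda)=\big(-G^{*}f,\;Gb,\;G\sigma\big)(t,x,y,z,u_1(t),u_2(t)),$$ one has: $A(t,\cdot)$ is Lipschitz uniformly in $(t,\omega)$; for each $\lambda$, $A(\cdot,\lambda)$ is square integrable in the sense of $M^2(0,T;\cdot)$; and for all $\lambda=(x,y,z)$, $\lambda'=(x',y',z')$, $$\langle A(t,\lambda)-A(t,\lambda'),\lambda-\lambda'\rangle\le-\beta_1|G(x-x')|^2-\beta_2\big(|G^{*}(y-y')|^2+|G^{*}(z-z')|^2\big).$$ **(A2)** For $i=1,2$, $l_i$ is continuously differentiable in $(x,y,z,u_1,u_2)$, $\phi_i$ in $x$ and $h_i$ in $y$; for some constant $C$, $|l_i|\le C(1+|x|^2+|y|^2+|z|^2+|u_1|^2+|u_2|^2)$, the derivatives of $l_i$ are bounded by $C(1+|x|+|y|+|z|+|u_1|+|u_2|)$, $|\phi_i(x)|\le C(1+|x|^2)$, $|h_i(y)|\le C(1+|y|^2)$, $|\phi_{ix}(x)|\le C(1+|x|)$, $|h_{iy}(y)|\le C(1+|y|)$. By known results, under (A1) equation (S) has for each admissible control a unique solution $(x,y,z)\in\mathcal S^2(0,T;\mathbb R^n)\times\mathcal S^2(0,T;\mathbb R^m)\times M^2(0,T;\mathbb R^{m\times d})$, called the state process; $(u_1,u_2;x,y,z)$ is called an admissible pair. Under (A1) and (A2), $|J_i(u_1,u_2)|<\infty$. **Hamiltonians.** For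 $i=1,2$, with $p\in\mathbb R^n$, $q\in\mathbb R^{n\times d}$, $k\in\mathbb R^m$, $$H_i(t,x,y,z,u_1,u_2,p,q,k)=\langle k,-f(t,x,y,z,u_1,u_2)\rangle+\langle p,b(t,x,y,z,u_1,u_2)\rangle+\langle q,\sigma(t,x,y,z,u_1,u_2)\rangle+l_i(t,x,y,z,u_1,u_2).$$ Subscripts $x,y,z,u_1,u_2$ denote gradients in those variables. **Adjoint equation (ADJ)** corresponding to an admissible pair $(u_1,u_2;x,y,z)$, for $i=1,2$: with all derivatives of $H_i$ evaluated at $(t,x(t),y(t),z(t),u_1(t),u_2(t),p^i(t),q^i(t),k^i(t))$, $$\begin{cases}dk^i(t)=-H_{iy}\,dt-H_{iz}\,dB(t),\\ dp^i(t)=-H_{ix}\,dt+q^i(t)\,dB(t),\\ k^i(0)=-h_{iy}(y(0)),\quad p^i(T)=\phi_{ix}(x(T)).\end{cases}$$ By known results, under (A1) and (A2) it has a unique solution $(k^i,p^i,q^i)\in\mathcal S^2(0,T;\mathbb R^m)\times\mathcal S^2(0,T;\mathbb R^n)\times M^2(0,T;\mathbb R^{n\times d})$. *)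

(* Defs.v *)
From HB Require Import structures.
From mathcomp Require Import all_boot all_order all_algebra.
From mathcomp Require Import all_classical all_reals all_analysis.

Set Implicit Arguments.
Unset Strict Implicit.
Unset Printing Implicit Defensive.

Import Order.TTheory GRing.Theory Num.Theory.
Import numFieldNormedType.Exports.

Local Open Scope classical_set_scope.
Local Open Scope ring_scope.

(* The sigma-algebra generated by the entries is the Borel sigma-algebra of the
   matrix space; this mirrors the library's instance on tuples. *)
Definition measure_matrix_display : measure_display.
Proof. exact: default_measure_display. Qed.

Section measurable_matrix.
Context {R : realType} {p q : nat}.

Definition matrix_entry_sets : set (set 'M[R]_(p, q)) :=
  [set A | exists (i : 'I_p) (j : 'I_q) (D : set (measurableTypeR R)),
    measurable D /\ A = (fun M : 'M[R]_(p, q) => M i j) @^-1` D].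

Let matrix_set0 : <<s matrix_entry_sets >> set0.
Proof. exact: sigma_algebra0. Qed.

Let matrix_setC A :
  <<s matrix_entry_sets >> A -> <<s matrix_entry_sets >> (~` A).
Proof. exact: sigma_algebraC. Qed.

Let matrix_bigcup (F : (set 'M[R]_(p, q))^nat) :
  (forall i, <<s matrix_entry_sets >> (F i)) ->
  <<s matrix_entry_sets >> (\bigcup_i F i).
Proof. exact: sigma_algebra_bigcup. Qed.

HB.instance Definition _ := @isMeasurable.Build measure_matrix_display
  'M[R]_(p, q) <<s matrix_entry_sets >> matrix_set0 matrix_setC matrix_bigcup.

End measurable_matrix.

(* Measurability for the trace sigma-algebra on D: unlike [measurable_fun D f],
   it is meaningful when D is not measurable (a convex subset of R^k need not be
   Borel). *)
Definition trace_measurable d1 d2 (S1 : measurableType d1)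
    (S2 : measurableType d2) (D : set S1) (f : S1 -> S2) :=
  forall Y, measurable Y ->
    exists2 W, measurable W & D `&` f @^-1` Y = D `&` W.

Section Euclidean.
Context {R : realType}.

Definition inner p q (A B : 'M[R]_(p, q)) : R := \tr (A^T *m B).

Definition sqnorm p q (A : 'M[R]_(p, q)) : R := inner A A.

Definition enorm p q (A : 'M[R]_(p, q)) : R := Num.sqrt (sqnorm A).

Definition grad p q (F : 'M[R]_(p, q) -> R) (x : 'M[R]_(p, q)) : 'M[R]_(p, q) :=
  \matrix_(i, j) 'D_(delta_mx i j) (F : _ -> R^o) x.

(* Continuous differentiability, with derivative dg, on a set D that need not be
   open: differentiability and continuity are relative to D. *)
Definition C1_on (V W : normedModType R) (D : set V) (g : V -> W)
    (dg : V -> {linear V -> W}) :=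
  (forall v, D v -> forall e : R, 0 < e ->
     \forall w \near v, D w -> `|g w - g v - dg v (w - v)| <= e * `|w - v|) /\
  (forall h, {within D, continuous (fun v => dg v h)}).

End Euclidean.

Section stochastic_calculus.
Context {R : realType} {disp : measure_display} {Omega : measurableType disp}.
Variable P : probability Omega R.
Context {d : nat}.
Variable B : R -> Omega -> 'cV[R]_d.

Local Notation mu := (@lebesgue_measure R).

Definition history_sets (t : R) : set (set Omega) :=
  [set A | exists s (D : set 'cV[R]_d),
    [/\ 0 <= s <= t, measurable D & A = B s @^-1` D]].

Record brownian_motion : Prop := {
  bm_measurable : forall t, 0 <= t -> measurable_fun setT (B t);
  bm_start : {ae P, forall w, B 0 w = 0};
  bm_continuous : {ae P, forall w,
    {within [set t : R | 0 <= t], continuous (fun t => B t w)}};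
  bm_independent : forall s t, 0 <= s -> s < t ->
    forall (E : set Omega) (D : set 'cV[R]_d),
      <<s history_sets s >> E -> measurable D ->
      (P (E `&` (fun w => B t w - B s w)%R @^-1` D) =
       P E * P ((fun w => B t w - B s w)%R @^-1` D))%E;
  (* the increments are N(0, (t - s) I_d): [normal_prob] takes the standard
     deviation *)
  bm_gaussian : forall s t, 0 <= s -> s < t ->
    forall A : 'I_d -> set (measurableTypeR R), (forall i, measurable (A i)) ->
      P [set w | forall i, A i ((B t w - B s w) i 0)] =
      (\prod_(i < d) fine (normal_prob 0 (Num.sqrt (t - s)) (A i)))%:E }.

Definition filtration (t : R) : set (set Omega) :=
  <<s history_sets t `|` [set N | P.-negligible N] >>.

Definition measurable_at (t : R) p q (X : Omega -> 'M[R]_(p, q)) :=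
  forall D, measurable D -> filtration t (X @^-1` D).

Variable T : R.

Section processes.
Context {p q : nat}.
Implicit Types X : R -> Omega -> 'M[R]_(p, q).

Definition adapted X := forall t, 0 <= t <= T -> measurable_at t (X t).

Definition L2_terminal (X : Omega -> 'M[R]_(p, q)) :=
  measurable_at T X /\ (\int[P]_w (sqnorm (X w))%:E < +oo)%E.

Definition M2 X :=
  [/\ measurable_fun ((`[0, T] : set (measurableTypeR R)) `*` setT)
        (fun tw : measurableTypeR R * Omega => X tw.1 tw.2),
      adapted X &
      (\int[P]_w \int[mu]_(t in `[0%R, T]) (sqnorm (X t w))%:E < +oo)%E].

Definition continuous_paths X :=
  forall w, {within `[0, T], continuous (fun t => X t w)}.

Definition S2 X :=
  [/\ continuous_paths X, adapted X &
      (\int[P]_w ereal_sup [set (sqnorm (X t w))%:E | t in `[0%R, T]]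
         < +oo)%E].

End processes.

Definition admissible k (U : set 'cV[R]_k) (u : R -> Omega -> 'cV[R]_k) :=
  M2 u /\ forall t w, 0 <= t <= T -> U (u t w).

(* The process equal to [sp_val k] on ]sp_time k, sp_time k.+1], k < sp_size. *)
Record simple_process p : Type := SimpleProcess {
  sp_size : nat;
  sp_time : nat -> R;
  sp_val : nat -> Omega -> 'M[R]_(p, d) }.

Definition nonanticipative p (S : simple_process p) :=
  forall k, (k < sp_size S)%N ->
    [/\ 0 <= sp_time S k, sp_time S k <= sp_time S k.+1,
        sp_time S k.+1 <= T, measurable_at (sp_time S k) (sp_val S k) &
        exists C, forall w, enorm (sp_val S k w) <= C].

Definition simple_eval p (S : simple_process p) (t : R) (w : Omega) :
    'M[R]_(p, d) :=
  \sum_(k < sp_size S)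
    if sp_time S k < t <= sp_time S k.+1 then sp_val S k w else 0.

Definition simple_integral p (S : simple_process p) (t : R) (w : Omega) :
    'cV[R]_p :=
  \sum_(k < sp_size S)
    sp_val S k w *m (B (Num.min (sp_time S k.+1) t) w -
                     B (Num.min (sp_time S k) t) w).

(* I is (a continuous version of) the Ito integral of gamma. *)
Definition ito_integral p (gamma : R -> Omega -> 'M[R]_(p, d))
    (I : R -> Omega -> 'cV[R]_p) :=
  [/\ M2 gamma, continuous_paths I, adapted I &
    exists S : nat -> simple_process p,
      [/\ forall j, nonanticipative (S j),
          (\int[P]_w \int[mu]_(t in `[0%R, T])
             (sqnorm (simple_eval (S j) t w - gamma t w))%:E)%E
             @[j --> \oo] --> 0%E &
          forall t, 0 <= t <= T ->
            (\int[P]_w (sqnorm (simple_integral (S j) t w - I t w))%:E)%E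
              @[j --> \oo] --> 0%E]].

Definition time_integral p (beta : R -> Omega -> 'cV[R]_p) (t : R) (w : Omega) :
    'cV[R]_p :=
  \matrix_(i, j) \int[mu]_(s in `[0, t]) beta s w i j.

(* dX(t) = beta(t) dt + gamma(t) dB(t) on [0, T]. *)
Definition ito_differential p (X beta : R -> Omega -> 'cV[R]_p)
    (gamma : R -> Omega -> 'M[R]_(p, d)) :=
  {ae P, forall w, forall i j,
     mu.-integrable `[0, T] (fun t => (beta t w i j)%:E)} /\
  exists2 I, ito_integral gamma I &
    {ae P, forall w, forall t, 0 <= t <= T ->
       X t w = X 0 w + time_integral beta t w + I t w}.

Section game.
Context {n m k1 k2 : nat}.

(* (x, y, z) and (x, y, z, u1, u2) *)
Local Notation state := ('cV[R]_n * 'cV[R]_m * 'M[R]_(m, d))%type.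
Local Notation point :=
  ('cV[R]_n * 'cV[R]_m * 'M[R]_(m, d) * 'cV[R]_k1 * 'cV[R]_k2)%type.

Variables (U1 : set 'cV[R]_k1) (U2 : set 'cV[R]_k2).

Definition domain : set point := [set v | U1 v.1.2 /\ U2 v.2].

Definition measurable_coef d' (E : measurableType d') (g : R -> point -> E) :=
  trace_measurable
    [set tv : measurableTypeR R * point | 0 <= tv.1 <= T /\ domain tv.2]
    (fun tv => g tv.1 tv.2).

Variables (b : R -> point -> 'cV[R]_n) (sigma : R -> point -> 'M[R]_(n, d))
  (f : R -> point -> 'cV[R]_m).

Record state_process (a : 'cV[R]_n) (xi : Omega -> 'cV[R]_m)
    (u1 : R -> Omega -> 'cV[R]_k1) (u2 : R -> Omega -> 'cV[R]_k2)
    (x : R -> Omega -> 'cV[R]_n) (y : R -> Omega -> 'cV[R]_m)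
    (z : R -> Omega -> 'M[R]_(m, d)) : Prop := {
  state_x_S2 : S2 x;
  state_y_S2 : S2 y;
  state_z_M2 : M2 z;
  state_forward : ito_differential x
    (fun t w => b t (x t w, y t w, z t w, u1 t w, u2 t w))
    (fun t w => sigma t (x t w, y t w, z t w, u1 t w, u2 t w));
  state_backward : ito_differential y
    (fun t w => - f t (x t w, y t w, z t w, u1 t w, u2 t w)) z;
  state_initial : {ae P, forall w, x 0 w = a};
  state_terminal : {ae P, forall w, y T w = xi w} }.

Definition C1_bounded (W : normedModType R) (g : R -> point -> W) :=
  exists (C : R) (dg : R -> point -> {linear point -> W}),
    forall t, 0 <= t <= T -> C1_on domain (g t) (dg t) /\
      forall v, domain v -> forall h, `|dg t v h| <= C * `|h|.

Definition state_inner (v v' : state) : R :=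
  inner v.1.1 v'.1.1 + inner v.1.2 v'.1.2 + inner v.2 v'.2.

Definition A_map (G : 'M[R]_(m, n)) (u1 : R -> Omega -> 'cV[R]_k1)
    (u2 : R -> Omega -> 'cV[R]_k2) (t : R) (w : Omega) (lam : state) : state :=
  (- (G^T *m f t (lam, u1 t w, u2 t w)),
   G *m b t (lam, u1 t w, u2 t w),
   G *m sigma t (lam, u1 t w, u2 t w)).

Record assumption_A1 : Prop := {
  A1_b : C1_bounded b;
  A1_sigma : C1_bounded sigma;
  A1_f : C1_bounded f;
  A1_monotone : exists (G : 'M[R]_(m, n)) (beta1 beta2 : R),
    [/\ \rank G = minn m n,
        [/\ 0 <= beta1, 0 <= beta2 & 0 < beta1 + beta2],
        (n < m)%N -> 0 < beta1,
        (m < n)%N -> 0 < beta2 &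
        forall u1 u2, admissible U1 u1 -> admissible U2 u2 ->
          [/\ exists C : R, forall t w, 0 <= t <= T -> forall lam lam',
                `|A_map G u1 u2 t w lam - A_map G u1 u2 t w lam'|
                  <= C * `|lam - lam'|,
              forall lam,
                [/\ M2 (fun t w => (A_map G u1 u2 t w lam).1.1),
                    M2 (fun t w => (A_map G u1 u2 t w lam).1.2) &
                    M2 (fun t w => (A_map G u1 u2 t w lam).2)] &
              forall t w, 0 <= t <= T -> forall lam lam',
                state_inner (A_map G u1 u2 t w lam - A_map G u1 u2 t w lam')
                    (lam - lam')
                <= - beta1 * sqnorm (G *m (lam - lam').1.1)
                   - beta2 * (sqnorm (G^T *m (lam - lam').1.2)
                              + sqnorm (G^T *m (lam - lam').2))]] }.

Section player.
Variables (l : R -> point -> R) (phi : 'cV[R]_n -> R) (h : 'cV[R]_m -> R).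

Definition C1_everywhere k (F : 'cV[R]_k -> R) :=
  (forall x, differentiable (F : _ -> R^o) x) /\ continuous (grad F).

Definition assumption_A2 :=
  exists (C : R) (dl : R -> point -> {linear point -> R^o}),
    [/\ forall t, 0 <= t <= T -> C1_on domain (l t : _ -> R^o) (dl t),
        C1_everywhere phi /\ C1_everywhere h,
        forall t x y z u1 u2, 0 <= t <= T -> U1 u1 -> U2 u2 ->
          `|l t (x, y, z, u1, u2)| <=
            C * (1 + sqnorm x + sqnorm y + sqnorm z + sqnorm u1 + sqnorm u2) /\
          forall e, `|dl t (x, y, z, u1, u2) e| <=
            C * (1 + enorm x + enorm y + enorm z + enorm u1 + enorm u2) * `|e|,
        forall x, `|phi x| <= C * (1 + sqnorm x) /\
          enorm (grad phi x) <= C * (1 + enorm x) &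
        forall y, `|h y| <= C * (1 + sqnorm y) /\
          enorm (grad h y) <= C * (1 + enorm y)].

Definition cost (u1 : R -> Omega -> 'cV[R]_k1) (u2 : R -> Omega -> 'cV[R]_k2)
    (x : R -> Omega -> 'cV[R]_n) (y : R -> Omega -> 'cV[R]_m)
    (z : R -> Omega -> 'M[R]_(m, d)) : \bar R :=
  ('E_P[(fun w => \int[mu]_(t in `[0, T])
                    l t (x t w, y t w, z t w, u1 t w, u2 t w)
                  + phi (x T w) + h (y 0 w))%R])%E.

Definition hamiltonian (t : R) (v : point) (p : 'cV[R]_n) (q : 'M[R]_(n, d))
    (k : 'cV[R]_m) : R :=
  inner k (- f t v) + inner p (b t v) + inner q (sigma t v) + l t v.

Record adjoint_process (u1 : R -> Omega -> 'cV[R]_k1)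
    (u2 : R -> Omega -> 'cV[R]_k2) (x : R -> Omega -> 'cV[R]_n)
    (y : R -> Omega -> 'cV[R]_m) (z : R -> Omega -> 'M[R]_(m, d))
    (p : R -> Omega -> 'cV[R]_n) (q : R -> Omega -> 'M[R]_(n, d))
    (k : R -> Omega -> 'cV[R]_m) : Prop := {
  adjoint_k_S2 : S2 k;
  adjoint_p_S2 : S2 p;
  adjoint_q_M2 : M2 q;
  adjoint_forward : ito_differential k
    (fun t w => - grad (fun y' => hamiltonian t
       (x t w, y', z t w, u1 t w, u2 t w) (p t w) (q t w) (k t w)) (y t w))
    (fun t w => - grad (fun z' => hamiltonian t
       (x t w, y t w, z', u1 t w, u2 t w) (p t w) (q t w) (k t w)) (z t w));
  adjoint_backward : ito_differential p
    (fun t w => - grad (fun x' => hamiltonian t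
       (x', y t w, z t w, u1 t w, u2 t w) (p t w) (q t w) (k t w)) (x t w)) q;
  adjoint_initial : {ae P, forall w, k 0 w = - grad h (y 0 w)};
  adjoint_terminal : {ae P, forall w, p T w = grad phi (x T w)} }.

End player.

Variables (a : 'cV[R]_n) (xi : Omega -> 'cV[R]_m).

(* [J_value l phi h u1 u2 c]: the cost functional with data l, phi, h takes the
   value c at (u1, u2). The functional is given by its graph because the state
   process of (u1, u2) is the solution of an equation. *)
Definition J_value (l : R -> point -> R) (phi : 'cV[R]_n -> R)
    (h : 'cV[R]_m -> R) (u1 : R -> Omega -> 'cV[R]_k1)
    (u2 : R -> Omega -> 'cV[R]_k2) (c : \bar R) :=
  exists x y z, state_process a xi u1 u2 x y z /\ c = cost l phi h u1 u2 x y z.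

End game.

End stochastic_calculus.

Definition is_min_on (R : realType) (E : Type) (U : set E) (F : E -> R)
    (v : R) := (F @` U) v /\ lbound (F @` U) v.

(* Main.v *)
(* Fix a competing admissible control and write X, Y, Z for the differences of
   the state processes. The products <X, p> and <Y, k> integrate by parts: in
   expectation, E <X_T, p_T> and - E <Y_0, k_0> add up to the integral of the
   increment of H - l minus the pairing of the state gradients of H with
   (X, Y, Z). Convexity of phi and h bounds the increment of the terminal and
   initial costs from below by these boundary terms, and convexity of H together
   with the minimum condition makes the increment of H dominate the gradient
   pairing, so the cost of the competitor is not smaller.

   The integration by parts needs only the martingale property and the isometry
   of the Ito integral, both inherited from simple processes by L^2 limits: the
   drift differences and the gradients of H are square integrable because the
   coefficients are Lipschitz, although the drifts themselves need not be. *)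
Require Import Defs.
From HB Require Import structures.
From mathcomp Require Import all_boot all_order all_algebra.
From mathcomp Require Import all_classical all_reals all_analysis.
From mathcomp Require Import measurable_realfun ring lra.

Set Implicit Arguments.
Unset Strict Implicit.
Unset Printing Implicit Defensive.

Import Order.TTheory GRing.Theory Num.Theory.
Import numFieldNormedType.Exports.

Local Open Scope classical_set_scope.
Local Open Scope ring_scope.

(** * Square-integrable functions *)

(** Measurability shapes much of the proof. Exchanging expectation and time requires jointly
    measurable integrands, and the martingale property can be tested at time s only against
    variables known at s, so the drift differences and the gradients of H must be both jointly
    measurable and adapted. The two properties come from one closure principle, [observable], stated
    for an arbitrary measurable space. The coefficients are measurable only in the trace sense, so
    everything substituted in them has to stay inside the domain at all times, and the gradients are
    reached as pointwise limits of difference quotients of H.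

    The second obstacle is that the domain need not be open in the control variables. Derivatives
    are therefore taken relative to it. In the x, y and z directions the domain is the whole space,
    so there they give true gradients; in the control directions only one-sided information along
    segments of U_i is available, which is exactly what convexity and minimality can use. *)

Lemma normM_le_sqr (R : realFieldType) (a b : R) :
  `|a * b| <= (a ^+ 2 + b ^+ 2) / 2.
Proof.
have := sqr_ge0 (a + b); have := sqr_ge0 (a - b); rewrite sqrrB sqrrD.
by rewrite ler_norml => h1 h2; apply/andP; split; lra.
Qed.

Section square_integrable.
Context d (S : measurableType d) (R : realType).
Variable m : {measure set S -> \bar R}.
Implicit Types f g : S -> R.

Definition intble f := m.-integrable setT (EFin \o f).
Definition sqintble f := measurable_fun setT f /\ intble (fun x => f x ^+ 2).

Lemma intble_meas f : intble f -> measurable_fun setT f.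
Proof. by move=> /integrableP[/measurable_EFinP]. Qed.

Lemma intble_le f g : measurable_fun setT f -> intble g ->
  (forall x, `|f x| <= g x) -> intble f.
Proof.
move=> mf ig fg; apply: le_integrable ig => //; first exact/measurable_EFinP.
by move=> x _; rewrite /= lee_fin (le_trans (fg x))// ler_norm.
Qed.

Lemma intbleD f g : intble f -> intble g -> intble (fun x => f x + g x).
Proof. by move=> jf jg; exact: (integrableD _ jf jg). Qed.

Lemma intbleZ k f : intble f -> intble (fun x => k * f x).
Proof. by move=> jf; exact: (integrableZl _ k jf). Qed.

Lemma intbleN f : intble f -> intble (fun x => - f x).
Proof. by move=> /(intbleZ (-1)); under [X in intble X]eq_fun do rewrite mulN1r. Qed.

Lemma intbleB f g : intble f -> intble g -> intble (fun x => f x - g x).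
Proof. by move=> jf /intbleN; exact: intbleD. Qed.

Lemma intble0 : intble (fun=> 0).
Proof. exact: integrable0. Qed.

Lemma intble_sum (I : Type) (s : seq I) (p : pred I) (F : I -> S -> R) :
  (forall i, p i -> intble (F i)) -> intble (fun x => \sum_(i <- s | p i) F i x).
Proof.
move=> iF; elim: s => [|i s ih].
  by under [X in intble X]eq_fun do rewrite big_nil; exact: intble0.
under [X in intble X]eq_fun do rewrite big_cons.
by case: (p i) (iF i) => // iFi; apply: intbleD => //; exact: iFi.
Qed.

Lemma Rintegral_sum (I : Type) (s : seq I) (p : pred I) (F : I -> S -> R) :
  (forall i, p i -> intble (F i)) ->
  \int[m]_x (\sum_(i <- s | p i) F i x) = \sum_(i <- s | p i) \int[m]_x F i x.
Proof.
move=> iF; elim: s => [|i s ih].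
  under eq_Rintegral do rewrite big_nil.
  by rewrite big_nil Rintegral_cst// mul0r.
rewrite big_cons; under eq_Rintegral do rewrite big_cons.
case: ifPn => // pi; rewrite RintegralD// ?ih//; first exact: iF.
exact: intble_sum.
Qed.

Lemma ae_eq_Rintegral f g : measurable_fun setT f -> measurable_fun setT g ->
  {ae m, forall x, f x = g x} -> \int[m]_x f x = \int[m]_x g x.
Proof.
move=> mf mg fg; congr fine; apply: ae_eq_integral => //; [exact/measurable_EFinP|exact/measurable_EFinP|].
by apply: filterS fg => x + _ => ->.
Qed.

Lemma ae_intble f g : measurable_fun setT f -> {ae m, forall x, f x = g x} ->
  intble g -> intble f.
Proof.
move=> mf fg ig; apply/integrableP; split; first exact/measurable_EFinP.
have [mg] := integrableP _ _ _ ig; apply: le_lt_trans.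
rewrite (@ae_eq_integral _ _ _ m setT (fun x => `|(g x)%:E|%E))//.
- by apply: measurableT_comp => //; exact/measurable_EFinP.
- by apply: measurableT_comp.
- by apply: filterS fg => x /= + _ => ->.
Qed.

Lemma sqint_mul f g : sqintble f -> sqintble g -> intble (fun x => f x * g x).
Proof.
move=> [mf f2] [mg g2]; apply: (intble_le _ (intbleD f2 g2)).
  exact: measurable_funM.
move=> x; apply: le_trans (normM_le_sqr _ _) _.
by have := sqr_ge0 (f x); have := sqr_ge0 (g x); lra.
Qed.

Lemma sqintZ k f : sqintble f -> sqintble (fun x => k * f x).
Proof.
move=> [mf f2]; split; first exact: measurable_funM.
by under [X in intble X]eq_fun do rewrite exprMn; exact: intbleZ.
Qed.

Lemma sqintN f : sqintble f -> sqintble (fun x => - f x).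
Proof.
by move=> /(sqintZ (-1)); under [X in sqintble X]eq_fun do rewrite mulN1r.
Qed.

Lemma sqint_le f g : measurable_fun setT f -> sqintble g ->
  (forall x, `|f x| <= `|g x|) -> sqintble f.
Proof.
move=> mf [mg g2] fg; split => //; apply: (intble_le _ g2).
  exact: measurable_funX.
by move=> x; rewrite normrX -[leRHS]real_normK ?num_real// lerXn2r ?nnegrE.
Qed.

Lemma sqintD f g : sqintble f -> sqintble g -> sqintble (fun x => f x + g x).
Proof.
move=> [mf f2] [mg g2]; split; first exact: measurable_funD.
apply: (intble_le _ (intbleD (intbleZ 2 f2) (intbleZ 2 g2))).
  by apply: measurable_funX; exact: measurable_funD.
move=> x; rewrite ger0_norm ?sqr_ge0// -subr_ge0.
by rewrite [leRHS](_ : _ = (f x - g x) ^+ 2) ?sqr_ge0//; ring.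
Qed.

Lemma sqintB f g : sqintble f -> sqintble g -> sqintble (fun x => f x - g x).
Proof. by move=> /sqintD h /sqintN; exact: h. Qed.

Lemma sqint0 : sqintble (fun=> 0).
Proof. by split => //; under [X in intble X]eq_fun do rewrite expr0n/=; exact: intble0. Qed.

Lemma sqint_sum (I : Type) (s : seq I) (p : pred I) (F : I -> S -> R) :
  (forall i, p i -> sqintble (F i)) ->
  sqintble (fun x => \sum_(i <- s | p i) F i x).
Proof.
move=> iF; elim: s => [|i s ih].
  by under [X in sqintble X]eq_fun do rewrite big_nil; exact: sqint0.
under [X in sqintble X]eq_fun do rewrite big_cons.
by case: (p i) (iF i) => // iFi; apply: sqintD => //; exact: iFi.
Qed.

Lemma sqint_ltoo f : measurable_fun setT f ->
  (\int[m]_x (f x ^+ 2)%:E < +oo)%E -> sqintble f.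
Proof.
move=> mf foo; split=> //; apply/integrableP; split.
  by apply/measurable_EFinP; exact: measurable_funX.
under eq_integral do rewrite /= ger0_norm ?sqr_ge0//.
exact: foo.
Qed.

(** With u = F_j - f and v = G_j - g, the error F_j G_j - f g is f v + g u + u v. Weighting the
    first two products by e bounds its integral by e N plus a multiple, depending on e, of the two
    squared distances: e is fixed first, then j is taken large. *)
Lemma sqint_pairing_cvg (f g : S -> R) (F G : nat -> S -> R) :
  sqintble f -> sqintble g ->
  (forall j, sqintble (F j)) -> (forall j, sqintble (G j)) ->
  (\int[m]_x (F j x - f x) ^+ 2) @[j --> \oo] --> 0 ->
  (\int[m]_x (G j x - g x) ^+ 2) @[j --> \oo] --> 0 ->
  (\int[m]_x (F j x * G j x)) @[j --> \oo] --> \int[m]_x (f x * g x).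
Proof.
move=> hf hg hF hG cF cG.
set N := \int[m]_x (f x ^+ 2 + g x ^+ 2).
have N0 : 0 <= N by apply: Rintegral_ge0 => x _; rewrite addr_ge0 ?sqr_ge0.
have bound (e : R) j : 0 < e ->
  `|\int[m]_x (F j x * G j x) - \int[m]_x (f x * g x)| <=
   e * N + (1 + e^-1) * (\int[m]_x (F j x - f x) ^+ 2 + \int[m]_x (G j x - g x) ^+ 2).
  move=> e0; have iFG := sqint_mul (hF j) (hG j); have ifg := sqint_mul hf hg.
  have iN : intble (fun x => f x ^+ 2 + g x ^+ 2) by apply: intbleD; [case: hf|case: hg].
  have [_ iu] := sqintB (hF j) hf; have [_ iv] := sqintB (hG j) hg.
  rewrite -RintegralB// -RintegralD// -!RintegralZl//; last exact: intbleD.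
  rewrite -RintegralD//; [|exact: intbleZ|by apply: intbleZ; exact: intbleD].
  apply: le_trans (le_normr_Rintegral _ _) _ => //; first exact: intbleB.
  apply: le_Rintegral => //.
  - apply: (@intble_le _ (fun x => `|F j x * G j x - f x * g x|)).
    + by apply: measurableT_comp => //; apply: intble_meas; exact: intbleB.
    + exact: (integrable_norm (intbleB iFG ifg)).
    + by move=> x; rewrite normr_id.
  - by apply: intbleD; [exact: intbleZ|apply: intbleZ; exact: intbleD].
  move=> x _; set a := f x; set b := g x; set u := F j x - a; set v := G j x - b.
  have -> : F j x * G j x - a * b = a * v + b * u + u * v by rewrite /u /v; ring.
  (* Weighted Young inequality; the defect is a multiple of a square. *)
  have key (p q : R) : `|p * q| <= (e * p ^+ 2 + e^-1 * q ^+ 2) / 2.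
    have -> : (e * p ^+ 2 + e^-1 * q ^+ 2) / 2 =
              `|p * q| + e^-1 * (e * `|p| - `|q|) ^+ 2 / 2.
      rewrite normrM -(real_normK (num_real p)) -(real_normK (num_real q)).
      by field; rewrite gt_eqF.
    by rewrite lerDl divr_ge0// mulr_ge0 ?sqr_ge0// invr_ge0 ltW.
  have uv : `|u * v| <= (u ^+ 2 + v ^+ 2) / 2.
    exact: normM_le_sqr.
  apply: le_trans (ler_normD _ _) _; apply: le_trans (lerD (ler_normD _ _) uv) _.
  have := key a v; have := key b u.
  have ei : 0 < e^-1 by rewrite invr_gt0.
  have := mulr_ge0 (ltW ei) (sqr_ge0 u); have := mulr_ge0 (ltW ei) (sqr_ge0 v).
  have := mulr_ge0 (ltW e0) (sqr_ge0 a); have := mulr_ge0 (ltW e0) (sqr_ge0 b).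
  by have := sqr_ge0 u; have := sqr_ge0 v; lra.
apply/cvgrPdist_le => e e0.
(* Makes e1 N at most e / 2; the 1 keeps the denominator positive when N = 0. *)
pose e1 := e / (2 * (N + 1)).
have N1 : 0 < 2 * (N + 1) by lra.
have e10 : 0 < e1 by rewrite divr_gt0.
have eN : e1 * N <= e / 2.
  rewrite /e1 mulrAC ler_pdivrMr//.
  by rewrite [leRHS](_ : _ = e * N + e) ?lerDl ?ltW//; field.
have c0 : 0 < 1 + e1^-1 by rewrite addr_gt0// invr_gt0.
have := cvgD cF cG => /(_ _); rewrite addr0 => /cvgrPdist_le /(_ (e / 2 / (1 + e1^-1))).
move=> /(_ _)[]; first by rewrite !divr_gt0.
move=> k _ hk; exists k => //= j kj; rewrite distrC.
apply: le_trans (bound e1 j e10) _.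
have := hk _ kj; rewrite sub0r normrN => /(le_trans (ler_norm _)).
by rewrite ler_pdivlMr// mulrC => /(lerD eN); rewrite -splitr.
Qed.

End square_integrable.

(** * Fubini for real integrals *)

Section real_fubini.
Context d1 d2 (T1 : measurableType d1) (T2 : measurableType d2) (R : realType).
Variable m1 : {sigma_finite_measure set T1 -> \bar R}.
Variable m2 : {sigma_finite_measure set T2 -> \bar R}.
Implicit Types f : T1 * T2 -> R.

Lemma intble_fst_section f : intble (m1 \x m2)%E f ->
  {ae m1, forall x, intble m2 (fun y => f (x, y))}.
Proof. by move=> jf; exact: (ae_integrable1 jf). Qed.

Lemma intble_snd_section f : intble (m1 \x m2)%E f ->
  {ae m2, forall y, intble m1 (fun x => f (x, y))}.
Proof. by move=> jf; exact: (ae_integrable2 jf). Qed.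

(** [fine] sends infinite values to 0, so the real inner integral is dominated everywhere by the
    extended one, also at points whose section is not integrable. *)
Lemma intble_int_snd f : intble (m1 \x m2)%E f ->
  intble m1 (fun x => \int[m2]_y f (x, y)).
Proof.
move=> jf; have jF := integrable_fubini_F jf.
have mF := measurable_fubini_F jf.
apply: le_integrable jF => //.
  by apply/measurable_EFinP; apply: measurableT_comp mF.
by move=> x _ /=; rewrite /Rintegral /fubini_F/=; case: (\int[m2]_y _)%E => [r| |] //=; rewrite ?leey.
Qed.

Let integrable_fubini_G f : intble (m1 \x m2)%E f ->
  m2.-integrable setT (fubini_G m1 (EFin \o f)).
Proof.
move=> jf; have mf : measurable_fun setT (EFin \o f) by case/integrableP : jf.
have mn : measurable_fun setT (fun z => `|(EFin \o f) z|%E).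
  exact: measurableT_comp.
have mG := measurable_fubini_G jf.
apply/integrableP; split => //.
apply: le_lt_trans ((integrable21ltyP m1 m2 mf).1 jf).
apply: ge0_le_integral => //.
- exact: measurableT_comp.
- by have := @measurable_fun_fubini_tonelli_G _ _ T1 T2 R m1 _ mn; apply => z; exact: abse_ge0.
- move=> y _; apply: le_abse_integral => //.
  exact: (measurableT_comp mf (pair2_measurable y)).
Qed.

Lemma intble_int_fst f : intble (m1 \x m2)%E f ->
  intble m2 (fun y => \int[m1]_x f (x, y)).
Proof.
move=> jf; have jF := integrable_fubini_G jf.
have mF := measurable_fubini_G jf.
apply: le_integrable jF => //.
  by apply/measurable_EFinP; apply: measurableT_comp mF.
by move=> x _ /=; rewrite /Rintegral /fubini_G/=; case: (\int[m1]_y _)%E => [r| |] //=; rewrite ?leey.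
Qed.

Lemma Rintegral_prod_snd f : intble (m1 \x m2)%E f ->
  \int[(m1 \x m2)%E]_z f z = \int[m1]_x \int[m2]_y f (x, y).
Proof.
move=> jf; rewrite /Rintegral -(integral12_prod_meas1 jf); congr fine.
apply: ae_eq_integral => //.
- exact: measurable_fubini_F jf.
- by case/integrableP : (intble_int_snd jf).
- apply: filterS (integrable_ae measurableT (integrable_fubini_F jf)) => x /=.
  by move=> + _ => /(_ I) h; rewrite fineK.
Qed.

Lemma Rintegral_prod_fst f : intble (m1 \x m2)%E f ->
  \int[(m1 \x m2)%E]_z f z = \int[m2]_y \int[m1]_x f (x, y).
Proof.
move=> jf; rewrite /Rintegral -(integral21_prod_meas1 jf); congr fine.
apply: ae_eq_integral => //.
- exact: measurable_fubini_G jf.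
- by case/integrableP : (intble_int_fst jf).
- apply: filterS (integrable_ae measurableT (integrable_fubini_G jf)) => x /=.
  by move=> + _ => /(_ I) h; rewrite fineK.
Qed.

Lemma intble_tensor (u : T1 -> R) (v : T2 -> R) : intble m1 u -> intble m2 v ->
  intble (m1 \x m2)%E (fun z => u z.1 * v z.2).
Proof.
move=> iu iv.
have mu : measurable_fun setT (fun z : T1 * T2 => u z.1 * v z.2).
  by apply: measurable_funM; apply: measurableT_comp => //;
    [exact: intble_meas iu|exact: intble_meas iv].
have mau : measurable_fun setT (fun x => `|u x|%:E).
  by apply/measurable_EFinP; apply: measurableT_comp => //; exact: intble_meas iu.
have mav : measurable_fun setT (fun y => `|v y|%:E).
  by apply/measurable_EFinP; apply: measurableT_comp => //; exact: intble_meas iv.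
apply/(integrable12ltyP m1 m2); first exact/measurable_EFinP.
rewrite (eq_integral (fun x => `|u x|%:E * (\int[m2]_y `|v y|%:E))%E); last first.
  move=> x _; rewrite -ge0_integralZl//.
  by apply: eq_integral => y _; rewrite /= normrM.
rewrite ge0_integralZr ?integral_ge0//.
by case/integrableP: iu => _ hu; case/integrableP: iv => _ hv;
  rewrite lte_mul_pinfty ?ge0_fin_numE ?integral_ge0.
Qed.

End real_fubini.

Section indicator.
Context d (S : measurableType d) (R : realType).

Lemma measurable_fun_bool_natr (D : set S) (p : S -> bool) :
  measurable_fun D p -> measurable_fun D (fun x => (p x)%:R : R).
Proof.
move=> mp mD; rewrite (_ : (fun x => _) = (fun x => if p x then 1 else 0)).
  by apply: measurable_fun_if => //; exact: measurable_cst.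
by apply/funext => x; case: (p x).
Qed.

Lemma intble_mul_bool (m : {measure set S -> \bar R}) (p : S -> bool) f :
  measurable_fun setT p -> intble m f -> intble m (fun x => (p x)%:R * f x).
Proof.
move=> mp iF; apply: (@intble_le _ _ _ _ _ (fun x => `|f x|)).
- by apply: measurable_funM; [exact: measurable_fun_bool_natr|exact: intble_meas iF].
- exact: (integrable_norm iF).
- by move=> x; rewrite normrM; case: (p x); rewrite ?normr1 ?mul1r// normr0 mul0r.
Qed.

End indicator.

(** * Integration by parts for cumulative integrals *)

Section integration_by_parts.
Variable R : realType.
Local Notation mu := (@lebesgue_measure R).
Implicit Types u v : measurableTypeR R -> R.

(** Fubini on the plane cut along the diagonal: the region r <= s is integrated in r first, the
    region s < r in s first. *)
Lemma Rintegral_mul_cumulative u v : intble mu u -> intble mu v ->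
  (\int[mu]_r u r) * (\int[mu]_s v s) =
  \int[mu]_s ((\int[mu]_r ((r <= s)%R%:R * u r)) * v s +
              (\int[mu]_r ((r <= s)%R%:R * v r)) * u s).
Proof.
move=> iu iv.
have mle (s : R) : measurable_fun setT (fun r : measurableTypeR R => r <= s).
  exact: measurable_fun_ler.
have iuv := intble_tensor iu iv.
have i1 : intble (mu \x mu)%E (fun z => (z.1 <= z.2)%R%:R * (u z.1 * v z.2)).
  by apply: intble_mul_bool => //; exact: measurable_fun_ler.
have i2 : intble (mu \x mu)%E (fun z => (z.2 < z.1)%R%:R * (u z.1 * v z.2)).
  by apply: intble_mul_bool => //; exact: measurable_fun_ltr.
have j1 : intble mu (fun s => (\int[mu]_r ((r <= s)%R%:R * u r)) * v s).
  have := intble_int_fst i1; congr (intble mu _); apply/funext => s /=.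
  rewrite -RintegralZr//; last exact: intble_mul_bool.
  by apply: eq_Rintegral => r _; rewrite mulrA.
have e2 (r : R) : \int[mu]_s ((s < r)%R%:R * (u r * v s)) =
            (\int[mu]_s ((s <= r)%R%:R * v s)) * u r.
  rewrite -RintegralZr//; last exact: intble_mul_bool.
  apply: ae_eq_Rintegral.
  - apply: measurable_funM; last by apply: measurable_funM => //; exact: intble_meas iv.
    by apply: measurable_fun_bool_natr; exact: measurable_fun_ltr.
  - apply: measurable_funM => //; apply: measurable_funM; last exact: intble_meas iv.
    by apply: measurable_fun_bool_natr.
  (* The strict and the weak inequality differ on one point only, which is Lebesgue-null. *)
  - exists [set r]; split => //; first exact: lebesgue_measure_set1.
    move=> s /=; apply: contra_notP => /eqP sr.
    by rewrite [s <= r]le_eqVlt (negbTE sr)/= mulrA [RHS]mulrAC.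
have j2 : intble mu (fun s => (\int[mu]_r ((r <= s)%R%:R * v r)) * u s).
  have := intble_int_snd i2; congr (intble mu _); apply/funext => s /=.
  exact: e2.
rewrite RintegralD//.
transitivity (\int[(mu \x mu)%E]_z (u z.1 * v z.2)).
  rewrite Rintegral_prod_snd// -RintegralZr//.
  by apply: eq_Rintegral => r _ /=; rewrite RintegralZl.
transitivity (\int[(mu \x mu)%E]_z ((z.1 <= z.2)%R%:R * (u z.1 * v z.2) +
                                  (z.2 < z.1)%R%:R * (u z.1 * v z.2))).
  by apply: eq_Rintegral => z _; rewrite ltNge -mulrDl; case: (z.1 <= z.2);
    rewrite ?addr0 ?add0r mul1r.
rewrite RintegralD//; congr (_ + _).
  rewrite Rintegral_prod_fst//; apply: eq_Rintegral => s _.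
  rewrite -RintegralZr//; last exact: intble_mul_bool.
  by apply: eq_Rintegral => r _; rewrite mulrA.
by rewrite Rintegral_prod_snd//; apply: eq_Rintegral => r _; exact: e2.
Qed.

End integration_by_parts.

(** * Scalar processes on [0, T] *)

Lemma ae_conj d (S : measurableType d) (R : realType)
    (m : {measure set S -> \bar R}) (p q : S -> Prop) :
  {ae m, forall x, p x} -> {ae m, forall x, q x} -> {ae m, forall x, p x /\ q x}.
Proof. by move=> hp hq; apply: filterS2 hp hq => x; split. Qed.

(** Multiplying f by the indicator of the set where the bound holds gives a function dominated
    everywhere and equal to f almost everywhere. *)
Lemma intble_le_ae d (S : measurableType d) (R : realType)
    (m : {measure set S -> \bar R}) (f g : S -> R) :
  measurable_fun setT f -> intble m g -> {ae m, forall x, `|f x| <= g x} ->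
  intble m f.
Proof.
move=> mf ig fg.
apply: (@ae_intble _ _ _ m _ (fun x => (`|f x| <= g x)%R%:R * f x)) => //.
  by apply: filterS fg => x ->; rewrite mul1r.
have mp : measurable_fun setT (fun x => `|f x| <= g x).
  by apply: measurable_fun_ler; [exact: measurableT_comp|exact: intble_meas ig].
apply: (@intble_le _ _ _ _ _ (fun x => `|g x|)).
- by apply: measurable_funM => //; exact: measurable_fun_bool_natr.
- exact: (integrable_norm ig).
- move=> x; have [h|_] := boolP (`|f x| <= g x); rewrite ?mul1r ?mul0r ?normr0//.
  exact: le_trans h (ler_norm _).
Qed.

Section scalar_processes.
Context (R : realType) (disp : measure_display) (Omega : measurableType disp).
Variables (P : probability Omega R) (T : R).
Hypothesis T0 : 0 < T.
Local Notation mu := (@lebesgue_measure R).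
Local Notation mP := (mu \x P)%E.
Implicit Types X Y I J a b : R -> Omega -> R.

(* Processes only matter on [0, T]; extending them by 0 lets all integrals over
   time range over the whole line. *)
Definition zext X (z : measurableTypeR R * Omega) : R :=
  (0 <= z.1 <= T)%R%:R * X z.1 z.2.

Definition sqint_process X := sqintble mP (zext X).

Let itv_ind (t : measurableTypeR R) : R := (0 <= t <= T)%R%:R.

Lemma measurable_itvT :
  measurable_fun setT (fun t : measurableTypeR R => 0 <= t <= T).
Proof. by apply: measurable_and; exact: measurable_fun_ler. Qed.

Lemma measurable_itvT_fst :
  measurable_fun setT (fun z : measurableTypeR R * Omega => 0 <= z.1 <= T).
Proof. exact: (measurableT_comp measurable_itvT). Qed.

Let itv_indE : itv_ind = \1_(`[0, T]%classic).
Proof.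
apply/funext => t; rewrite indicE /itv_ind; congr (nat_of_bool _)%:R.
by rewrite mem_setE in_itv.
Qed.

Let intble_itv_ind : intble mu itv_ind.
Proof. by rewrite itv_indE; exact: integrable_indic_itv. Qed.

Let Rintegral_itv_ind : \int[mu]_t itv_ind t = T.
Proof.
rewrite itv_indE /Rintegral integral_indic// setIT.
have /= := lebesgue_measure_itv `[0, T].
by rewrite lte_fin T0 sube0 => ->.
Qed.

Let itv_ind_idem t : itv_ind t * itv_ind t = itv_ind t.
Proof. by rewrite /itv_ind; case: (0 <= t <= T); rewrite ?mul1r ?mul0r. Qed.

Let zext_idem X z : itv_ind z.1 * zext X z = zext X z.
Proof. by rewrite /zext mulrA itv_ind_idem. Qed.

Lemma zext_itv X t w : 0 <= t <= T -> zext X (t, w) = X t w.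
Proof. by rewrite /zext /= => ->; rewrite mul1r. Qed.

Lemma zext_out X t w : ~~ (0 <= t <= T) -> zext X (t, w) = 0.
Proof. by rewrite /zext /= => /negbTE ->; rewrite mul0r. Qed.

Lemma sqint_process_cst (xi : Omega -> R) : sqintble P xi ->
  sqint_process (fun=> xi).
Proof.
move=> [mxi ixi]; split.
  apply: measurable_funM; last exact: (measurableT_comp mxi).
  by apply: measurable_fun_bool_natr; exact: measurable_itvT_fst.
have := intble_tensor intble_itv_ind ixi; congr (intble mP _).
by apply/funext => z; rewrite /zext -/(itv_ind _) exprMn [itv_ind _ ^+ 2]expr2 itv_ind_idem.
Qed.

Lemma sqint_process_intble a : sqint_process a -> intble mP (zext a).
Proof.
move=> sa; have s1 : sqint_process (fun _ _ => 1).
  apply: sqint_process_cst; split => //.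
  by apply: finite_measure_integrable_cst.
have := sqint_mul s1 sa; congr (intble mP _); apply/funext => z.
by rewrite /zext mulr1 zext_idem.
Qed.

(** Puts a running integral in the form used by [Rintegral_mul_cumulative]. *)
Lemma Rintegral_itv_zext X t w : 0 <= t <= T ->
  \int[mu]_(s in `[0, t]) X s w = \int[mu]_s ((s <= t)%R%:R * zext X (s, w)).
Proof.
move=> /andP[t0 tT]; rewrite Rintegral_mkcond; apply: eq_Rintegral => s _.
rewrite patchE mem_setE in_itv/= /zext/=.
case: (leP s t) => st; last by rewrite andbF mul0r.
by rewrite andbT (le_trans st tT) andbT mul1r; case: ifP; rewrite ?mul1r ?mul0r.
Qed.

Definition total_integral a w := \int[mu]_s zext a (s, w).

Lemma sqint_total_integral a : sqint_process a -> sqintble P (total_integral a).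
Proof.
move=> sa; have ia := sqint_process_intble sa; have [_ ia2] := sa.
have iA : intble P (total_integral a) by exact: intble_int_fst ia.
have mA := intble_meas iA; split => //.
apply: (intble_le_ae _ (intbleZ T (intble_int_fst ia2))).
  exact: measurable_funX.
apply: filterS2 (intble_snd_section ia) (intble_snd_section ia2) => w iu iu2.
rewrite ger0_norm ?sqr_ge0// /total_integral.
(* [k] is the mean of u over [0, T]. Expanding the nonnegative integral of (u - k)^2 over [0, T]
   yields the Cauchy-Schwarz bound of (int u)^2 by T int u^2. *)
set u := fun s => zext a (s, w); set k := (\int[mu]_s u s) / T.
have : 0 <= \int[mu]_s (u s - k * itv_ind s) ^+ 2.
  by apply: Rintegral_ge0 => s _; rewrite sqr_ge0.
have -> : \int[mu]_s (u s - k * itv_ind s) ^+ 2 =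
    \int[mu]_s (u s ^+ 2 + (- 2 * k * u s + k ^+ 2 * itv_ind s)).
  apply: eq_Rintegral => s _; have := zext_idem a (s, w); rewrite -/(u s) /= => cu.
  have -> : (u s - k * itv_ind s) ^+ 2 =
    u s ^+ 2 - 2 * k * (itv_ind s * u s) + k ^+ 2 * (itv_ind s * itv_ind s) by ring.
  by rewrite cu itv_ind_idem; ring.
have i2u : intble mu (fun s => - 2 * k * u s) by exact: intbleZ.
have i2i : intble mu (fun s => k ^+ 2 * itv_ind s) by exact: intbleZ.
rewrite RintegralD//; last exact: intbleD.
rewrite RintegralD// !RintegralZl// Rintegral_itv_ind.
have T0' : T != 0 by rewrite gt_eqF.
have -> : - 2 * k * (\int[mu]_s u s) + k ^+ 2 * T = - ((\int[mu]_s u s) ^+ 2 / T).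
  by rewrite /k; field.
by rewrite subr_ge0 ler_pdivrMr// mulrC.
Qed.

Lemma expectation_mul_total_integral (xi : Omega -> R) b :
  sqintble P xi -> sqint_process b ->
  \int[P]_w (xi w * total_integral b w) = \int[mP]_z (zext (fun=> xi) z * zext b z).
Proof.
move=> sxi sb; have sx := sqint_process_cst sxi.
rewrite Rintegral_prod_fst; last exact: sqint_mul.
apply: ae_eq_Rintegral.
- apply: intble_meas (sqint_mul sxi (sqint_total_integral sb)).
- by apply: intble_meas; exact: (intble_int_fst (sqint_mul sx sb)).
- apply: filterS (intble_snd_section (sqint_process_intble sb)) => w ib.
  rewrite -RintegralZl//; apply: eq_Rintegral => s _.
  by rewrite -{1}zext_idem mulrA [xi w * _]mulrC.
Qed.

(** With time as the outer variable, almost every section b_s is square integrable, and for those s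
    the martingale hypothesis exchanges I_T for I_s. *)
Lemma martingale_pairing b I : sqint_process b -> sqint_process I ->
  sqintble P (I T) ->
  (forall s, 0 <= s <= T -> sqintble P (b s) ->
    \int[P]_w (b s w * I T w) = \int[P]_w (b s w * I s w)) ->
  \int[P]_w (I T w * total_integral b w) = \int[mP]_z (zext I z * zext b z).
Proof.
move=> sb sI sIT mart; rewrite expectation_mul_total_integral//.
have sc := sqint_process_cst sIT.
have i1 := sqint_mul sc sb; have i2 := sqint_mul sI sb.
rewrite !Rintegral_prod_snd//; apply: ae_eq_Rintegral.
- by apply: intble_meas; exact: (intble_int_snd i1).
- by apply: intble_meas; exact: (intble_int_snd i2).
have [mb ib2] := sb.
apply: filterS (intble_fst_section ib2) => s ibs.
have [sT|sT] := boolP (0 <= s <= T); last first.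
  by apply: eq_Rintegral => w _; rewrite zext_out// mul0r zext_out// mul0r.
transitivity (\int[P]_w (b s w * I T w)).
  by apply: eq_Rintegral => w _; rewrite !zext_itv// mulrC.
rewrite mart//; first by apply: eq_Rintegral => w _; rewrite !zext_itv// mulrC.
have e : b s = (fun w => zext b (s, w)) by apply/funext => w; rewrite zext_itv.
rewrite e; split => //.
exact: (measurableT_comp mb (pair1_measurable s)).
Qed.

(* Integration by parts in expectation, without an Ito formula: expand
   X_T Y_T = (X_0 + A + I_T) (Y_0 + B + J_T), where A and B are the integrals of
   the drifts over [0, T]. The martingale property replaces I_T by I_s in
   E[I_T B] = E int I_T b_s ds, and A B is int (A_s b_s + B_s a_s) ds. *)
Lemma expectation_product X Y I J a b :
  sqint_process X -> sqint_process Y -> sqint_process I -> sqint_process J ->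
  sqint_process a -> sqint_process b ->
  sqintble P (X 0) -> sqintble P (Y 0) -> sqintble P (X T) -> sqintble P (Y T) ->
  sqintble P (I T) -> sqintble P (J T) ->
  {ae P, forall w, forall t, 0 <= t <= T ->
     X t w = X 0 w + \int[mu]_(s in `[0, t]) a s w + I t w} ->
  {ae P, forall w, forall t, 0 <= t <= T ->
     Y t w = Y 0 w + \int[mu]_(s in `[0, t]) b s w + J t w} ->
  \int[P]_w (X 0 w * J T w) = 0 -> \int[P]_w (Y 0 w * I T w) = 0 ->
  (forall s, 0 <= s <= T -> sqintble P (b s) ->
    \int[P]_w (b s w * I T w) = \int[P]_w (b s w * I s w)) ->
  (forall s, 0 <= s <= T -> sqintble P (a s) ->
    \int[P]_w (a s w * J T w) = \int[P]_w (a s w * J s w)) ->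
  \int[P]_w (X T w * Y T w) = \int[P]_w (X 0 w * Y 0 w) +
    \int[mP]_z (zext X z * zext b z + zext Y z * zext a z) +
    \int[P]_w (I T w * J T w).
Proof.
move=> sX sY sI sJ sa sb sX0 sY0 sXT sYT sIT sJT eX eY X0J Y0I mI mJ.
have cX0 := sqint_process_cst sX0; have cY0 := sqint_process_cst sY0.
have sA := sqint_total_integral sa; have sB := sqint_total_integral sb.
set A := total_integral a in sA *; set B := total_integral b in sB *.
have AT Z c L w : (forall t, 0 <= t <= T ->
     Z t w = Z 0 w + \int[mu]_(s in `[0, t]) c s w + L t w) ->
     Z T w = Z 0 w + total_integral c w + L T w.
  move=> ->; last by rewrite lexx ltW.
  rewrite Rintegral_itv_zext ?lexx ?ltW//; congr (_ + _ + _).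
  apply: eq_Rintegral => s _; case: (leP s T) => sT; rewrite ?mul1r//.
  by rewrite zext_out ?mulr0// negb_and -!ltNge sT orbT.
have eXY : \int[P]_w (X T w * Y T w) =
  \int[P]_w ((X 0 w + A w + I T w) * (Y 0 w + B w + J T w)).
  apply: ae_eq_Rintegral.
  - exact: intble_meas (sqint_mul sXT sYT).
  - apply: intble_meas; apply: (@sqint_mul _ _ _ P); exact: sqintD (sqintD _ _) _.
  - by apply: filterS2 eX eY => w /AT -> /AT ->.
rewrite {}eXY.
have iX0Y0 := sqint_mul sX0 sY0; have iX0B := sqint_mul sX0 sB.
have iX0J := sqint_mul sX0 sJT; have iAY0 := sqint_mul sY0 sA.
have iAB := sqint_mul sA sB; have iAJ := sqint_mul sJT sA.
have iIY0 := sqint_mul sY0 sIT; have iIB := sqint_mul sIT sB.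
have iIJ := sqint_mul sIT sJT.
(* Of the nine products, the two of an initial value with a stochastic integral vanish, and the four
   of a drift integral with an initial value or a stochastic integral become integrals over the
   product space. A B is treated separately. *)
have -> : \int[P]_w ((X 0 w + A w + I T w) * (Y 0 w + B w + J T w)) =
  \int[P]_w (X 0 w * Y 0 w + (X 0 w * B w + (X 0 w * J T w + (Y 0 w * A w +
   (A w * B w + (J T w * A w + (Y 0 w * I T w + (I T w * B w + I T w * J T w)))))))).
  by apply: eq_Rintegral => w _; ring.
rewrite [X in _ = _ + X + _]RintegralD//; [|exact: sqint_mul|exact: sqint_mul].
rewrite !RintegralD//; do ?[exact: intbleD | apply: intbleD => //].
rewrite X0J Y0I.
have i1 := sqint_mul cX0 sb; have i2 := sqint_mul cY0 sa.
have i3 := sqint_mul sI sb; have i4 := sqint_mul sJ sa.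
have -> := expectation_mul_total_integral sX0 sb.
have -> := expectation_mul_total_integral sY0 sa.
have -> := martingale_pairing sa sJ sJT mJ.
have -> := martingale_pairing sb sI sIT mI.
(* On [0, T], [A'] and [B'] are almost surely the running drift integrals. Writing them as what
   remains of X and Y gives their square integrability at once. *)
pose A' z := zext X z - (zext (fun=> X 0) z + zext I z).
pose B' z := zext Y z - (zext (fun=> Y 0) z + zext J z).
have sA' : sqintble mP A' by apply: sqintB => //; exact: sqintD.
have sB' : sqintble mP B' by apply: sqintB => //; exact: sqintD.
have i5 := sqint_mul sA' sb; have i6 := sqint_mul sB' sa.
have eAB : \int[P]_w (A w * B w) = \int[mP]_z (A' z * zext b z + B' z * zext a z).
  have i56 := intbleD i5 i6.
  rewrite Rintegral_prod_fst//; apply: ae_eq_Rintegral.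
  - exact: intble_meas iAB.
  - by apply: intble_meas; exact: intble_int_fst i56.
  have i1a := sqint_process_intble sa; have i1b := sqint_process_intble sb.
  have iab := ae_conj (intble_snd_section i1a) (intble_snd_section i1b).
  apply: filterS2 eX (ae_conj eY iab) => w hX [hY [ia ib]].
  rewrite /A /B /total_integral Rintegral_mul_cumulative//.
  apply: eq_Rintegral => s _.
  have [sT|sT] := boolP (0 <= s <= T); last by rewrite ![zext _ (s, w)]zext_out// !mulr0.
  rewrite /A' /B' -!Rintegral_itv_zext// ![zext _ (s, w)]zext_itv// hX// hY//.
  by congr (_ * _ + _ * _); ring.
rewrite eAB RintegralD//.
have -> : \int[mP]_z (zext X z * zext b z) = \int[mP]_z (A' z * zext b z +
    (zext (fun=> X 0) z * zext b z + zext I z * zext b z)).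
  by apply: eq_Rintegral => z _; rewrite /A'; ring.
have -> : \int[mP]_z (zext Y z * zext a z) = \int[mP]_z (B' z * zext a z +
    (zext (fun=> Y 0) z * zext a z + zext J z * zext a z)).
  by apply: eq_Rintegral => z _; rewrite /B'; ring.
rewrite !RintegralD//; try exact: intbleD.
ring.
Qed.

End scalar_processes.

(** * Gaussian moments *)

Section normal_moments.
Context (R : realType) (s : R).
Hypothesis s0 : 0 < s.
Local Notation mu := (@lebesgue_measure R).
Local Notation pdf := (normal_pdf 0 s).
Local Notation N := (normal_prob 0 s).

Let sn0 : s != 0. Proof. by rewrite gt_eqF. Qed.

Let cpdf : continuous pdf. Proof. exact: continuous_normal_pdf. Qed.

Let mpdf : measurable_fun setT pdf. Proof. exact: measurable_normal_pdf. Qed.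

(** The abstract Radon-Nikodym derivative of the normal law and the explicit density have the same
    integral over every measurable set, hence agree almost everywhere. *)
Lemma ge0_integral_normal_prob (f : R -> \bar R) :
  measurable_fun setT f -> (forall x, 0 <= f x)%E ->
  (\int[N]_x f x = \int[mu]_x (f x * (pdf x)%:E))%E.
Proof.
move=> mf f0; have dom : N `<< mu := normal_prob_dominates 0 s.
have jf := Radon_Nikodym_SigmaFinite.f_integrable dom.
rewrite -(Radon_Nikodym_SigmaFinite.change_of_variables dom)//.
apply: ae_eq_integral => //.
- by apply: emeasurable_funM => //; exact: measurable_int jf.
- by apply: emeasurable_funM => //; exact/measurable_EFinP.
- apply: ae_eqe_mul2l; apply: integral_ae_eq => //.
  + exact/measurable_EFinP.
  + by move=> A _ mA; rewrite -Radon_Nikodym_SigmaFinite.f_integral.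
Qed.

(** [G] is a primitive of [g]. It vanishes at 0 and at infinity, so on the half-line the integral of
    x^2 against the density is s^2 times the mass. *)
Let G (x : R) : R := - (s ^+ 2) * (x * pdf x).
Let g (x : R) : R := (x ^+ 2 - s ^+ 2) * pdf x.

Let derG (x : R) : is_derive x (1 : R) G (g x).
Proof.
rewrite /G /g normal_pdfE// /normal_fun.
apply: is_derive_eq.
rewrite /GRing.scale/= !subr0.
by field.
Qed.

Let pdf_even : pdf =1 pdf \o -%R.
Proof. by move=> x; rewrite normal_pdfE// /= /normal_fun !subr0 sqrrN. Qed.

Let cvgG : G x @[x --> +oo] --> (0 : R).
Proof.
have pk0 := normal_peak_ge0 s.
(* The constant produced by exp(-u) <= 1/u at u = x^2 / (2 s^2), which bounds |G x| by K / x. *)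
pose K := s ^+ 2 * normal_peak s * (2 * s ^+ 2).
have K0 : 0 <= K by rewrite /K; do !apply: mulr_ge0 => //; exact: ltW.
have bound x : 0 < x -> `|G x| <= K / x.
  move=> x0; rewrite /G normal_pdfE// /normal_fun subr0.
  set u := x ^+ 2 / (2 * s ^+ 2).
  have u0 : 0 < u by rewrite divr_gt0 ?exprn_gt0// mulr_gt0 ?exprn_gt0.
  rewrite (_ : - x ^+ 2 / _ = - u); last by rewrite /u; field.
  have eu : expR (- u) <= u^-1.
    rewrite expRN lef_pV2 ?posrE ?expR_gt0//.
    by apply: le_trans (expR_ge1Dx u); rewrite lerDr.
  have -> : K / x = s ^+ 2 * (x * (normal_peak s * u^-1)).
    by rewrite /K /u; field; rewrite sn0 gt_eqF.
  rewrite mulNr normrN ger0_norm; last first.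
    by rewrite !mulr_ge0 ?sqr_ge0 ?expR_ge0// ltW.
  by rewrite !ler_wpM2l ?sqr_ge0// ltW.
apply/cvgrPdist_le => e e0.
apply: filterS2 (nbhs_pinfty_gt (num_real 0)) (nbhs_pinfty_ge (num_real (K / e))) => x x0 Kx.
rewrite sub0r normrN; apply: le_trans (bound x x0) _.
by rewrite ler_pdivrMr// mulrC -ler_pdivrMr.
Qed.

Let cg : continuous g.
Proof.
move=> x; apply: cvgM; last exact: cpdf.
by apply: cvgB; [exact: exprn_continuous|exact: cvg_cst].
Qed.

Let cG : continuous G.
Proof. by move=> x; apply/differentiable_continuous/derivable1_diffP; case: (derG x). Qed.

Let q x := x ^+ 2 * pdf x.

Let cq : continuous q.
Proof. by move=> x; apply: cvgM; [exact: exprn_continuous|exact: cpdf]. Qed.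

Let q0 x : 0 <= q x. Proof. by rewrite mulr_ge0 ?sqr_ge0 ?normal_pdf_ge0. Qed.

Let gE x : q x = g x + s ^+ 2 * pdf x.
Proof. by rewrite /q /g; ring. Qed.

Let mE (f : R -> R) (D : set (measurableTypeR R)) : continuous f ->
  measurable_fun D (EFin \o f).
Proof. move=> cf; apply/measurable_EFinP; apply: measurable_funTS. exact: continuous_measurable_fun. Qed.

(** [g] is negative before s and nonnegative after it. The half-line is cut at s so that the
    improper integral of [g] has a nonnegative integrand; the two boundary values [G s] cancel. *)
Let half_second_moment : (\int[mu]_(x in `[0%R, +oo[) (q x)%:E =
  (s ^+ 2)%:E * \int[mu]_(x in `[0%R, +oo[) (pdf x)%:E)%E.
Proof.
have c2pdf : continuous (fun x => s ^+ 2 * pdf x).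
  by move=> x; apply: cvgM; [exact: cvg_cst|exact: cpdf].
have s2 : 0 <= s ^+ 2 by exact: sqr_ge0.
rewrite -ge0_integralZl_EFin//; last 2 first.
- by move=> x _; rewrite lee_fin normal_pdf_ge0.
- exact: mE.
have split (f : R -> R) : continuous f -> (forall x, 0 <= f x) ->
   (\int[mu]_(x in `[0%R, +oo[) (f x)%:E = \int[mu]_(x in `[0%R, s]) (f x)%:E +
      \int[mu]_(x in `[s, +oo[) (f x)%:E)%E.
  move=> cf f0.
  rewrite (@itv_bndbnd_setU _ _ _ (BRight s))//; last by rewrite bnd_simp ltW.
  rewrite ge0_integral_setU//=.
  - by rewrite integral_itv_obnd_cbnd//; exact: mE.
  - exact: mE.
  - by move=> x _; rewrite lee_fin.
  - apply/disj_setPS => x [/=]; rewrite !in_itv/= andbT => /andP[_ xs].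
    by rewrite ltNge xs.
rewrite split// [in RHS](_ : (fun x => _) = EFin \o (fun x => s ^+ 2 * pdf x))//.
rewrite split//; last by move=> x; rewrite mulr_ge0 ?normal_pdf_ge0.
have i0s (f : R -> R) : continuous f -> mu.-integrable `[0, s] (EFin \o f).
  move=> cf; apply: continuous_compact_integrable; first exact: segment_compact.
  exact: continuous_subspaceT.
have e1 : (\int[mu]_(x in `[0%R, s]) (q x)%:E = (G s)%:E +
    \int[mu]_(x in `[0%R, s]) ((s ^+ 2 * pdf x)%:E))%E.
  under eq_integral do rewrite gE EFinD.
  rewrite integralD//; [|exact: i0s|exact: i0s]; congr (_ + _)%E.
  rewrite (@continuous_FTC2 _ g G)//.
  - by rewrite {2}/G mul0r mulr0 sube0.
  - exact: continuous_subspaceT.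
  - split; first by move=> x _; case: (derG x).
    + by apply: cvg_at_right_filter; exact: cG.
    + by apply: cvg_at_left_filter; exact: cG.
  - by move=> x _; rewrite derive1E; exact: derive_val.
have e2 : (\int[mu]_(x in `[s, +oo[) (q x)%:E = - (G s)%:E +
    \int[mu]_(x in `[s, +oo[) ((s ^+ 2 * pdf x)%:E))%E.
  have g0 x : s <= x -> 0 <= g x.
    move=> sx; rewrite mulr_ge0 ?normal_pdf_ge0// subr_ge0 lerXn2r// nnegrE ltW//.
    exact: lt_le_trans sx.
  under eq_integral do rewrite gE EFinD.
  rewrite ge0_integralD//; last 4 first.
  - by move=> x /=; rewrite in_itv/= andbT lee_fin => /g0.
  - exact: mE.
  - by move=> x _; rewrite lee_fin mulr_ge0 ?normal_pdf_ge0.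
  - exact: mE.
  congr (_ + _)%E.
  rewrite (@ge0_continuous_FTC2y _ g G _ 0)//.
  - by rewrite sub0e.
  - exact: continuous_subspaceT.
  - by move=> x _; case: (derG x).
  - by apply: cvg_at_right_filter; exact: cG.
  - by move=> x _; rewrite derive1E; exact: derive_val.
rewrite e1 e2 addeACA -EFinN -EFinD subrr add0e//.
Qed.

Lemma integral_sqr_normal_prob : (\int[N]_x (x ^+ 2)%:E = (s ^+ 2)%:E)%E.
Proof.
rewrite ge0_integral_normal_prob; last 2 first.
- by apply/measurable_EFinP; exact: measurable_funX.
- by move=> x; rewrite lee_fin sqr_ge0.
under eq_integral do rewrite -EFinM -/(q _).
rewrite ge0_symfun_integralT//; last first.
  by move=> x; rewrite /q /= sqrrN; congr (_ * _); exact: pdf_even.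
rewrite -set_itvcy half_second_moment muleCA.
rewrite set_itvcy -ge0_symfun_integralT//; last first.
  by move=> x; exact: normal_pdf_ge0.
by rewrite integral_normal_pdf mule1.
Qed.

Lemma intble_normal_prob_id : intble N id.
Proof.
apply: (@intble_le _ _ R N id (fun x : R => 1 + x ^+ 2)) => //.
- apply: intbleD; first exact: finite_measure_integrable_cst.
  apply/integrableP; split; first by apply/measurable_EFinP; exact: measurable_funX.
  under eq_integral do rewrite /= ger0_norm ?sqr_ge0//.
  by rewrite integral_sqr_normal_prob ltry.
- move=> x; rewrite /= -[x in `|x|]mul1r; apply: le_trans (normM_le_sqr 1 x) _.
  by have := sqr_ge0 x; lra.
Qed.

(** Adding |x| reduces the claim to nonnegative integrands: x + |x| is 2 |x| on the nonnegative
    half-line and 0 on the other, so by evenness of the density it has the integral of |x|. *)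
Lemma Rintegral_normal_prob_id : \int[N]_x x = 0.
Proof.
have ii := intble_normal_prob_id.
have in_ : intble N (fun x => `|x|) := integrable_norm ii.
suff : \int[N]_x (x + `|x|) = \int[N]_x `|x| by rewrite RintegralD// => /eqP; lra.
rewrite /Rintegral; congr fine.
rewrite !ge0_integral_normal_prob//; last 2 first.
- by apply/measurable_EFinP; apply: measurable_funD.
- by move=> x; rewrite lee_fin; have := ler_norm (- x); rewrite normrN; lra.
pose h x := `|x| * pdf x.
have ch : continuous h.
  by move=> x; apply: cvgM; [exact: norm_continuous|exact: cpdf].
rewrite [RHS](_ : _ = \int[mu]_x (h x)%:E)%E; last by apply: eq_integral.
have h0 x : 0 <= h x by rewrite mulr_ge0 ?normal_pdf_ge0.
have heven : h =1 h \o -%R.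
  by move=> x; rewrite /h /= normrN; congr (_ * _); exact: pdf_even.
rewrite [RHS](ge0_symfun_integralT h0 ch heven).
rewrite -set_itvcy -ge0_integralZl_EFin//; last 2 first.
- by move=> x _; rewrite lee_fin.
- exact: mE.
rewrite [RHS]integral_mkcond; apply: eq_integral => x _.
rewrite patchE mem_setE in_itv/= andbT; case: leP => x0.
  by rewrite -!EFinM /h ger0_norm//; congr EFin; ring.
by rewrite ltr0_norm// subrr mul0e.
by apply/measurable_EFinP; exact: (@normr_measurable R setT).
Qed.

End normal_moments.

(** * Expectation of a product of independent variables *)

Section independence.
Context d (S : measurableType d) (R : realType) (P : probability S R).
Variables X Y : S -> R.
Hypotheses (mX : measurable_fun setT X) (mY : measurable_fun setT Y).
Hypothesis indep : forall A A' : set (measurableTypeR R),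
  measurable A -> measurable A' ->
  (P (X @^-1` A `&` Y @^-1` A') = P (X @^-1` A) * P (Y @^-1` A'))%E.
Hypotheses (iX : intble P X) (iY : intble P Y).

Let mX' : measurable_fun setT (X : S -> measurableTypeR R). Proof. exact: mX. Qed.
Let mY' : measurable_fun setT (Y : S -> measurableTypeR R). Proof. exact: mY. Qed.

Let rX : {mfun S >-> measurableTypeR R} := HB.pack X (isMeasurableFun.Build _ _ _ _ _ mX').
Let rY : {mfun S >-> measurableTypeR R} := HB.pack Y (isMeasurableFun.Build _ _ _ _ _ mY').

Let mXY : measurable_fun setT (fun w => (X w : measurableTypeR R, Y w : measurableTypeR R)).
Proof. exact: measurable_fun_pair. Qed.

Let rXY : {mfun S >-> (measurableTypeR R * measurableTypeR R)%type} :=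
  HB.pack (fun w => (X w, Y w)) (isMeasurableFun.Build _ _ _ _ _ mXY).

(** Independence is equality on rectangles, and a measure that agrees there with a product measure
    is that product. Integrability and expectation of X Y then follow from Fubini under the product
    of the two laws. *)
Let joint A : measurable A ->
  (distribution P rX \x distribution P rY)%E A = distribution P rXY A.
Proof. by move=> mA; apply: product_measure_unique => // B C mB mC; exact: indep. Qed.

Let intble_law (Z : {mfun S >-> measurableTypeR R}) : intble P Z ->
  intble (distribution P Z) id.
Proof.
move=> iZ; apply: integrable_pushforward => //.
by apply/measurable_EFinP; exact: measurable_id.
Qed.

Let Rintegral_law (Z : {mfun S >-> measurableTypeR R}) : intble P Z ->
  \int[distribution P Z]_x x = \int[P]_w Z w.
Proof.
move=> iZ; congr fine; by rewrite integral_distribution.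
Qed.

Let mprod : measurable_fun setT (fun z : measurableTypeR R * measurableTypeR R => z.1 * z.2).
Proof. exact: measurable_funM. Qed.

Lemma intble_mul_indep : intble P (fun w => X w * Y w).
Proof.
have /integrableP[_ fin] := intble_tensor (intble_law (Z := rX) iX) (intble_law (Z := rY) iY).
apply/integrableP; split; first by apply/measurable_EFinP; exact: measurable_funM.
move: fin; rewrite (eq_measure_integral (distribution P rXY)); last first.
  by move=> A mA _; exact: joint.
rewrite ge0_integral_distribution//.
by apply: measurableT_comp => //; exact/measurable_EFinP.
Qed.

Lemma expectation_mul_indep :
  \int[P]_w (X w * Y w) = (\int[P]_w X w) * (\int[P]_w Y w).
Proof.
rewrite -(@Rintegral_law rX iX) -(@Rintegral_law rY iY).
have iX' := @intble_law rX iX; have iY' := @intble_law rY iY.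
rewrite -RintegralZr//.
transitivity (\int[(distribution P rX \x distribution P rY)%E]_z (z.1 * z.2)).
  rewrite /Rintegral; congr fine.
  rewrite [RHS](eq_measure_integral (distribution P rXY)); last first.
    by move=> A mA _; exact: joint.
  rewrite integral_distribution//; first (by apply/measurable_EFinP; exact: mprod).
  exact: intble_mul_indep.
rewrite Rintegral_prod_snd; last exact: (intble_tensor iX' iY').
by apply: eq_Rintegral => x _; rewrite RintegralZl.
Qed.

End independence.

(** * The Brownian filtration *)

Section matrix_measurability.
Context (R : realType) d (S : measurableType d) (p q : nat).
Implicit Types (D : set S) (F : S -> 'M[R]_(p, q)).

Lemma measurable_entry (i : 'I_p) (j : 'I_q) :
  measurable_fun setT (fun M : 'M[R]_(p, q) => M i j).
Proof.
move=> _ A mA; rewrite setTI; apply: sub_gen_smallest; by exists i, j, A.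
Qed.

Lemma measurable_fun_mxP D F :
  measurable_fun D F <-> forall i j, measurable_fun D (fun w => F w i j).
Proof.
split=> [mF i j|mF mD]; first exact: (measurableT_comp (measurable_entry i j)).
apply: (measurability (@matrix_entry_sets R p q)) => //.
move=> _ [_ [i [j [A [mA ->]]] <-]].
exact: mF.
Qed.

End matrix_measurability.

Section filtration.
Context (R : realType) (disp : measure_display) (Omega : measurableType disp).
Variables (P : probability Omega R) (d : nat) (B : R -> Omega -> 'cV[R]_d).
Hypotheses (cP : measure_is_complete P) (hB : brownian_motion P B).

Definition filtration_type (t : R) :=
  g_sigma_algebraType (history_sets B t `|` [set N | P.-negligible N]).

(* [filtration P B t] is the sigma-algebra of the measurable type
   [filtration_type t] on the points of [Omega]. *)
Definition fmeasurable (t : R) (f : Omega -> R) :=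
  measurable_fun [set: filtration_type t] f.

Lemma fmeasurableP t f : fmeasurable t f <->
  forall A : set (measurableTypeR R), measurable A -> filtration P B t (f @^-1` A).
Proof.
split=> [mf A mA|mf _ A mA]; last by rewrite setTI; exact: mf.
by rewrite -[_ @^-1` _]setTI; exact: mf.
Qed.

Lemma history_sets_measurable t : 0 <= t -> history_sets B t `<=` measurable.
Proof.
move=> t0 A [s [D [/andP[s0 _] mD ->]]]; rewrite -[_ @^-1` _]setTI.
exact: (bm_measurable hB s0).
Qed.

(** Completeness makes the added negligible sets measurable. *)
Lemma filtration_measurable t : 0 <= t -> filtration P B t `<=` measurable.
Proof.
move=> t0; apply: smallest_sub; first exact: sigma_algebra_measurable.
by move=> A [/(history_sets_measurable t0)//|/cP].
Qed.

Lemma filtration_le s t : s <= t -> filtration P B s `<=` filtration P B t.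
Proof.
move=> st; apply: sub_smallest2r; first exact: smallest_sigma_algebra.
move=> A [[r [D [/andP[r0 rs] mD ->]]]|]; last by right.
by left; exists r, D; split => //; rewrite r0 (le_trans rs).
Qed.

Lemma fmeasurable_measurable t f : 0 <= t -> fmeasurable t f -> measurable_fun setT f.
Proof.
move=> t0 /fmeasurableP mf _ A mA; rewrite setTI.
by apply: (filtration_measurable t0); exact: mf.
Qed.

Lemma fmeasurable_le s t f : s <= t -> fmeasurable s f -> fmeasurable t f.
Proof.
move=> st /fmeasurableP mf; apply/fmeasurableP => A mA.
by apply: (filtration_le st); exact: mf.
Qed.

Lemma fmeasurable_brownian t i : 0 <= t -> fmeasurable t (fun w => B t w i 0).
Proof.
move=> t0; apply/fmeasurableP => A mA; apply: sub_gen_smallest; left.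
exists t, ((fun M : 'cV[R]_d => M i 0) @^-1` A); split => //; first by rewrite t0 lexx.
by apply: sub_gen_smallest; exists i, 0, A.
Qed.

(** The sets that differ from a set of the raw history by a negligible set form a sigma-algebra, and
    it contains both kinds of generators. *)
Lemma filtration_history s E : filtration P B s E ->
  exists2 E', <<s history_sets B s >> E' & P.-negligible ((E `\` E') `|` (E' `\` E)).
Proof.
pose G : set (set Omega) := [set E | exists2 E', <<s history_sets B s >> E' &
  P.-negligible ((E `\` E') `|` (E' `\` E))].
have sG : sigma_algebra setT G.
  split.
  - exists set0; first exact: sigma_algebra0.
    by rewrite !setD0 setU0; exact: negligible_set0.
  - move=> A [A' sA' nA]; exists (setT `\` A'); first exact: sigma_algebraCD.
    apply: negligibleS nA => x [[[_ nAx] h]|[[_ nAx] h]].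
      by right; split => //; apply: contrapT => ?; apply: h.
    by left; split => //; apply: contrapT => ?; apply: h.
  - move=> A hA; have /choice[A' hA'] n : exists A', <<s history_sets B s >> A' /\
        P.-negligible ((A n `\` A') `|` (A' `\` A n)).
      by have [A' ? ?] := hA n; exists A'.
    exists (\bigcup_k A' k); first by apply: sigma_algebra_bigcup => k; case: (hA' k).
    apply: (@negligibleS _ _ _ _ (\bigcup_k ((A k `\` A' k) `|` (A' k `\` A k)))).
      move=> x [[[k _ Akx] h]|[[k _ Akx] h]]; exists k => //; [left|right]; split => //;
        by move=> ?; apply: h; exists k.
    by apply: negligible_bigcup => k; case: (hA' k).
suff fG : filtration P B s `<=` G by move=> /fG.
apply: smallest_sub => // A [hA|nA].
  exists A; first exact: sub_gen_smallest.
  by rewrite setDv setU0; exact: negligible_set0.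
exists set0; first exact: sigma_algebra0.
by rewrite setD0 set0D setU0.
Qed.

Definition increment s t l (w : Omega) : R := (B t w - B s w) l 0.

Lemma incrementE s t l w : increment s t l w = B t w l 0 - B s w l 0.
Proof. by rewrite /increment mxE mxE. Qed.

Lemma measurable_increment s t l : 0 <= s -> 0 <= t -> measurable_fun setT (increment s t l).
Proof.
move=> s0 t0; rewrite (_ : increment s t l = fun w => B t w l 0 - B s w l 0); last first.
  by apply/funext => w; rewrite incrementE.
by apply: measurable_funB; exact: fmeasurable_measurable (fmeasurable_brownian _ _).
Qed.

(** Independence of the increments is given for the raw history. Replacing E by a raw set that
    differs negligibly changes neither probability. *)
Lemma filtration_indep s t E (D : set 'cV[R]_d) : 0 <= s -> s < t ->
  filtration P B s E -> measurable D ->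
  (P (E `&` (fun w => B t w - B s w)%R @^-1` D) =
   P E * P ((fun w => B t w - B s w)%R @^-1` D))%E.
Proof.
move=> s0 st fE mD; have [E' hE' nE] := filtration_history fE.
have mE : measurable E := filtration_measurable s0 fE.
have mE' : measurable E'.
  have : <<s history_sets B s >> `<=` measurable; last exact.
  apply: smallest_sub; first exact: sigma_algebra_measurable.
  exact: history_sets_measurable.
set V := _ @^-1` D.
have mV : measurable V.
  rewrite /V -[_ @^-1` _]setTI.
  suff : measurable_fun setT (fun w => B t w - B s w) by apply.
  apply/measurable_fun_mxP => i j; rewrite [j]ord1.
  exact: measurable_increment (ltW (le_lt_trans s0 st)).
have aeE F F' : measurable F -> measurable F' ->
    P.-negligible ((F `\` F') `|` (F' `\` F)) -> P F = P F'.
  move=> mF mF' nF.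
  have n1 : P (F `\` F') = 0%E.
    by apply/negligibleP; [exact: measurableD|apply: negligibleS nF => x; left].
  have n2 : P (F' `\` F) = 0%E.
    by apply/negligibleP; [exact: measurableD|apply: negligibleS nF => x; right].
  apply: (eq_trans (measureDI P mF mF')); apply/esym.
  apply: (eq_trans (measureDI P mF' mF)).
  by congr (_ + _)%E; [rewrite [LHS]n2 [RHS]n1|rewrite setIC].
rewrite (aeE (E `&` V) (E' `&` V)) ?(aeE E E')//; last 3 first.
- exact: measurableI.
- exact: measurableI.
- by apply: negligibleS nE => x [[[Ex Vx] h]|[[Ex Vx] h]]; [left|right]; split => // ?; apply: h.
exact: (bm_independent hB).
Qed.

End filtration.

(** * Moments of Brownian increments *)

Section increments.
Context (R : realType) (disp : measure_display) (Omega : measurableType disp).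
Variables (P : probability Omega R) (d : nat) (B : R -> Omega -> 'cV[R]_d).
Hypotheses (cP : measure_is_complete P) (hB : brownian_motion P B).

Local Notation incr := (increment B).
Local Notation fmeas := (fmeasurable P B).

Section strict.
Variables s t : R.
Hypotheses (s0 : 0 <= s) (st : s < t).
Let t0 : 0 <= t := le_trans s0 (ltW st).
Let sd := Num.sqrt (t - s).
Local Notation N := (normal_prob 0 sd).
Let sd0 : 0 < sd. Proof. by rewrite sqrtr_gt0 subr_gt0. Qed.
Let mW l : measurable_fun setT (incr s t l) := measurable_increment cP hB l s0 t0.
Let mW' l : measurable_fun setT (incr s t l : Omega -> measurableTypeR R).
Proof. exact: mW. Qed.

Let rW l : {mfun Omega >-> measurableTypeR R} :=
  HB.pack (incr s t l) (isMeasurableFun.Build _ _ _ _ _ (mW' l)).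

Let NT : N setT = 1%E. Proof. exact: probability_setT. Qed.

(** Taking the whole line for every other component leaves a single factor in the product formula;
    [law2] keeps two factors in the same way. *)
Let law l (A : set (measurableTypeR R)) : measurable A ->
  distribution P (rW l) A = N A.
Proof.
move=> mA; have := bm_gaussian hB s0 st (A := fun i => if i == l then A else setT).
rewrite (_ : [set w | _] = rW l @^-1` A); last first.
  apply/seteqP; split=> w /= => [/(_ l)|Aw i]; first by rewrite eqxx.
  by case: eqP => // ->.
move=> /(_ _) h; rewrite /distribution /pushforward h; last by move=> i; case: ifP.
rewrite (bigD1 l)//= eqxx big1 ?mulr1; last first.
  by move=> i /negbTE ->; rewrite -[LHS]/(fine (N setT)) NT.
by rewrite fineK// fin_num_measure.
Qed.

Let law2 l l' (A A' : set (measurableTypeR R)) : l != l' ->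
  measurable A -> measurable A' ->
  (P (incr s t l @^-1` A `&` incr s t l' @^-1` A') =
   P (incr s t l @^-1` A) * P (incr s t l' @^-1` A'))%E.
Proof.
move=> ll mA mA'.
have := bm_gaussian hB s0 st
  (A := fun i => if i == l then A else if i == l' then A' else setT).
rewrite (_ : [set w | _] = incr s t l @^-1` A `&` incr s t l' @^-1` A'); last first.
  apply/seteqP; split=> w /= => [h|[Aw A'w] i].
    by split; [have := h l; rewrite eqxx|have := h l'; rewrite eq_sym (negbTE ll) eqxx].
  by case: eqP => [->//|_]; case: eqP => [->//|_].
move=> /(_ _) ->; last by move=> i; case: ifP => // _; case: ifP.
have ll2 : l' != l by rewrite eq_sym.
rewrite (bigD1 l)//= eqxx (bigD1 l')//= (negbTE ll2) eqxx.
rewrite big1 ?mulr1; last first.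
  by move=> i /andP[/negbTE -> /negbTE ->]; rewrite -[LHS]/(fine (N setT)) NT.
by rewrite EFinM !fineK ?fin_num_measure// -(law l)// -(law l').
Qed.

Let second_moment l : (\int[P]_w (incr s t l w ^+ 2)%:E = (t - s)%:E)%E.
Proof.
have /= <- := @ge0_integral_distribution _ _ _ _ R P (rW l) (fun x => (x ^+ 2)%:E).
- rewrite (eq_measure_integral N); last by move=> A mA _; exact: law.
  by rewrite integral_sqr_normal_prob// sqr_sqrtr// subr_ge0 ltW.
- by apply/measurable_EFinP; exact: measurable_funX.
- by move=> x; rewrite lee_fin sqr_ge0.
Qed.

Lemma sqint_increment_lt l : sqintble P (incr s t l).
Proof. by apply: sqint_ltoo => //; rewrite second_moment ltry. Qed.

Let intble_incr l : intble P (incr s t l).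
Proof.
have s1 : sqintble P (fun=> 1) by split => //; exact: finite_measure_integrable_cst.
by have := sqint_mul s1 (sqint_increment_lt l); under [X in intble P X]eq_fun do rewrite mul1r.
Qed.

Let first_moment l : \int[P]_w incr s t l w = 0.
Proof.
rewrite /Rintegral -(@integral_distribution _ _ _ _ R P (rW l) EFin)//.
  rewrite (eq_measure_integral N); last by move=> A mA _; exact: law.
  exact: Rintegral_normal_prob_id.
exact: intble_incr.
Qed.

Let covariance l l' : \int[P]_w (incr s t l w * incr s t l' w) = (l == l')%:R * (t - s).
Proof.
have [<-|ll] := eqVneq l l'.
  rewrite mul1r -[RHS]/(fine (t - s)%:E) -(second_moment l) /Rintegral.
  by congr fine; apply: eq_integral => w _; rewrite expr2.
rewrite expectation_mul_indep// ?first_moment ?mul0r//.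
by move=> A A' mA mA'; exact: law2.
Qed.

Let indep_fmeas (g : 'cV[R]_d -> R) (xi : Omega -> R) (A A' : set (measurableTypeR R)) :
  measurable_fun setT g -> fmeas s xi -> measurable A -> measurable A' ->
  (P (xi @^-1` A `&` (fun w => g (B t w - B s w)%R) @^-1` A') =
   P (xi @^-1` A) * P ((fun w => g (B t w - B s w)%R) @^-1` A'))%E.
Proof.
move=> mg /fmeasurableP mxi mA mA'.
apply: (filtration_indep cP hB (D := g @^-1` A')) => //; first exact: mxi.
by rewrite -[_ @^-1` _]setTI; exact: mg.
Qed.

(** The increment is independent of what is known at s, so the expectation factors, and the
    increment is centred. *)
Lemma mul_increment_lt l xi : fmeas s xi -> intble P xi ->
  intble P (fun w => xi w * incr s t l w) /\
  \int[P]_w (xi w * incr s t l w) = 0.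
Proof.
move=> fxi ixi; have ind := indep_fmeas (measurable_entry l 0) fxi.
have mxi := intble_meas ixi.
split; first exact: (intble_mul_indep mxi (mW l) ind ixi (intble_incr l)).
by rewrite (expectation_mul_indep mxi (mW l) ind ixi (intble_incr l)) first_moment mulr0.
Qed.

Lemma mul_increment2_lt l l' xi : fmeas s xi -> intble P xi ->
  intble P (fun w => xi w * (incr s t l w * incr s t l' w)) /\
  \int[P]_w (xi w * (incr s t l w * incr s t l' w)) =
    (l == l')%:R * (t - s) * \int[P]_w xi w.
Proof.
move=> fxi ixi; have mxi := intble_meas ixi.
have mg : measurable_fun setT (fun M : 'cV[R]_d => M l 0 * M l' 0).
  by apply: measurable_funM; exact: measurable_entry.
have ind := indep_fmeas mg fxi.
have mWW := measurable_funM (mW l) (mW l').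
have iWW := sqint_mul (sqint_increment_lt l) (sqint_increment_lt l').
split; first exact: (intble_mul_indep mxi mWW ind ixi iWW).
by rewrite (expectation_mul_indep mxi mWW ind ixi iWW) covariance mulrC.
Qed.

End strict.

(** The Gaussian law is available for s < t; at s = t the increment is 0. The following lemmas add
    this degenerate case in the same way. *)
Lemma sqint_increment s t l : 0 <= s -> s <= t -> sqintble P (incr s t l).
Proof.
move=> s0; rewrite le_eqVlt => /predU1P[->|st]; last first.
  exact: sqint_increment_lt.
rewrite (_ : incr t t l = fun=> 0); first exact: sqint0.
by apply/funext => w; rewrite incrementE subrr.
Qed.

Lemma intble_mul_increment s t l xi : 0 <= s -> s <= t ->
  fmeas s xi -> intble P xi -> intble P (fun w => xi w * incr s t l w).
Proof.
move=> s0; rewrite le_eqVlt => /predU1P[-> _ _|st fxi ixi]; last first.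
  by case: (mul_increment_lt s0 st l fxi ixi).
under [X in intble P X]eq_fun do rewrite incrementE subrr mulr0.
exact: intble0.
Qed.

Lemma expectation_mul_increment s t l xi : 0 <= s -> s <= t ->
  fmeas s xi -> intble P xi -> \int[P]_w (xi w * incr s t l w) = 0.
Proof.
move=> s0; rewrite le_eqVlt => /predU1P[-> _ _|st fxi ixi]; last first.
  by case: (mul_increment_lt s0 st l fxi ixi).
under eq_Rintegral do rewrite incrementE subrr mulr0.
by rewrite Rintegral_cst// mul0r.
Qed.

Lemma expectation_mul_increment2 s t l l' xi : 0 <= s -> s <= t ->
  fmeas s xi -> intble P xi ->
  \int[P]_w (xi w * (incr s t l w * incr s t l' w)) =
    (l == l')%:R * (t - s) * \int[P]_w xi w.
Proof.
move=> s0; rewrite le_eqVlt => /predU1P[-> _ _|st fxi ixi]; last first.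
  by case: (mul_increment2_lt s0 st l l' fxi ixi).
under eq_Rintegral do rewrite incrementE subrr mul0r mulr0.
by rewrite Rintegral_cst// subrr mulr0 !mul0r.
Qed.

End increments.

(** * Matrix-valued processes *)

Section matrix_norms.
Context (R : realType) (p q : nat).
Implicit Types A C : 'M[R]_(p, q).

Lemma innerE A C : inner A C = \sum_i \sum_j A i j * C i j.
Proof.
rewrite /inner /mxtrace exchange_big/=; apply: eq_bigr => j _.
by rewrite mxE; apply: eq_bigr => i _; rewrite mxE.
Qed.

Lemma innerC A C : inner A C = inner C A.
Proof. by rewrite /inner -mxtrace_tr trmx_mul trmxK. Qed.

Lemma innerN A C : inner A (- C) = - inner A C.
Proof. by rewrite /inner mulmxN linearN. Qed.

Lemma innerD A C D : inner A (C + D) = inner A C + inner A D.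
Proof. by rewrite /inner mulmxDr linearD. Qed.

Lemma innerB A C D : inner A (C - D) = inner A C - inner A D.
Proof. by rewrite innerD innerN. Qed.

Lemma innerZ A (a : R) C : inner A (a *: C) = a * inner A C.
Proof. by rewrite /inner -scalemxAr linearZ. Qed.

Lemma inner0 A : inner A 0 = 0.
Proof. by rewrite /inner mulmx0 mxtrace0. Qed.

Lemma sqnormE A : sqnorm A = \sum_i \sum_j A i j ^+ 2.
Proof. by rewrite /sqnorm innerE; under eq_bigr do under eq_bigr do rewrite -expr2. Qed.

Lemma sqr_entry_le A i j : A i j ^+ 2 <= sqnorm A.
Proof.
rewrite sqnormE (bigD1 i)//= (bigD1 j)//= -addrA lerDl addr_ge0//.
  by apply: sumr_ge0 => k _; exact: sqr_ge0.
by apply: sumr_ge0 => k _; apply: sumr_ge0 => l _; exact: sqr_ge0.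
Qed.

Lemma sqnorm_ge0 A : 0 <= sqnorm A.
Proof. by rewrite sqnormE; apply: sumr_ge0 => i _; apply: sumr_ge0 => j _; exact: sqr_ge0. Qed.

Lemma entry_le_enorm A i j : `|A i j| <= enorm A.
Proof. by rewrite -sqrtr_sqr; apply: ler_wsqrtr; exact: sqr_entry_le. Qed.

End matrix_norms.

(** * Joint measurability of continuous processes *)

Section joint_measurability.
Context (R : realType) (disp : measure_display) (Omega : measurableType disp).
Variable T : R.
Hypothesis T0 : 0 < T.
Local Notation mu := (@lebesgue_measure R).
Implicit Types X : R -> Omega -> R.

Let strip : set (measurableTypeR R * Omega) := (`[0, T] : set (measurableTypeR R)) `*` setT.

Lemma zextE X : zext T X = (fun z => X z.1 z.2) \_ strip.
Proof.
apply/funext => z; rewrite /zext patchE /strip.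
have -> : (z \in ((`[0, T] : set (measurableTypeR R)) `*` (setT : set Omega))) = (0 <= z.1 <= T).
  by apply/asboolP/idP => [[]|]; rewrite /= in_itv.
by case: ifP; rewrite ?mul1r ?mul0r.
Qed.

Let mstrip : measurable strip.
Proof. by apply: measurableX => //; exact: measurable_itv. Qed.

Lemma measurable_zextP X :
  measurable_fun strip (fun z => X z.1 z.2) <-> measurable_fun setT (zext T X).
Proof. by rewrite zextE; exact: measurable_restrictT. Qed.

Lemma measurable_zext_continuous X :
  (forall t, 0 <= t <= T -> measurable_fun setT (X t)) ->
  (forall w, {within `[0, T], continuous (fun t => X t w)}) ->
  measurable_fun setT (zext T X).
Proof.
move=> mX cX.
pose N n : R := n.+1%:R.
have N0 n : 0 < N n by rewrite /N ltr0n.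
(* The value 0 stands in for grid points beyond T, where no measurability of X is assumed; [hE]
   shows that on [0, T] the selected value is always one of X. *)
pose g n k : Omega -> R := if (k%:R / N n <= T)%R then X (k%:R / N n) else fun=> 0.
pose h n (z : measurableTypeR R * Omega) : R := (0 <= z.1 <= T)%R%:R *
  \sum_(k < (Num.truncn (T * N n)).+1) (k%:R <= z.1 * N n < k.+1%:R)%R%:R * g n k z.2.
pose tau n (t : R) : R := (Num.truncn (t * N n))%:R / N n.
have hE n t w : 0 <= t <= T -> h n (t, w) = X (tau n t) w.
  move=> /andP[t0 tT]; rewrite /h /= t0 tT mul1r.
  have tN0 : 0 <= t * N n by rewrite mulr_ge0// ltW.
  have kb : (Num.truncn (t * N n) < (Num.truncn (T * N n)).+1)%N.
    by rewrite ltnS; apply: le_truncn; rewrite ler_wpM2r// ltW.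
  rewrite (bigD1 (Ordinal kb))//= truncn_itv// mul1r big1 ?addr0.
    rewrite /g ifT// ler_pdivrMr// (le_trans _ (_ : t * N n <= _))//.
      by rewrite truncn_le.
    by rewrite ler_wpM2r// ltW.
  move=> k /eqP nk; have [/andP[k1 k2]|] := boolP (_ <= _ < _); last by rewrite mul0r.
  exfalso; apply: nk; apply/val_inj => /=; apply/esym.
  by apply: truncn_def; rewrite k1.
have tauT n t : 0 <= t <= T -> 0 <= tau n t <= T.
  move=> /andP[t0 tT]; have tN0 : 0 <= t * N n by rewrite mulr_ge0// ltW.
  rewrite /tau; apply/andP; split; first by rewrite divr_ge0// ltW.
  rewrite ler_pdivrMr// (le_trans _ (_ : t * N n <= _))//.
    by rewrite truncn_le.
  by rewrite ler_wpM2r// ltW.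
have tau_near n t : 0 <= t <= T -> `|t - tau n t| <= (N n)^-1.
  move=> /andP[t0 tT]; have tN0 : 0 <= t * N n by rewrite mulr_ge0// ltW.
  have /andP[k1 k2] := truncn_itv tN0.
  have e : t - tau n t = (t * N n - (Num.truncn (t * N n))%:R) / N n.
    by rewrite /tau; field; rewrite gt_eqF.
  have Ni0 : 0 <= (N n)^-1 by rewrite invr_ge0 ltW.
  rewrite e normrM (ger0_norm Ni0).
  rewrite ler_piMl// ger0_norm ?subr_ge0//.
  by move: k2; rewrite -natr1; lra.
have mh n : measurable_fun setT (h n).
  apply: measurable_funM.
    by apply: measurable_fun_bool_natr; exact: measurable_itvT_fst.
  apply: measurable_sum => k; apply: measurable_funM.
    have mN : measurable_fun setT (fun z : measurableTypeR R * Omega => (z.1 : R) * N n).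
      by apply: measurable_funM.
    apply: measurable_fun_bool_natr; apply: measurable_and.
      exact: measurable_fun_ler.
    exact: measurable_fun_ltr.
  apply: measurableT_comp => //; rewrite /g; case: ifP => // kT.
  by apply: mX; rewrite kT divr_ge0// ltW.
apply: (measurable_fun_cvg mh) => -[t w] _.
have [tT|tT] := boolP (0 <= t <= T); last first.
  rewrite zext_out// (_ : h ^~ (t, w) = fun=> 0); first exact: cvg_cst.
  by apply/funext => n; rewrite /h /= (negbTE tT) mul0r.
rewrite zext_itv// (_ : h ^~ (t, w) = fun n => X (tau n t) w); last first.
  by apply/funext => n; exact: hE.
have /subspace_continuousP/(_ t) := cX w; rewrite /= in_itv/= => /(_ tT) ct.
apply: (cvg_comp (tau^~ t) (fun t => X t w) _ ct).
move=> A /= [e /= e0 eA].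
rewrite /nbhs /= /fmap /=.
near=> n; apply: eA => /=; last by rewrite in_itv/=; exact: tauT.
apply: le_lt_trans (tau_near n t tT) _.
by near: n; exact: near_infty_natSinv_lt (PosNum e0).
Unshelve. all: by end_near. Qed.

End joint_measurability.

(** * Ito integrals *)

Section simple_integrals.
Context (R : realType) (disp : measure_display) (Omega : measurableType disp).
Variables (P : probability Omega R) (d : nat) (B : R -> Omega -> 'cV[R]_d) (T : R).
Hypotheses (cP : measure_is_complete P) (hB : brownian_motion P B) (T0 : 0 < T).
Local Notation mu := (@lebesgue_measure R).
Local Notation mP := (mu \x P)%E.
Local Notation incr := (increment B).
Local Notation fmeas := (fmeasurable P B).
Implicit Types u v xi : Omega -> R.

Definition bounded_fmeas s u := fmeas s u /\ exists C, forall w, `|u w| <= C.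

Lemma bounded_fmeas_sqint s u : 0 <= s -> bounded_fmeas s u -> sqintble P u.
Proof.
move=> s0 [fu [C uC]]; apply: (@sqint_le _ _ _ P _ (fun=> C)).
- exact: fmeasurable_measurable fu.
- by split => //; exact: finite_measure_integrable_cst.
- by move=> w; apply: le_trans (uC w) (ler_norm _).
Qed.

Lemma bounded_fmeasM s u v : bounded_fmeas s u -> bounded_fmeas s v ->
  bounded_fmeas s (fun w => u w * v w).
Proof.
move=> [fu [C uC]] [fv [C' vC]]; split; first exact: (@measurable_funM _ (filtration_type P B s)).
by exists (C * C') => w; rewrite normrM ler_pM.
Qed.

Lemma bounded_fmeas_le s t u : s <= t -> bounded_fmeas s u -> bounded_fmeas t u.
Proof. by move=> st [fu bu]; split => //; exact: fmeasurable_le fu. Qed.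

Lemma sqint_mul_bounded u f : measurable_fun setT u ->
  (exists C, forall w, `|u w| <= C) -> sqintble P f -> sqintble P (fun w => u w * f w).
Proof.
move=> mu_ [C uC] sf; have [mf _] := sf.
apply: (sqint_le _ (sqintZ C sf)); first exact: measurable_funM.
by move=> w; rewrite !normrM ler_wpM2r//; exact: le_trans (uC w) (ler_norm _).
Qed.

Lemma fmeasurable_increment s t l : 0 <= s -> s <= t -> fmeas t (incr s t l).
Proof.
move=> s0 st; rewrite (_ : incr s t l = fun w => B t w l 0 - B s w l 0); last first.
  by apply/funext => w; rewrite incrementE.
apply: (@measurable_funB _ (filtration_type P B t)).
  by apply: fmeasurable_brownian; exact: le_trans st.
by apply: fmeasurable_le st _; exact: fmeasurable_brownian.
Qed.

Lemma increment_split a b c l w : incr a c l w = incr a b l w + incr b c l w.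
Proof. by rewrite !incrementE; ring. Qed.

Lemma sqint_bounded_increment s a b l u : 0 <= s -> bounded_fmeas s u ->
  0 <= a -> a <= b -> sqintble P (fun w => u w * incr a b l w).
Proof.
move=> s0 [fu bu] a0 ab; apply: sqint_mul_bounded => //.
  exact: fmeasurable_measurable fu.
exact: sqint_increment.
Qed.

(* Each factor is bounded or an increment, and the last increment starts after
   the time where the other factors are known. *)
Let pairing_orthogonal s a b a' b' l l' u : 0 <= s -> bounded_fmeas s u ->
  s <= a' -> 0 <= a -> a <= b -> b <= a' -> a' <= b' ->
  \int[P]_w ((u w * incr a b l w) * incr a' b' l' w) = 0.
Proof.
move=> s0 bu sa' a0 ab ba' ab'.
have a'0 : 0 <= a' := le_trans s0 sa'.
apply: (expectation_mul_increment cP hB) => //.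
- apply: (@measurable_funM _ (filtration_type P B a')).
    exact: (bounded_fmeas_le sa' bu).1.
  by apply: (fmeasurable_le ba'); exact: fmeasurable_increment.
- have i1 := bounded_fmeas_sqint s0 bu; have i2 := sqint_increment cP hB l a0 ab.
  exact: sqint_mul.
Qed.

(** If b <= b', the longer increment is the shorter one plus the increment over [b, b'], which is
    orthogonal to what is known at b. *)
Let pairing_same_start s b b' l l' u : 0 <= s -> bounded_fmeas s u ->
  s <= b -> s <= b' ->
  \int[P]_w ((u w * incr s b l w) * incr s b' l' w) =
  (l == l')%:R * (Num.min b b' - s) * \int[P]_w u w.
Proof.
wlog bb' : b b' l l' / b <= b' => [hw|] s0 bu sb sb'.
  case: (leP b b') => bb'.
    by have := hw b b' l l' bb' s0 bu sb sb'; rewrite (min_idPl bb').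
  have := hw b' b l' l (ltW bb') s0 bu sb' sb.
  rewrite (min_idPl (ltW bb')) eq_sym => <-.
  by apply: eq_Rintegral => w _; rewrite mulrAC.
rewrite (min_idPl bb').
have su := bounded_fmeas_sqint s0 bu.
have b0 : 0 <= b := le_trans s0 sb.
have iu : intble P u.
  have s1 : sqintble P (fun=> 1) by split => //; exact: finite_measure_integrable_cst.
  by have := sqint_mul s1 su; under [X in intble P X]eq_fun do rewrite mul1r.
have i1 : sqintble P (fun w => u w * incr s b l w) by exact: (sqint_bounded_increment _ s0 bu).
have i2 : sqintble P (incr s b l') by exact: sqint_increment.
have i3 : sqintble P (incr b b' l') by exact: sqint_increment.
transitivity (\int[P]_w ((u w * incr s b l w) * incr s b l' w +
                         (u w * incr s b l w) * incr b b' l' w)).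
  by apply: eq_Rintegral => w _; rewrite (increment_split s b b'); ring.
rewrite RintegralD//; [|exact: sqint_mul|exact: sqint_mul].
have -> : \int[P]_w ((u w * incr s b l w) * incr b b' l' w) = 0.
  exact: (pairing_orthogonal (s := s)).
rewrite addr0.
rewrite -(expectation_mul_increment2 cP hB l l' s0 sb bu.1 iu).
by apply: eq_Rintegral => w _; rewrite mulrA.
Qed.

(** The length of the intersection of two half-open intervals. As an integral it can be recognized
    directly when Fubini is applied to the product of two steps. *)
Let overlap a b a' b' : R :=
  \int[mu]_t ((a < t <= b)%R%:R * (a' < t <= b')%R%:R).

Let overlapC a b a' b' : overlap a b a' b' = overlap a' b' a b.
Proof. by apply: eq_Rintegral => t _; rewrite mulrC. Qed.

Let overlapE a b a' b' : a <= a' ->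
  overlap a b a' b' = if (a' < Num.min b b')%R then Num.min b b' - a' else 0.
Proof.
move=> aa'; rewrite /overlap.
transitivity (\int[mu]_t (\1_(`]a', Num.min b b']%classic) t : R)).
  apply: eq_Rintegral => t _; rewrite indicE mem_setE in_itv/= le_min.
  case: (ltP a' t) => a't; rewrite ?mulr0//= (le_lt_trans aa' a't)/=.
  by case: (t <= b); rewrite ?mul0r// mul1r.
rewrite /Rintegral integral_indic// setIT.
have /= -> := lebesgue_measure_itv `]a', Num.min b b'].
by rewrite lte_fin; case: ifP.
Qed.

(** With a <= a', the increment over [a, b] is cut at a'. The piece before a' is known when the
    second increment starts and contributes 0; the two remaining increments start together. *)
Lemma elementary_isometry a b a' b' l l' u v :
  0 <= a -> a <= b -> 0 <= a' -> a' <= b' ->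
  bounded_fmeas a u -> bounded_fmeas a' v ->
  \int[P]_w ((u w * incr a b l w) * (v w * incr a' b' l' w)) =
  (l == l')%:R * overlap a b a' b' * \int[P]_w (u w * v w).
Proof.
wlog aa' : a b a' b' l l' u v / a <= a' => [hw|] a0 ab a'0 ab' bu bv.
  case: (leP a a') => aa'; first exact: hw.
  have -> : \int[P]_w (u w * v w) = \int[P]_w (v w * u w).
    by apply: eq_Rintegral => w _; rewrite mulrC.
  rewrite overlapC eq_sym -hw//; last exact: ltW.
  by apply: eq_Rintegral => w _; rewrite mulrC.
have buv := bounded_fmeasM (bounded_fmeas_le aa' bu) bv.
rewrite overlapE//.
transitivity (\int[P]_w ((u w * v w * incr a b l w) * incr a' b' l' w)).
  by apply: eq_Rintegral => w _; ring.
case: (leP b a') => ba'.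
  by rewrite (pairing_orthogonal (s := a'))// lt_min ltNge ba' mulr0 mul0r.
transitivity (\int[P]_w ((u w * v w * incr a a' l w) * incr a' b' l' w +
                         (u w * v w * incr a' b l w) * incr a' b' l' w)).
  by apply: eq_Rintegral => w _; rewrite (increment_split a a' b); ring.
have i1 : sqintble P (fun w => u w * v w * incr a a' l w).
  exact: (sqint_bounded_increment _ a'0 buv).
have i2 : sqintble P (fun w => u w * v w * incr a' b l w).
  by apply: (sqint_bounded_increment _ a'0 buv) => //; exact: ltW.
have i3 : sqintble P (incr a' b' l') by exact: sqint_increment.
rewrite RintegralD//; [|exact: sqint_mul|exact: sqint_mul].
have -> : \int[P]_w ((u w * v w * incr a a' l w) * incr a' b' l' w) = 0.
  exact: (pairing_orthogonal (s := a')).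
rewrite add0r pairing_same_start ?(ltW ba')//.
(* The intersection can be empty here only if b' = a', and then the length b' - a' is 0 as well. *)
rewrite lt_min ba'/=; case: ltP => // b'a'.
have -> : b' = a' by apply/eqP; rewrite eq_le b'a'.
by rewrite (min_idPr (ltW ba')) subrr.
Qed.

(** The first interval lies in [0, T], so the cut-off made by [zext] has no effect on the
    product. *)
Let overlap_product a b a' b' u v : 0 <= a -> b <= T ->
  0 <= a' -> bounded_fmeas a u -> bounded_fmeas a' v ->
  \int[mP]_z (zext T (fun t w => (a < t <= b)%R%:R * u w) z *
              zext T (fun t w => (a' < t <= b')%R%:R * v w) z) =
  overlap a b a' b' * \int[P]_w (u w * v w).
Proof.
move=> a0 bT a'0 bu bv.
have iuv : intble P (fun w => u w * v w).
  by apply: sqint_mul; [exact: bounded_fmeas_sqint bu|exact: bounded_fmeas_sqint bv].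
have mi (x y : R) : measurable_fun setT (fun t : measurableTypeR R => x < t <= y).
  by apply: measurable_and; [exact: measurable_fun_ltr|exact: measurable_fun_ler].
have ii : intble mu (fun t => (a < t <= b)%R%:R * (a' < t <= b')%R%:R).
  have : intble mu (\1_(`]a, b]%classic) : R -> R) by exact: integrable_indic_itv.
  move=> /(intble_mul_bool (mi a' b')); congr (intble mu _).
  by apply/funext => t; rewrite mulrC indicE mem_setE in_itv.
rewrite /overlap -RintegralZr//.
have -> : \int[mu]_t ((a < t <= b)%R%:R * (a' < t <= b')%R%:R * \int[P]_w (u w * v w)) =
    \int[mP]_z (((a < z.1 <= b)%R%:R * (a' < z.1 <= b')%R%:R) * (u z.2 * v z.2)).
  rewrite Rintegral_prod_snd; last exact: (intble_tensor ii iuv).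
  by apply: eq_Rintegral => t _ /=; rewrite RintegralZl.
apply: eq_Rintegral => -[t w] _; rewrite /zext/=.
have [/andP[at_ tb]|_] := boolP (a < t <= b); last by rewrite !(mul0r, mulr0).
by rewrite (le_trans a0 (ltW at_)) (le_trans tb bT) !mul1r; ring.
Qed.

Section one_process.
Variables (p : nat) (S : @simple_process R disp Omega d p).
Hypothesis hS : nonanticipative P B T S.

Lemma simple_integral_entry t w i : simple_integral B S t w i 0 =
  \sum_(k < sp_size S) \sum_l sp_val S k w i l *
    incr (Num.min (sp_time S k) t) (Num.min (sp_time S k.+1) t) l w.
Proof. by rewrite /simple_integral summxE; apply: eq_bigr => k _; rewrite mxE. Qed.

Lemma simple_eval_entry t w i l : simple_eval S t w i l =
  \sum_(k < sp_size S) (sp_time S k < t <= sp_time S k.+1)%R%:R * sp_val S k w i l.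
Proof.
rewrite /simple_eval summxE; apply: eq_bigr => k _.
by case: ifP => _; rewrite ?mul1r// mul0r mxE.
Qed.

Lemma bounded_fmeas_sp_val (k : 'I_(sp_size S)) i l :
  bounded_fmeas (sp_time S k) (fun w => sp_val S k w i l).
Proof.
have [_ _ _ mS [C hC]] := hS (ltn_ord k); split.
  apply/fmeasurableP => A mA.
  apply: (mS ((fun M : 'M[R]_(p, d) => M i l) @^-1` A)).
  by rewrite -[_ @^-1` _]setTI; exact: measurable_entry.
by exists C => w; apply: le_trans (hC w); exact: entry_le_enorm.
Qed.

Lemma sqint_simple_integral t i : 0 <= t ->
  sqintble P (fun w => simple_integral B S t w i 0).
Proof.
move=> t0; under [X in sqintble P X]eq_fun do rewrite simple_integral_entry.
apply: sqint_sum => k _; apply: sqint_sum => l _.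
have [k0 kS _ _ _] := hS (ltn_ord k).
apply: (sqint_bounded_increment _ k0 (bounded_fmeas_sp_val k i l)).
  by rewrite le_min k0.
by rewrite le_min ge_min kS/= ge_min lexx orbT.
Qed.

(** The difference of the integral at T and at s is a sum of increments from max(t_k, s) to
    max(t_{k+1}, s). Its coefficients, also after multiplication by [xi], are known at the left end,
    so every term has expectation 0. *)
Lemma simple_integral_martingale s i xi : 0 <= s <= T -> fmeas s xi -> sqintble P xi ->
  \int[P]_w (xi w * simple_integral B S T w i 0) =
  \int[P]_w (xi w * simple_integral B S s w i 0).
Proof.
move=> /andP[s0 sT] fxi sxi.
have iT : intble P (fun w => xi w * simple_integral B S T w i 0).
  by apply: sqint_mul => //; apply: sqint_simple_integral; exact: ltW.
have is_ : intble P (fun w => xi w * simple_integral B S s w i 0).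
  by apply: sqint_mul => //; exact: sqint_simple_integral.
apply/eqP; rewrite -subr_eq0 -RintegralB//; apply/eqP.
transitivity (\int[P]_w \sum_(k < sp_size S) \sum_l ((xi w * sp_val S k w i l) *
    incr (Num.max (sp_time S k) s) (Num.max (sp_time S k.+1) s) l w)).
  apply: eq_Rintegral => w _; rewrite !simple_integral_entry -mulrBr -sumrB mulr_sumr.
  apply: eq_bigr => k _; rewrite -sumrB mulr_sumr; apply: eq_bigr => l _.
  have [_ kS kT _ _] := hS (ltn_ord k).
  rewrite (min_idPl kT) (min_idPl (le_trans kS kT)) -mulrBr -mulrA.
  congr (_ * (_ * _)); rewrite !incrementE.
  (* The pair {x, s} equals the pair {min, max}. This trades the minima in the definition of the
     integral for maxima. *)
  have minmax x : B x w l 0 + B s w l 0 = B (Num.min x s) w l 0 + B (Num.max x s) w l 0.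
    by case: (leP x s) => // _; rewrite addrC.
  by have := minmax (sp_time S k); have := minmax (sp_time S k.+1); lra.
have f1 (k : 'I_(sp_size S)) l :
    fmeas (Num.max (sp_time S k) s) (fun w => xi w * sp_val S k w i l).
  apply: (@measurable_funM _ (filtration_type P B _)).
    by apply: fmeasurable_le fxi; rewrite le_max lexx orbT.
  by apply: fmeasurable_le (bounded_fmeas_sp_val k i l).1; rewrite le_max lexx.
have f2 (k : 'I_(sp_size S)) l : intble P (fun w => xi w * sp_val S k w i l).
  have [k0 _ _ _ _] := hS (ltn_ord k).
  by apply: sqint_mul => //; apply: (bounded_fmeas_sqint k0); exact: bounded_fmeas_sp_val.
have f3 (k : 'I_(sp_size S)) : 0 <= Num.max (sp_time S k) s by rewrite le_max s0 orbT.
have f4 (k : 'I_(sp_size S)) : Num.max (sp_time S k) s <= Num.max (sp_time S k.+1) s.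
  by have [_ kS _ _ _] := hS (ltn_ord k); rewrite ge_max !le_max kS lexx orbT.
rewrite Rintegral_sum => [|k _].
  apply: big1 => k _; rewrite Rintegral_sum => [|l _]; last exact: intble_mul_increment.
  by apply: big1 => l _; exact: expectation_mul_increment.
by apply: intble_sum => l _; exact: intble_mul_increment.
Qed.

Lemma simple_integral0 i w : simple_integral B S 0 w i 0 = 0.
Proof.
rewrite simple_integral_entry big1// => k _; rewrite big1// => l _.
have [k0 kS _ _ _] := hS (ltn_ord k).
by rewrite (min_idPr k0) (min_idPr (le_trans k0 kS)) incrementE subrr mulr0.
Qed.

Let eval_term (k : 'I_(sp_size S)) i l t w :=
  (sp_time S k < t <= sp_time S k.+1)%R%:R * sp_val S k w i l.

Lemma sqint_process_step a b u : 0 <= a -> bounded_fmeas a u ->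
  sqint_process P T (fun t w => (a < t <= b)%R%:R * u w).
Proof.
move=> a0 bu; have := sqint_process_cst T (bounded_fmeas_sqint a0 bu).
have mi : measurable_fun setT (fun z : measurableTypeR R * Omega => a < z.1 <= b).
  by apply: measurable_and; [exact: measurable_fun_ltr|exact: measurable_fun_ler].
move=> h; apply: (sqint_le _ h).
  rewrite (_ : zext T _ = fun z => (a < z.1 <= b)%R%:R * zext T (fun _ => u) z).
    by apply: measurable_funM; [exact: measurable_fun_bool_natr|case: h].
  by apply/funext => z; rewrite /zext; ring.
move=> z; rewrite /zext mulrCA normrM; case: (a < z.1 <= b); rewrite ?normr1 ?mul1r//.
by rewrite normr0 mul0r.
Qed.

Lemma sqint_process_eval_term (k : 'I_(sp_size S)) i l : sqint_process P T (eval_term k i l).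
Proof.
have [k0 _ _ _ _] := hS (ltn_ord k).
exact: sqint_process_step (bounded_fmeas_sp_val k i l).
Qed.

Lemma zext_simple_eval i l z : zext T (fun t w => simple_eval S t w i l) z =
  \sum_(k < sp_size S) zext T (eval_term k i l) z.
Proof. by rewrite /zext simple_eval_entry mulr_sumr. Qed.

Lemma sqint_process_simple_eval i l :
  sqint_process P T (fun t w => simple_eval S t w i l).
Proof.
rewrite /sqint_process (_ : zext T _ = fun z => \sum_(k < sp_size S) zext T (eval_term k i l) z).
  by apply: sqint_sum => k _; exact: sqint_process_eval_term.
by apply/funext => z; exact: zext_simple_eval.
Qed.

End one_process.

(** Both sides are bilinear, so single steps are compared; different Brownian components contribute
    0. The form with two integrands is needed for the covariation of a state process with an adjoint
    process. *)
Lemma simple_integral_isometry p p' (S : @simple_process R disp Omega d p)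
    (S' : @simple_process R disp Omega d p') i i' :
  nonanticipative P B T S -> nonanticipative P B T S' ->
  \int[P]_w (simple_integral B S T w i 0 * simple_integral B S' T w i' 0) =
  \sum_l \int[mP]_z (zext T (fun t w => simple_eval S t w i l) z *
                     zext T (fun t w => simple_eval S' t w i' l) z).
Proof.
move=> hS hS'.
have tm q (Q : @simple_process R disp Omega d q) (hQ : nonanticipative P B T Q)
    (k : 'I_(sp_size Q)) : [/\ 0 <= sp_time Q k, sp_time Q k <= sp_time Q k.+1 &
    sp_time Q k.+1 <= T] by have [] := hQ _ (ltn_ord k).
have sq q (Q : @simple_process R disp Omega d q) (hQ : nonanticipative P B T Q)
    (k : 'I_(sp_size Q)) j l :
    sqintble P (fun w => sp_val Q k w j l * incr (sp_time Q k) (sp_time Q k.+1) l w).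
  have [h1 h2 _] := tm _ _ hQ k.
  exact: (sqint_bounded_increment _ h1 (bounded_fmeas_sp_val hQ k j l)).
have ent q (Q : @simple_process R disp Omega d q) (hQ : nonanticipative P B T Q) j w :
    simple_integral B Q T w j 0 = \sum_(k < sp_size Q) \sum_l
      (sp_val Q k w j l * incr (sp_time Q k) (sp_time Q k.+1) l w).
  rewrite simple_integral_entry; apply: eq_bigr => k _; apply: eq_bigr => l _.
  have [_ h2 h3] := tm _ _ hQ k.
  by rewrite (min_idPl h3) (min_idPl (le_trans h2 h3)).
transitivity (\int[P]_w \sum_(k < sp_size S) \sum_l \sum_(k' < sp_size S') \sum_l'
   ((sp_val S k w i l * incr (sp_time S k) (sp_time S k.+1) l w) *
    (sp_val S' k' w i' l' * incr (sp_time S' k') (sp_time S' k'.+1) l' w))).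
  apply: eq_Rintegral => w _; rewrite !ent// mulr_suml; apply: eq_bigr => k _.
  rewrite mulr_suml; apply: eq_bigr => l _; rewrite mulr_sumr; apply: eq_bigr => k' _.
  by rewrite mulr_sumr.
have i4 (k : 'I_(sp_size S)) l (k' : 'I_(sp_size S')) l' : intble P (fun w =>
   (sp_val S k w i l * incr (sp_time S k) (sp_time S k.+1) l w) *
    (sp_val S' k' w i' l' * incr (sp_time S' k') (sp_time S' k'.+1) l' w)).
  exact: sqint_mul (sq _ _ hS k i l) (sq _ _ hS' k' i' l').
pose ov (k : 'I_(sp_size S)) (k' : 'I_(sp_size S')) :=
  overlap (sp_time S k) (sp_time S k.+1) (sp_time S' k') (sp_time S' k'.+1).
pose ev (k : 'I_(sp_size S)) l (k' : 'I_(sp_size S')) l' :=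
  \int[P]_w (sp_val S k w i l * sp_val S' k' w i' l').
transitivity (\sum_(k < sp_size S) \sum_l \sum_(k' < sp_size S')
    ov k k' * ev k l k' l).
  rewrite Rintegral_sum => [|k _]; last first.
    by apply: intble_sum => l _; apply: intble_sum => k' _; exact: intble_sum.
  apply: eq_bigr => k _; rewrite Rintegral_sum => [|l _]; last first.
    by apply: intble_sum => k' _; exact: intble_sum.
  apply: eq_bigr => l _; rewrite Rintegral_sum => [|k' _]; last exact: intble_sum.
  apply: eq_bigr => k' _; rewrite Rintegral_sum => [|l' _]; last exact: i4.
  have [a0 ab _] := tm _ _ hS k; have [a'0 ab' _] := tm _ _ hS' k'.
  rewrite (bigD1 l)//= big1 ?addr0 => [|l' /negbTE ll'].
    rewrite elementary_isometry ?eqxx ?mul1r//; exact: bounded_fmeas_sp_val.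
  rewrite elementary_isometry ?(eq_sym l l') ?ll' ?mul0r//; exact: bounded_fmeas_sp_val.
rewrite exchange_big/=; apply: eq_bigr => l _.
pose e k t w := (sp_time S k < t <= sp_time S k.+1)%R%:R * sp_val S k w i l.
pose e' k t w := (sp_time S' k < t <= sp_time S' k.+1)%R%:R * sp_val S' k w i' l.
have i5 (k : 'I_(sp_size S)) (k' : 'I_(sp_size S')) :
    intble mP (fun z => zext T (e k) z * zext T (e' k') z).
  exact: sqint_mul (sqint_process_eval_term hS k i l) (sqint_process_eval_term hS' k' i' l).
transitivity (\int[mP]_z \sum_(k < sp_size S) \sum_(k' < sp_size S')
    (zext T (e k) z * zext T (e' k') z)); last first.
  apply: eq_Rintegral => z _; rewrite !zext_simple_eval mulr_suml; apply: eq_bigr => k _.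
  by rewrite mulr_sumr.
rewrite Rintegral_sum => [|k _]; last exact: intble_sum.
apply: eq_bigr => k _; rewrite Rintegral_sum//; apply: eq_bigr => k' _.
have [a0 ab bT] := tm _ _ hS k; have [a'0 ab' _] := tm _ _ hS' k'.
by rewrite overlap_product//; exact: bounded_fmeas_sp_val.
Qed.

End simple_integrals.

(** * Matrix-valued L2 convergence, entry by entry *)

Section matrix_L2.
Context (R : realType) d (S : measurableType d) (m : {measure set S -> \bar R}).
Variables (p q : nat).
Implicit Types F : S -> 'M[R]_(p, q).

Lemma measurable_sqnorm F : measurable_fun setT F ->
  measurable_fun setT (fun x => sqnorm (F x)).
Proof.
move=> /measurable_fun_mxP mF; under eq_fun do rewrite sqnormE.
by apply: measurable_sum => i; apply: measurable_sum => j; exact: measurable_funX.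
Qed.

Lemma sqint_entry F i j : measurable_fun setT F ->
  (\int[m]_x (sqnorm (F x))%:E < +oo)%E -> sqintble m (fun x => F x i j).
Proof.
move=> mF; have mFij := (measurable_fun_mxP _ _).1 mF i j => fin.
apply: sqint_ltoo => //; apply: le_lt_trans fin; apply: ge0_le_integral => //.
- by move=> x _; rewrite lee_fin sqr_ge0.
- by apply/measurable_EFinP; exact: measurable_funX.
- by apply/measurable_EFinP; exact: measurable_sqnorm.
- by move=> x _; rewrite lee_fin sqr_entry_le.
Qed.

(** The square of an entry is at most the squared norm, so the real integrals are squeezed between 0
    and a sequence tending to 0. *)
Lemma entry_L2_cvg (F : nat -> S -> 'M[R]_(p, q)) (G : S -> 'M[R]_(p, q)) i j :
  (forall n, sqintble m (fun x => F n x i j)) ->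
  (forall n, measurable_fun setT (F n)) -> measurable_fun setT G ->
  (\int[m]_x (sqnorm (F n x - G x))%:E)%E @[n --> \oo] --> 0%E ->
  sqintble m (fun x => G x i j) /\
  \int[m]_x (F n x i j - G x i j) ^+ 2 @[n --> \oo] --> 0.
Proof.
move=> sF mF mG cv; have /fine_cvgP[fin cvfine] := cv.
have mD n : measurable_fun setT (fun x => F n x - G x).
  apply/measurable_fun_mxP => k l.
  rewrite (_ : (fun w => _) = fun w => F n w k l - G w k l); last first.
    by apply/funext => w; rewrite !mxE.
  by apply: measurable_funB; exact: (measurable_fun_mxP _ _).1.
have De n x : (F n x - G x) i j = F n x i j - G x i j by rewrite !mxE.
have sG : sqintble m (fun x => G x i j).
  (* Convergence to 0 in the extended reals makes some distance finite; at that index the entry of G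
     is a difference of two square-integrable functions. *)
  have [N _ /(_ N (leqnn N)) finN] := fin.
  have sD : sqintble m (fun x => (F N x - G x) i j).
    by apply: sqint_entry => //; rewrite ltey_eq finN.
  have := sqintB (sF N) sD; congr (sqintble m _); apply/funext => x.
  by rewrite De; ring.
split=> //.
apply: (@squeeze_cvgr _ _ _ _ (fun=> 0) (fun n => fine (\int[m]_x (sqnorm (F n x - G x))%:E)%E)).
- apply: filterS fin => n fn; apply/andP; split.
    by apply: Rintegral_ge0 => x _; exact: sqr_ge0.
  apply: fine_le => //.
    have [_ h] := sqintB (sF n) sG; exact: integrable_fin_num h.
  apply: ge0_le_integral => //.
  + by move=> x _; rewrite lee_fin sqr_ge0.
  + by have [_ /intble_meas h] := sqintB (sF n) sG; exact/measurable_EFinP.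
  + by apply/measurable_EFinP; exact: measurable_sqnorm.
  + by move=> x _; rewrite lee_fin -De sqr_entry_le.
- exact: cvg_cst.
- exact: cvfine.
Qed.

End matrix_L2.

Lemma continuous_entry (R : realType) (p q : nat) (D : set R) (F : R -> 'M[R]_(p, q)) i j :
  {within D, continuous F} -> {within D, continuous (fun t => F t i j)}.
Proof.
move=> cF t; apply: (cvg_comp F (fun M : 'M[R]_(p, q) => M i j) (cF t)).
exact: coord_continuous.
Qed.

Section processes.
Context (R : realType) (disp : measure_display) (Omega : measurableType disp).
Variables (P : probability Omega R) (T : R).
Hypothesis T0 : 0 < T.
Local Notation mu := (@lebesgue_measure R).
Local Notation mP := (mu \x P)%E.

Lemma iterated_zext (X : R -> Omega -> R) :
  (forall t w, 0 <= X t w) -> measurable_fun setT (zext T X) ->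
  (\int[P]_w \int[mu]_(t in `[0%R, T]) (X t w)%:E = \int[mP]_z (zext T X z)%:E)%E.
Proof.
move=> X0 mX; rewrite fubini_tonelli2//; last 2 first.
- exact/measurable_EFinP.
- by move=> z; rewrite lee_fin mulr_ge0.
apply: eq_integral => w _; rewrite integral_mkcond; apply: eq_integral => t _.
by rewrite patchE mem_setE in_itv/= /zext/=; case: ifP => _; rewrite ?mul1r ?mul0r.
Qed.

Definition zext_mx p q (X : R -> Omega -> 'M[R]_(p, q)) (z : measurableTypeR R * Omega) :
    'M[R]_(p, q) :=
  (0 <= z.1 <= T)%R%:R *: X z.1 z.2.

Lemma zext_mxE p q (X : R -> Omega -> 'M[R]_(p, q)) z i j :
  zext_mx X z i j = zext T (fun t w => X t w i j) z.
Proof. by rewrite mxE. Qed.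

Lemma zext_sqnorm p q (X : R -> Omega -> 'M[R]_(p, q)) z :
  zext T (fun t w => sqnorm (X t w)) z = sqnorm (zext_mx X z).
Proof.
rewrite /zext /zext_mx; case: (0 <= z.1 <= T); rewrite ?mul1r ?scale1r// mul0r scale0r.
by rewrite sqnormE big1// => i _; rewrite big1// => j _; rewrite mxE expr0n.
Qed.

Lemma measurable_zext_mx p q (X : R -> Omega -> 'M[R]_(p, q)) :
  measurable_fun ((`[0, T] : set (measurableTypeR R)) `*` setT)
        (fun tw : measurableTypeR R * Omega => X tw.1 tw.2) ->
  measurable_fun setT (zext_mx X).
Proof.
move=> mX; apply/measurable_fun_mxP => i j.
rewrite (_ : (fun w => _) = zext T (fun t w => X t w i j)).
  by apply/(measurable_zextP T); exact: (measurable_fun_mxP _ _).1.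
by apply/funext => z; rewrite zext_mxE.
Qed.

Lemma iterated_sqnorm p q (X : R -> Omega -> 'M[R]_(p, q)) :
  measurable_fun setT (zext_mx X) ->
  (\int[P]_w \int[mu]_(t in `[0%R, T]) (sqnorm (X t w))%:E =
   \int[mP]_z (sqnorm (zext_mx X z))%:E)%E.
Proof.
move=> mX; rewrite iterated_zext; last 2 first.
- by move=> t w; exact: sqnorm_ge0.
- rewrite (_ : zext T _ = fun z => sqnorm (zext_mx X z)); first exact: measurable_sqnorm.
  by apply/funext => z; rewrite zext_sqnorm.
by apply: eq_integral => z _; rewrite zext_sqnorm.
Qed.

(** Tonelli with time outside: the inner integral is at most K on [0, T] and 0 elsewhere. *)
Lemma sqint_process_bounded (X : R -> Omega -> R) K :
  measurable_fun setT (zext T X) ->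
  (forall t, 0 <= t <= T -> sqintble P (X t) /\ \int[P]_w (X t w ^+ 2) <= K) ->
  sqint_process P T X.
Proof.
move=> mX hK; split => //; apply/integrableP; split.
  by apply/measurable_EFinP; exact: measurable_funX.
have mX2 : measurable_fun setT (fun z => `|(zext T X z ^+ 2)%:E|%E).
  by apply: measurableT_comp => //; apply/measurable_EFinP; exact: measurable_funX.
rewrite fubini_tonelli1//.
apply: (@le_lt_trans _ _ (\int[mu]_t (K * \1_(`[0, T]%classic) t)%:E)%E).
  apply: ge0_le_integral => //.
  - by move=> t _; exact: integral_ge0.
  - exact: measurable_fun_fubini_tonelli_F.
  - by apply/measurable_EFinP; apply: measurable_funM => //; exact: measurable_indic.
  move=> t _; rewrite /fubini_F indicE mem_setE in_itv/=.
  have [tT|tT] := boolP (0 <= t <= T); last first.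
    by rewrite integral0_eq ?mulr0// => w _; rewrite zext_out// expr0n normr0.
  have [[_ iX2] bK] := hK t tT.
  rewrite mulr1 -(lee_fin _ K) in bK *; apply: le_trans bK.
  rewrite /Rintegral fineK; last exact: integrable_fin_num iX2.
  rewrite le_eqVlt; apply/orP; left; apply/eqP; apply: eq_integral => w _.
  by rewrite zext_itv// ger0_norm ?sqr_ge0.
have h : intble mu (fun t => K * \1_(`[0, T]%classic) t).
  by apply: intbleZ; exact: integrable_indic_itv.
by rewrite ltey_eq (integrable_fin_num _ h).
Qed.

End processes.

(** * Martingale property and isometry of the Ito integral *)

Section ito.
Context (R : realType) (disp : measure_display) (Omega : measurableType disp).
Variables (P : probability Omega R) (d : nat) (B : R -> Omega -> 'cV[R]_d) (T : R).
Hypotheses (cP : measure_is_complete P) (hB : brownian_motion P B) (T0 : 0 < T).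
Local Notation mu := (@lebesgue_measure R).
Local Notation mP := (mu \x P)%E.
Local Notation fmeas := (fmeasurable P B).

Lemma measurable_at_fmeas t p q (X : Omega -> 'M[R]_(p, q)) i j :
  measurable_at P B t X -> fmeas t (fun w => X w i j).
Proof.
move=> mX; apply/fmeasurableP => A mA.
apply: (mX ((fun M : 'M[R]_(p, q) => M i j) @^-1` A)).
by rewrite -[_ @^-1` _]setTI; exact: measurable_entry.
Qed.

Lemma measurable_at_measurable t p q (X : Omega -> 'M[R]_(p, q)) :
  0 <= t -> measurable_at P B t X -> measurable_fun setT X.
Proof.
move=> t0 mX; apply/measurable_fun_mxP => i j.
by apply: (fmeasurable_measurable cP hB t0); exact: measurable_at_fmeas.
Qed.

Lemma M2_sqint_process p q (X : R -> Omega -> 'M[R]_(p, q)) i j :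
  M2 P B T X -> sqint_process P T (fun t w => X t w i j).
Proof.
move=> [mX _ fin]; have mz := measurable_zext_mx mX.
have := @sqint_entry _ _ _ mP _ _ (zext_mx T X) i j mz.
rewrite -iterated_sqnorm// => /(_ fin); congr (sqintble mP _).
by apply/funext => z; rewrite zext_mxE.
Qed.

Section one_integral.
Variables (p : nat) (gamma : R -> Omega -> 'M[R]_(p, d)) (I : R -> Omega -> 'cV[R]_p).
Hypothesis hI : ito_integral P B T gamma I.

(** Unfolds the defining approximation into entries and into one integral over the product space,
    the form to which [sqint_pairing_cvg] applies. *)
Lemma ito_integral_approx : exists S : nat -> @simple_process R disp Omega d p,
  [/\ forall j, nonanticipative P B T (S j),
      forall i l, \int[mP]_z (zext T (fun t w => simple_eval (S j) t w i l) z -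
          zext T (fun t w => gamma t w i l) z) ^+ 2 @[j --> \oo] --> 0,
      forall t i, 0 <= t <= T -> sqintble P (fun w => I t w i 0) &
      forall t i, 0 <= t <= T ->
        \int[P]_w (simple_integral B (S j) t w i 0 - I t w i 0) ^+ 2
          @[j --> \oo] --> 0].
Proof.
have [mG _ aI [S [naS evS siS]]] := hI; exists S.
have mS j : measurable_fun setT (zext_mx T (simple_eval (S j))).
  apply/measurable_fun_mxP => i l.
  rewrite (_ : (fun w => _) = zext T (fun t w => simple_eval (S j) t w i l)).
    by case: (sqint_process_simple_eval cP hB (naS j) i l).
  by apply/funext => z; rewrite zext_mxE.
have mgam : measurable_fun setT (zext_mx T gamma) by case: mG => /measurable_zext_mx.
have At t i : 0 <= t <= T -> sqintble P (fun w => I t w i 0) /\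
   \int[P]_w (simple_integral B (S j) t w i 0 - I t w i 0) ^+ 2 @[j --> \oo] --> 0.
  move=> tT; have /andP[t0 _] := tT.
  have sS j k : sqintble P (fun w => simple_integral B (S j) t w k 0).
    exact: (sqint_simple_integral cP hB (naS j) _ t0).
  apply: (entry_L2_cvg (F := fun j w => simple_integral B (S j) t w)).
  - by move=> j; exact: sS.
  - by move=> j; apply/measurable_fun_mxP => k l; rewrite [l]ord1; case: (sS j k).
  - exact: measurable_at_measurable (aI _ tT).
  - exact: siS.
split => //; last 2 first.
- by move=> t i tT; case: (At t i tT).
- by move=> t i tT; case: (At t i tT).
move=> i l.
have := @entry_L2_cvg _ _ _ mP _ _ (fun j => zext_mx T (simple_eval (S j))) (zext_mx T gamma) i l.
move=> /(_ _ mS mgam)[].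
- move=> j; rewrite (_ : (fun x => _) = zext T (fun t w => simple_eval (S j) t w i l)).
    exact: (sqint_process_simple_eval cP hB (naS j)).
  by apply/funext => z; rewrite zext_mxE.
- have e j : (\int[mP]_z (sqnorm (zext_mx T (simple_eval (S j)) z - zext_mx T gamma z))%:E =
      \int[P]_w \int[mu]_(t in `[0%R, T]) (sqnorm (simple_eval (S j) t w - gamma t w))%:E)%E.
    rewrite (@iterated_sqnorm R _ _ P T _ _ (fun t w => simple_eval (S j) t w - gamma t w)).
      by apply: eq_integral => z _; rewrite /zext_mx scalerBr.
    apply/measurable_fun_mxP => k k'.
    rewrite (_ : (fun w => _) = fun z => zext_mx T (simple_eval (S j)) z k k' -
                                         zext_mx T gamma z k k').
      by apply: measurable_funB; exact: (measurable_fun_mxP _ _).1.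
    by apply/funext => z; rewrite /zext_mx !mxE; ring.
  by under eq_cvg do rewrite e.
- by move=> _; under eq_cvg do under eq_Rintegral do rewrite !zext_mxE.
Qed.

Lemma sqint_ito t i : 0 <= t <= T -> sqintble P (fun w => I t w i 0).
Proof. by have [S [_ _ h _]] := ito_integral_approx; exact: h. Qed.

Let cst_cvg xi : sqintble P xi ->
  \int[P]_w ((fun _ : nat => xi) j w - xi w) ^+ 2 @[j --> \oo] --> (0 : R).
Proof.
move=> _; rewrite (_ : (fun _ => _) = fun=> 0); first exact: cvg_cst.
apply/funext => j; under eq_Rintegral do rewrite subrr expr0n/=.
by rewrite Rintegral_cst// mul0r.
Qed.

(** The pairings of [xi] with the simple integrals at T and at s form the same sequence, and each
    side is a limit of it. *)
Lemma ito_martingale s i xi : 0 <= s <= T -> fmeas s xi -> sqintble P xi ->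
  \int[P]_w (xi w * I T w i 0) = \int[P]_w (xi w * I s w i 0).
Proof.
move=> sT fxi sxi; have [S [naS _ sI cI]] := ito_integral_approx.
have TT : 0 <= T <= T by rewrite lexx ltW.
have lim t : 0 <= t <= T -> \int[P]_w (xi w * simple_integral B (S j) t w i 0) @[j --> \oo]
    --> \int[P]_w (xi w * I t w i 0).
  move=> tT; have /andP[t0 _] := tT.
  apply: (sqint_pairing_cvg (F := fun _ => xi)) => //.
  - exact: sI.
  - by move=> j; exact: (sqint_simple_integral cP hB (naS j)).
  - exact: cst_cvg.
  - exact: cI.
have := lim T TT.
rewrite (_ : (fun j => _) = fun j => \int[P]_w (xi w * simple_integral B (S j) s w i 0)).
  by move=> h; exact: (cvg_unique _ h (lim s sT)).
by apply/funext => j; exact: (simple_integral_martingale cP hB T0 (naS j) i sT fxi sxi).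
Qed.

(** A weak form of I_0 = 0 almost surely, inherited from simple integrals, which vanish at time
    0. *)
Lemma ito_initial i xi : sqintble P xi -> \int[P]_w (xi w * I 0 w i 0) = 0.
Proof.
move=> sxi; have [S [naS _ sI cI]] := ito_integral_approx.
have TT : (0 : R) <= 0 <= T by rewrite lexx ltW.
have h1 : \int[P]_w (xi w * simple_integral B (S j) 0 w i 0) @[j --> \oo] -->
    \int[P]_w (xi w * I 0 w i 0).
  apply: (sqint_pairing_cvg (F := fun _ => xi)) => //.
  - exact: sI.
  - by move=> j; exact: (sqint_simple_integral cP hB (naS j)).
  - exact: cst_cvg.
  - exact: cI.
have h0 : \int[P]_w (xi w * simple_integral B (S j) 0 w i 0) @[j --> \oo] --> (0 : R).
  rewrite (_ : (fun _ => _) = fun=> 0); first exact: cvg_cst.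
  apply/funext => j; under eq_Rintegral do rewrite (simple_integral0 (naS _)) mulr0.
  by rewrite Rintegral_cst// mul0r.
exact: (cvg_unique _ h1 h0).
Qed.

(* The second moment of a martingale is nondecreasing in time. *)
Lemma sqint_process_ito i : sqint_process P T (fun t w => I t w i 0).
Proof.
have [_ cI aI _] := hI; set X := fun t w => I t w i 0.
have mX : measurable_fun setT (zext T X).
  apply: measurable_zext_continuous => //.
    by move=> t tT; case: (sqint_ito i tT).
  by move=> w; exact: continuous_entry.
have TT : 0 <= T <= T by rewrite lexx ltW.
set K := \int[P]_w (X T w ^+ 2).
have bound t : 0 <= t <= T -> \int[P]_w (X t w ^+ 2) <= K.
  move=> tT; have st := sqint_ito i tT; have sT := sqint_ito i TT.
  (* The martingale property tested against X_t itself gives E X_t^2 = E X_t X_T, which is at most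
     half the sum of the two second moments. *)
  have := ito_martingale i tT (measurable_at_fmeas i 0 (aI _ tT)) st.
  have [_ it2] := st; have [_ iT2] := sT; have ii := sqint_mul st sT.
  have h : \int[P]_w (X t w * X T w) <= \int[P]_w (2^-1 * (X t w ^+ 2 + X T w ^+ 2)).
    apply: le_Rintegral => //; first by apply: intbleZ; exact: intbleD.
    by move=> w _; apply: le_trans (ler_norm _) _; rewrite [leRHS]mulrC; exact: normM_le_sqr.
  move: h; rewrite RintegralZl//; last exact: intbleD.
  rewrite RintegralD// -/K => h e; move: h; rewrite /X e.
  under eq_Rintegral do rewrite -expr2.
  by rewrite -/X; lra.
apply: (@sqint_process_bounded _ _ _ P T X K) => //.
by move=> t tT; split; [exact: sqint_ito|exact: bound].
Qed.

End one_integral.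

(** Both sides are limits of the corresponding expressions for simple processes, since pairings are
    continuous in L2. *)
Lemma ito_isometry p p' (gamma : R -> Omega -> 'M[R]_(p, d)) (I : R -> Omega -> 'cV[R]_p)
    (gamma' : R -> Omega -> 'M[R]_(p', d)) (I' : R -> Omega -> 'cV[R]_p') i i' :
  ito_integral P B T gamma I -> ito_integral P B T gamma' I' ->
  \int[P]_w (I T w i 0 * I' T w i' 0) =
  \sum_l \int[mP]_z (zext T (fun t w => gamma t w i l) z *
                     zext T (fun t w => gamma' t w i' l) z).
Proof.
move=> hI hI'; have [S [naS eS sI cI]] := ito_integral_approx hI.
have [S' [naS' eS' sI' cI']] := ito_integral_approx hI'.
have [mG _ _ _] := hI; have [mG' _ _ _] := hI'.
have T00 : 0 <= T by exact: ltW.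
have TT : 0 <= T <= T by rewrite lexx ltW.
have h1 : \int[P]_w (simple_integral B (S j) T w i 0 * simple_integral B (S' j) T w i' 0)
    @[j --> \oo] --> \int[P]_w (I T w i 0 * I' T w i' 0).
  apply: sqint_pairing_cvg; [exact: sI|exact: sI'| | |exact: cI|exact: cI'].
    by move=> j; exact: (sqint_simple_integral cP hB (naS j)).
  by move=> j; exact: (sqint_simple_integral cP hB (naS' j)).
have e : (fun j => \int[P]_w (simple_integral B (S j) T w i 0 *
      simple_integral B (S' j) T w i' 0)) = fun j => \sum_l \int[mP]_z
    (zext T (fun t w => simple_eval (S j) t w i l) z *
     zext T (fun t w => simple_eval (S' j) t w i' l) z).
  by apply/funext => j; exact: (simple_integral_isometry cP hB i i' (naS j) (naS' j)).
rewrite e in h1; apply: (cvg_unique _ h1) => //.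
apply: cvg_big => [|l _]; first exact: add_continuous.
apply: sqint_pairing_cvg; [exact: M2_sqint_process|exact: M2_sqint_process| | |exact: eS|exact: eS'].
  by move=> j; exact: (sqint_process_simple_eval cP hB (naS j)).
by move=> j; exact: (sqint_process_simple_eval cP hB (naS' j)).
Qed.

End ito.

(** * Duality *)

(* Unlike [ge0_le_integral], the majorant need not be measurable. *)
Lemma ge0_le_integral_nonmeas d (S : measurableType d) (R : realType)
    (m : {measure set S -> \bar R}) (f g : S -> \bar R) :
  (forall x, 0 <= f x)%E -> (forall x, f x <= g x)%E ->
  (\int[m]_x f x <= \int[m]_x g x)%E.
Proof.
move=> f0 fg; rewrite !ge0_integralTE//; last by move=> x; exact: le_trans (fg x).
apply: le_ereal_sup => _ [h hf <-]; exists h => // x.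
exact: le_trans (hf x) (fg x).
Qed.

Section duality.
Context (R : realType) (disp : measure_display) (Omega : measurableType disp).
Variables (P : probability Omega R) (d : nat) (B : R -> Omega -> 'cV[R]_d) (T : R).
Hypotheses (cP : measure_is_complete P) (hB : brownian_motion P B) (T0 : 0 < T).
Local Notation mu := (@lebesgue_measure R).
Local Notation mP := (mu \x P)%E.
Local Notation fmeas := (fmeasurable P B).
Local Notation sqp := (sqint_process P T).

(** The expected supremum bounds every second moment at once. The supremum runs over uncountably
    many times, hence the comparison that does not ask for its measurability. *)
Lemma S2_sqint p q (X : R -> Omega -> 'M[R]_(p, q)) i j : S2 P B T X ->
  exists K, forall t, 0 <= t <= T ->
    sqintble P (fun w => X t w i j) /\ \int[P]_w (X t w i j ^+ 2) <= K.
Proof.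
move=> [_ aX]; set M := (\int[P]_w _)%E => finM.
exists (fine M) => t tT; have /andP[t0 _] := tT.
have mX : measurable_fun setT (fun w => X t w i j).
  by apply: (fmeasurable_measurable cP hB t0); apply: measurable_at_fmeas; exact: aX.
have le : (\int[P]_w (X t w i j ^+ 2)%:E <= M)%E.
  apply: ge0_le_integral_nonmeas => w; first by rewrite lee_fin sqr_ge0.
  apply: (@le_trans _ _ (sqnorm (X t w))%:E); first by rewrite lee_fin sqr_entry_le.
  by apply: ereal_sup_ubound; exists t.
have sX : sqintble P (fun w => X t w i j) by apply: sqint_ltoo => //; exact: le_lt_trans le _.
split => //; apply: fine_le => //.
- by case: sX => _ h; exact: integrable_fin_num h.
- rewrite ge0_fin_numE//; apply: le_trans le; apply: integral_ge0 => w _.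
  by rewrite lee_fin sqr_ge0.
Qed.

Lemma measurable_S2 p q (X : R -> Omega -> 'M[R]_(p, q)) i j : S2 P B T X ->
  measurable_fun setT (zext T (fun t w => X t w i j)).
Proof.
move=> sX; have [cX _ _] := sX; have [K hK] := S2_sqint i j sX.
apply: measurable_zext_continuous => //.
- by move=> t tT; case: (hK t tT) => -[].
- by move=> w; exact: continuous_entry.
Qed.

Lemma S2_sqint_process p q (X : R -> Omega -> 'M[R]_(p, q)) i j : S2 P B T X ->
  sqp (fun t w => X t w i j).
Proof.
move=> sX; have [K hK] := S2_sqint i j sX.
by apply: sqint_process_bounded => //; [exact: measurable_S2|exact: hK].
Qed.

Lemma sqint_processB (X Y : R -> Omega -> R) : sqp X -> sqp Y ->
  sqp (fun t w => X t w - Y t w).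
Proof.
move=> sX sY; have := sqintB sX sY; congr (sqintble mP _); apply/funext => z.
by rewrite /zext mulrBr.
Qed.

Lemma zextM (X Y : R -> Omega -> R) z :
  zext T (fun t w => X t w * Y t w) z = zext T X z * zext T Y z.
Proof.
by rewrite /zext; case: (0 <= z.1 <= T); rewrite ?mul1r ?mul0r.
Qed.

Lemma zextD (X Y : R -> Omega -> R) z :
  zext T (fun t w => X t w + Y t w) z = zext T X z + zext T Y z.
Proof. by rewrite /zext mulrDr. Qed.

Lemma zext_sum (I : Type) (s : seq I) (F : I -> R -> Omega -> R) z :
  zext T (fun t w => \sum_(i <- s) F i t w) z = \sum_(i <- s) zext T (F i) z.
Proof. by rewrite /zext mulr_sumr. Qed.

Lemma zext_inner p q (X Y : R -> Omega -> 'M[R]_(p, q)) z :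
  zext T (fun t w => inner (X t w) (Y t w)) z =
  \sum_i \sum_j zext T (fun t w => X t w i j) z * zext T (fun t w => Y t w i j) z.
Proof.
rewrite [LHS](_ : _ = zext T (fun t w => \sum_i \sum_j X t w i j * Y t w i j) z); last first.
  by rewrite /zext innerE.
rewrite zext_sum; apply: eq_bigr => i _; rewrite zext_sum; apply: eq_bigr => j _.
exact: zextM.
Qed.

Lemma intble_inner_process p q (X Y : R -> Omega -> 'M[R]_(p, q)) :
  (forall i j, sqp (fun t w => X t w i j)) -> (forall i j, sqp (fun t w => Y t w i j)) ->
  intble mP (zext T (fun t w => inner (X t w) (Y t w))).
Proof.
move=> sX sY; rewrite (_ : zext T _ = fun z => \sum_i \sum_j
    zext T (fun t w => X t w i j) z * zext T (fun t w => Y t w i j) z).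
  by apply: intble_sum => i _; apply: intble_sum => j _; exact: sqint_mul (sX i j) (sY i j).
by apply/funext => z; rewrite zext_inner.
Qed.

Lemma intble_inner p q (X Y : Omega -> 'M[R]_(p, q)) :
  (forall i j, sqintble P (fun w => X w i j)) -> (forall i j, sqintble P (fun w => Y w i j)) ->
  intble P (fun w => inner (X w) (Y w)).
Proof.
move=> sX sY; under [X in intble P X]eq_fun do rewrite innerE.
by apply: intble_sum => i _; apply: intble_sum => j _; exact: sqint_mul (sX i j) (sY i j).
Qed.

(** The integration by parts applied to x - xb and p. The two state processes are kept apart because
    square integrability is required of the difference of their drifts only. *)
Lemma ito_duality_entry N (x xb p bx bxb bp : R -> Omega -> 'cV[R]_N)
    (gx gxb gp : R -> Omega -> 'M[R]_(N, d)) i :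
  S2 P B T x -> S2 P B T xb -> S2 P B T p ->
  ito_differential P B T x bx gx -> ito_differential P B T xb bxb gxb ->
  ito_differential P B T p bp gp ->
  sqp (fun t w => bx t w i 0 - bxb t w i 0) -> sqp (fun t w => bp t w i 0) ->
  (forall s, 0 <= s <= T -> fmeas s (fun w => bx s w i 0 - bxb s w i 0)) ->
  (forall s, 0 <= s <= T -> fmeas s (fun w => bp s w i 0)) ->
  \int[P]_w ((x T w i 0 - xb T w i 0) * p T w i 0) =
  \int[P]_w ((x 0 w i 0 - xb 0 w i 0) * p 0 w i 0) +
  \int[mP]_z (zext T (fun t w => x t w i 0 - xb t w i 0) z * zext T (fun t w => bp t w i 0) z +
    zext T (fun t w => p t w i 0) z * zext T (fun t w => bx t w i 0 - bxb t w i 0) z) +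
  \sum_l \int[mP]_z (zext T (fun t w => gx t w i l - gxb t w i l) z *
    zext T (fun t w => gp t w i l) z).
Proof.
move=> Sx Sxb Sp [ix [Ix hIx eqx]] [ixb [Ixb hIxb eqxb]] [ip [Ip hIp eqp]] sb sbp fb fbp.
have [[_ ax _] [_ axb _] [_ ap _]] := And3 Sx Sxb Sp.
have TT : 0 <= T <= T by rewrite lexx ltW.
have TO : (0 : R) <= 0 <= T by rewrite lexx ltW.
have [K hx] := S2_sqint i 0 Sx; have [Kb hxb] := S2_sqint i 0 Sxb.
have [Kp hp] := S2_sqint i 0 Sp.
have sd t : 0 <= t <= T -> sqintble P (fun w => x t w i 0 - xb t w i 0).
  by move=> tT; apply: sqintB; [case: (hx t tT)|case: (hxb t tT)].
have sp t : 0 <= t <= T -> sqintble P (fun w => p t w i 0) by move=> tT; case: (hp t tT).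
have sI t : 0 <= t <= T -> sqintble P (fun w => Ix t w i 0 - Ixb t w i 0).
  by move=> tT; apply: sqintB; [exact: (sqint_ito cP hB hIx)|exact: (sqint_ito cP hB hIxb)].
have sIp t : 0 <= t <= T -> sqintble P (fun w => Ip t w i 0).
  by move=> tT; exact: (sqint_ito cP hB hIp).
have fd : fmeas 0 (fun w => x 0 w i 0 - xb 0 w i 0).
  by apply: (@measurable_funB _ (filtration_type P B 0)); apply: measurable_at_fmeas;
    [exact: ax|exact: axb].
have fp : fmeas 0 (fun w => p 0 w i 0) by apply: measurable_at_fmeas; exact: ap.
have mart s xi : 0 <= s <= T -> fmeas s xi -> sqintble P xi ->
    \int[P]_w (xi w * (Ix T w i 0 - Ixb T w i 0)) = \int[P]_w (xi w * (Ix s w i 0 - Ixb s w i 0)).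
  move=> sT fxi sxi.
  under eq_Rintegral do rewrite mulrBr.
  under [RHS]eq_Rintegral do rewrite mulrBr.
  have h1 := sqint_ito cP hB hIx i TT; have h2 := sqint_ito cP hB hIxb i TT.
  have h3 := sqint_ito cP hB hIx i sT; have h4 := sqint_ito cP hB hIxb i sT.
  rewrite !RintegralB//; try exact: sqint_mul.
  by rewrite (ito_martingale cP hB T0 hIx i sT fxi sxi) (ito_martingale cP hB T0 hIxb i sT fxi sxi).
rewrite (@expectation_product R disp Omega P T T0 (fun t w => x t w i 0 - xb t w i 0)
  (fun t w => p t w i 0) (fun t w => Ix t w i 0 - Ixb t w i 0) (fun t w => Ip t w i 0)
  (fun t w => bx t w i 0 - bxb t w i 0) (fun t w => bp t w i 0)) //.
- congr (_ + _).
  have h1 := sqint_ito cP hB hIx i TT; have h2 := sqint_ito cP hB hIxb i TT.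
  have h3 := sqint_ito cP hB hIp i TT.
  under eq_Rintegral do rewrite mulrBl.
  rewrite RintegralB//; [|exact: sqint_mul|exact: sqint_mul].
  rewrite (ito_isometry cP hB T0 i i hIx hIp) (ito_isometry cP hB T0 i i hIxb hIp) -sumrB.
  have [[mgx _ _ _] [mgxb _ _ _] [mgp _ _ _]] := And3 hIx hIxb hIp.
  apply: eq_bigr => l _; rewrite -RintegralB//; last 2 first.
  + by apply: sqint_mul; exact: (M2_sqint_process _ _ mgx) || exact: (M2_sqint_process _ _ mgp).
  + by apply: sqint_mul; exact: (M2_sqint_process _ _ mgxb) || exact: (M2_sqint_process _ _ mgp).
  by apply: eq_Rintegral => z _; rewrite /zext; ring.
- by apply: sqint_processB; exact: S2_sqint_process.
- exact: S2_sqint_process.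
- by apply: sqint_processB; [exact: (sqint_process_ito cP hB T0 hIx)|exact: (sqint_process_ito cP hB T0 hIxb)].
- exact: (sqint_process_ito cP hB T0 hIp).
- exact: sd.
- exact: sp.
- exact: sd.
- exact: sp.
- exact: sI.
- exact: sIp.
- apply: filterS2 (ae_conj eqx eqxb) (ae_conj ix ixb) => w [ex exb] [jx jxb] t tT.
  rewrite ex// exb// !mxE RintegralB//; first by ring.
  + have := jx i 0; apply: integrableS => //; apply: subset_itvl.
    by rewrite bnd_simp; case/andP: tT.
  + have := jxb i 0; apply: integrableS => //; apply: subset_itvl.
    by rewrite bnd_simp; case/andP: tT.
- by apply: filterS eqp => w ep t tT; rewrite ep// !mxE.
(* The initial value is known at time 0, so the integral at T may be replaced by the integral at 0,
   whose pairings vanish. The next goal is the symmetric one. *)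
- rewrite (ito_martingale cP hB T0 hIp i TO fd (sd _ TO)).
  exact: (ito_initial cP hB T0 hIp i (sd _ TO)).
- rewrite (mart 0)//; last exact: sp.
  under eq_Rintegral do rewrite mulrBr.
  have h1 := sqint_ito cP hB hIx i TO; have h2 := sqint_ito cP hB hIxb i TO.
  rewrite RintegralB//; [|by apply: sqint_mul => //; exact: sp|by apply: sqint_mul => //; exact: sp].
  rewrite (ito_initial cP hB T0 hIx i (sp _ TO)) (ito_initial cP hB T0 hIxb i (sp _ TO)).
  by rewrite subrr.
- by move=> s sT sbs; apply: mart => //; exact: fbp.
- by move=> s sT sbs; apply: (ito_martingale cP hB T0 hIp) => //; exact: fb.
Qed.

(* The expectation of the integrated Ito product rule
   d<X, p> = <X, dp> + <p, dX> + d[X, p] for X = x - xb. *)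
Lemma ito_duality N (x xb p bx bxb bp : R -> Omega -> 'cV[R]_N)
    (gx gxb gp : R -> Omega -> 'M[R]_(N, d)) :
  S2 P B T x -> S2 P B T xb -> S2 P B T p ->
  ito_differential P B T x bx gx -> ito_differential P B T xb bxb gxb ->
  ito_differential P B T p bp gp ->
  (forall i, sqp (fun t w => bx t w i 0 - bxb t w i 0)) ->
  (forall i, sqp (fun t w => bp t w i 0)) ->
  (forall i s, 0 <= s <= T -> fmeas s (fun w => bx s w i 0 - bxb s w i 0)) ->
  (forall i s, 0 <= s <= T -> fmeas s (fun w => bp s w i 0)) ->
  \int[P]_w inner (x T w - xb T w) (p T w) =
  \int[P]_w inner (x 0 w - xb 0 w) (p 0 w) +
  (\int[mP]_z zext T (fun t w => inner (x t w - xb t w) (bp t w)) z +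
   \int[mP]_z zext T (fun t w => inner (p t w) (bx t w - bxb t w)) z +
   \int[mP]_z zext T (fun t w => inner (gx t w - gxb t w) (gp t w)) z).
Proof.
move=> Sx Sxb Sp dx dxb dp sb sbp fb fbp.
have TT : 0 <= T <= T by rewrite lexx ltW.
have TO : (0 : R) <= 0 <= T by rewrite lexx ltW.
have sd t i : 0 <= t <= T -> sqintble P (fun w => x t w i 0 - xb t w i 0).
  have [K hx] := S2_sqint i 0 Sx; have [Kb hxb] := S2_sqint i 0 Sxb.
  by move=> tT; apply: sqintB; [case: (hx t tT)|case: (hxb t tT)].
have sp t i : 0 <= t <= T -> sqintble P (fun w => p t w i 0).
  by have [Kp hp] := S2_sqint i 0 Sp; move=> tT; case: (hp t tT).
have marg t : 0 <= t <= T -> \int[P]_w inner (x t w - xb t w) (p t w) =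
    \sum_i \int[P]_w ((x t w i 0 - xb t w i 0) * p t w i 0).
  move=> tT; rewrite -Rintegral_sum => [|i _]; last by apply: sqint_mul; [exact: sd|exact: sp].
  apply: eq_Rintegral => w _; rewrite innerE; apply: eq_bigr => i _.
  by rewrite big_ord1 !mxE.
rewrite !marg//.
have [[_ [Ix [mgx _ _ _] _]] [_ [Ixb [mgxb _ _ _] _]] [_ [Ip [mgp _ _ _] _]]] := And3 dx dxb dp.
have sgx i l : sqp (fun t w => gx t w i l - gxb t w i l).
  by apply: sqint_processB; [exact: M2_sqint_process mgx|exact: M2_sqint_process mgxb].
have sgp i l : sqp (fun t w => gp t w i l) by exact: M2_sqint_process mgp.
have sX i : sqp (fun t w => x t w i 0 - xb t w i 0).
  by apply: sqint_processB; exact: S2_sqint_process.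
have sP i : sqp (fun t w => p t w i 0) by exact: S2_sqint_process.
have mid q (X Xb Y : R -> Omega -> 'M[R]_(N, q)) :
    (forall i j, sqp (fun t w => X t w i j - Xb t w i j)) ->
    (forall i j, sqp (fun t w => Y t w i j)) ->
    \int[mP]_z zext T (fun t w => inner (X t w - Xb t w) (Y t w)) z =
    \sum_i \sum_j \int[mP]_z (zext T (fun t w => X t w i j - Xb t w i j) z *
                             zext T (fun t w => Y t w i j) z).
  move=> sXX sY.
  have ii i j : intble mP (fun z => zext T (fun t w => X t w i j - Xb t w i j) z *
                             zext T (fun t w => Y t w i j) z) by exact: sqint_mul (sXX i j) (sY i j).
  transitivity (\int[mP]_z \sum_i \sum_j (zext T (fun t w => X t w i j - Xb t w i j) z *
                             zext T (fun t w => Y t w i j) z)).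
    apply: eq_Rintegral => z _; rewrite zext_inner; apply: eq_bigr => i _.
    by apply: eq_bigr => j _; congr (_ * _); rewrite /zext !mxE.
  rewrite Rintegral_sum => [|i _]; last exact: intble_sum.
  by apply: eq_bigr => i _; rewrite Rintegral_sum.
have -> : \int[mP]_z zext T (fun t w => inner (p t w) (bx t w - bxb t w)) z =
    \int[mP]_z zext T (fun t w => inner (bx t w - bxb t w) (p t w)) z.
  by apply: eq_Rintegral => z _; rewrite /zext innerC.
rewrite !mid//; try by move=> i j; rewrite ?[j]ord1.
rewrite -!big_split/=; apply: eq_bigr => i _.
rewrite (ito_duality_entry Sx Sxb Sp dx dxb dp (sb i) (sbp i) (fb i) (fbp i)) !big_ord1.
have i1 := sqint_mul (sX i) (sbp i); have i2 := sqint_mul (sP i) (sb i).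
rewrite RintegralD// -!addrA; congr (_ + (_ + (_ + _))).
by apply: eq_Rintegral => z _; rewrite mulrC.
Qed.

End duality.

(** * Derivatives relative to a convex domain *)

Section relative_derivative.
Context (R : realType) (V : normedModType R).
Implicit Types (D : set V) (g : V -> R) (L : V -> R).

(** A Frechet derivative relative to D with a bare function L, so that entries and inner products of
    linear maps are covered directly. Homogeneity and additivity are assumed where a line or a sum
    of directions occurs. *)
Definition rel_derivative D g v L := forall e : R, 0 < e ->
  \forall w \near v, D w -> `|g w - g v - L (w - v)| <= e * `|w - v|.

Definition homogeneous L := forall (a : R) h, L (a *: h) = a * L h.

Lemma rel_derivativeD D g g' v L L' : rel_derivative D g v L ->
  rel_derivative D g' v L' ->
  rel_derivative D (fun w => g w + g' w) v (fun h => L h + L' h).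
Proof.
move=> hg hg' e e0; have e2 : 0 < e / 2 by rewrite divr_gt0.
apply: filterS2 (hg _ e2) (hg' _ e2) => w h h' Dw.
rewrite (_ : _ - _ = (g w - g v - L (w - v)) + (g' w - g' v - L' (w - v))); last by ring.
apply: le_trans (ler_normD _ _) _; apply: le_trans (lerD (h Dw) (h' Dw)) _.
by rewrite -mulrDl -splitr.
Qed.

Lemma rel_derivativeZ D g v L (k : R) : rel_derivative D g v L ->
  rel_derivative D (fun w => k * g w) v (fun h => k * L h).
Proof.
move=> hg e e0; have k1 : 0 < `|k| + 1 by rewrite ltr_wpDl.
apply: filterS (hg (e / (`|k| + 1)) (divr_gt0 e0 k1)) => w h Dw.
rewrite -!mulrBr normrM; apply: le_trans (ler_wpM2l (normr_ge0 _) (h Dw)) _.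
by rewrite mulrA ler_wpM2r// mulrCA ler_piMr ?(ltW e0)// ler_pdivrMr// mul1r lerDl.
Qed.

Lemma rel_derivative_cst D v (k : R) : rel_derivative D (fun=> k) v (fun=> 0).
Proof.
by move=> e e0; apply: filterE => w _; rewrite !subrr normr0 mulr_ge0 // ltW.
Qed.

Lemma rel_derivative_sum (I : Type) (s : seq I) D (G : I -> V -> R) v (K : I -> V -> R) :
  (forall i, rel_derivative D (G i) v (K i)) ->
  rel_derivative D (fun w => \sum_(i <- s) G i w) v (fun h => \sum_(i <- s) K i h).
Proof.
move=> hG; elim: s => [|i s ih].
  have e (F : I -> V -> R) : (fun w => \sum_(i <- [::]) F i w) = fun=> 0.
    by apply/funext => w; rewrite big_nil.
  by rewrite !e; exact: rel_derivative_cst.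
have e (F : I -> V -> R) :
    (fun w => \sum_(j <- i :: s) F j w) = fun w => F i w + \sum_(j <- s) F j w.
  by apply/funext => w; rewrite big_cons.
by rewrite !e; exact: rel_derivativeD.
Qed.

Lemma rel_derivative_line D g v L h (e : R) : rel_derivative D g v L -> homogeneous L ->
  0 < e -> \forall s \near (0 : R), D (v + s *: h) ->
    `|g (v + s *: h) - g v - s * L h| <= e * `|s|.
Proof.
move=> hg hL e0; have h1 : 0 < `|h| + 1 by rewrite ltr_wpDl.
(* The displacement has norm |s| |h|, so this tolerance yields e |s|; the 1 covers h = 0. *)
have near_v := hg (e / (`|h| + 1)) (divr_gt0 e0 h1).
have cv : v + s *: h @[s --> (0 : R)] --> v.
  rewrite -[X in _ --> X]addr0 -(scale0r h).
  by apply: cvgD; [exact: cvg_cst|apply: cvgZr_tmp; exact: cvg_id].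
have near_0 : \forall s \near (0 : R), D (v + s *: h) ->
    `|g (v + s *: h) - g v - L (v + s *: h - v)| <= e / (`|h| + 1) * `|v + s *: h - v|.
  exact: cv _ near_v.
apply: filterS near_0 => s /= hs Ds.
have e1 : v + s *: h - v = s *: h by rewrite addrAC subrr add0r.
move: (hs Ds); rewrite e1 hL normrZ => /le_trans; apply.
rewrite mulrCA [leRHS]mulrC ler_wpM2l// -mulrA ler_piMr ?(ltW e0)//.
by rewrite mulrC ler_pdivrMr// mul1r lerDl.
Qed.

Let small (p : R -> Prop) : (\forall s \near (0 : R), p s) -> exists2 s, 0 < s <= 1 & p s.
Proof.
move=> [r /= r0 hr]; exists (Num.min (r / 2) 1).
  by rewrite lt_min divr_gt0//= ltr01 ge_min lexx orbT.
apply: hr => /=; rewrite sub0r normrN ger0_norm; last first.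
  by rewrite le_min divr_ge0 ?ltW.
by rewrite gt_min ltr_pdivrMr// ltr_pMr// ltr1n.
Qed.

(** For each e, one small positive s suffices: s L(h) is at most the increment plus e s, hence at
    most s (c + e). Only points v + s h with 0 < s <= 1 are used, as is needed on the boundary of a
    convex set. *)
Lemma rel_derivative_le D g v L h (c : R) : rel_derivative D g v L -> homogeneous L ->
  (forall s : R, 0 < s <= 1 -> D (v + s *: h)) ->
  (forall s : R, 0 < s <= 1 -> g (v + s *: h) - g v <= s * c) -> L h <= c.
Proof.
move=> hg hL Dh gc; apply/ler_addgt0Pr => e e0.
have [s s01 hs] := small (rel_derivative_line h hg hL e0).
have /andP[s0 _] := s01.
have := hs (Dh s s01); rewrite (ger0_norm (ltW s0)) ler_norml => /andP[h1 _].
rewrite -(ler_pM2l s0) mulrDr; have := gc s s01; move: h1.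
by rewrite [e * s]mulrC; lra.
Qed.

Lemma rel_derivative_ge D g v L h (c : R) : rel_derivative D g v L -> homogeneous L ->
  (forall s : R, 0 < s <= 1 -> D (v + s *: h)) ->
  (forall s : R, 0 < s <= 1 -> s * c <= g (v + s *: h) - g v) -> c <= L h.
Proof.
move=> hg hL Dh gc; apply/ler_addgt0Pr => e e0.
have [s s01 hs] := small (rel_derivative_line h hg hL e0).
have /andP[s0 _] := s01.
have := hs (Dh s s01); rewrite (ger0_norm (ltW s0)) ler_norml => /andP[_ h1].
rewrite -(ler_pM2l s0) mulrDr; have := gc s s01; move: h1.
by rewrite [e * s]mulrC; lra.
Qed.

Lemma is_derive_line (F : V -> R) x v (df : R) :
  (forall e : R, 0 < e -> \forall s \near (0 : R),
    `|F (x + s *: v) - F x - s * df| <= e * `|s|) ->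
  is_derive x v (F : V -> R^o) df.
Proof.
move=> hF.
have cv : h^-1 *: ((F \o shift x) (h *: v) - F x) @[h --> (0 : R)^'] --> (df : R^o).
  apply/cvgrPdist_le => e e0.
  apply: (filterS2 _ _ (nbhs_dnbhs_neq (0 : R)) (nbhs_dnbhs (hF e e0))) => s s0 hs.
  rewrite distrC /= [s *: v + x]addrC.
  have -> : s^-1 *: (F (x + s *: v) - F x) - df = s^-1 * (F (x + s *: v) - F x - s * df).
    by rewrite /GRing.scale/=; field.
  by rewrite normrM normfV mulrC ler_pdivrMr ?normr_gt0.
split; last exact: cvg_lim cv.
by apply/cvg_ex; exists df.
Qed.

End relative_derivative.

(** * Mean value inequality along segments of the domain *)

Section lipschitz.
Context (R : realType) (V : normedModType R).

(** The mean value theorem along the segment. Inside ]0, 1[ the relative expansion is two-sided and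
    gives a derivative; at the end points it still gives one-sided continuity. *)
Lemma rel_derivative_lipschitz (D : set V) (g : V -> R) (dg : V -> V -> R) v v' (C : R) :
  (forall u, D u -> rel_derivative D g u (dg u)) ->
  (forall u, homogeneous (dg u)) ->
  (forall u, D u -> forall h, `|dg u h| <= C * `|h|) ->
  (forall s : R, 0 <= s <= 1 -> D (v + s *: (v' - v))) ->
  `|g v' - g v| <= C * `|v' - v|.
Proof.
move=> dgP dgZ dgC seg; set h := v' - v.
pose f (s : R) := g (v + s *: h); pose u (s : R) := v + s *: h.
have uD s r : u s + r *: h = u (s + r) by rewrite /u scalerDl addrA.
have line s (e : R) : 0 <= s <= 1 -> 0 < e -> \forall r \near (0 : R), 0 <= s + r <= 1 ->
    `|f (s + r) - f s - r * dg (u s) h| <= e * `|r|.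
  move=> s01 e0; have := rel_derivative_line h (dgP _ (seg s s01)) (dgZ _) e0.
  apply: filterS => r hr sr; have := hr; rewrite -/(u s) uD; apply.
  exact: seg.
have [c c01 fc] : exists2 c, c \in `]0, 1[%R & f 1 - f 0 = dg (u c) h * (1 - 0).
  apply: (@MVT R f (fun s => dg (u s) h)) => // [s|].
    rewrite in_itv/= => /andP[s0 s1]; apply: is_derive_line => e e0.
    have s01 : 0 <= s <= 1 by rewrite !ltW.
    have nr : \forall r \near (0 : R), 0 <= s + r <= 1.
      exists (Num.min s (1 - s)) => /=; first by rewrite lt_min s0 subr_gt0.
      move=> r /=; rewrite sub0r normrN lt_min ltr_norml => /andP[/andP[r1 _]].
      by rewrite ltr_norml => /andP[_ r2]; apply/andP; split; lra.
    apply: filterS2 nr (line s e s01 e0) => r r01 hr.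
    by rewrite /GRing.scale/= mulr1; exact: hr.
  apply/subspace_continuousP => s; rewrite /= in_itv/= => s01.
  apply/cvgrPdist_le => e e0.
  (* The expansion with tolerance 1 bounds the increment of f by K |r|, which gives continuity
     within [0, 1]. *)
  pose K := 1 + `|dg (u s) h|; have K0 : 0 < K by rewrite ltr_pwDl.
  have near_r : \forall r \near (0 : R), 0 <= s + r <= 1 -> `|f (s + r) - f s| <= e.
    have nr : \forall r \near (0 : R), `|r| <= e / K.
      exists (e / K) => /=; first by rewrite divr_gt0.
      by move=> r /=; rewrite sub0r normrN => /ltW.
    apply: filterS2 nr (line s 1 s01 ltr01) => r rK hr r01.
    rewrite (_ : f (s + r) - f s = (f (s + r) - f s - r * dg (u s) h) + r * dg (u s) h);
      last by ring.
    apply: le_trans (ler_normD _ _) _; apply: le_trans (lerD (hr r01) (lexx _)) _.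
    by rewrite normrM mul1r [`|r| * _]mulrC -[X in X + _]mul1r -mulrDl mulrC -ler_pdivlMr.
  rewrite /within /=; have [r0 /= r00 hr0] := near_r.
  exists r0 => //= y sy y01; rewrite distrC.
  have := hr0 (y - s); rewrite /= sub0r opprB => /(_ sy).
  by rewrite [s + _]addrC subrK; apply; move: y01; rewrite in_itv.
have c01' : 0 <= c <= 1 by move: c01; rewrite in_itv/= => /andP[c0 c1]; rewrite !ltW.
have -> : g v' = f 1 by rewrite /f scale1r /h addrC subrK.
have -> : g v = f 0 by rewrite /f scale0r addr0.
by rewrite fc subr0 mulr1; exact/dgC/seg.
Qed.

End lipschitz.

Section entries.
Context (R : realType).

Lemma entry_le_norm p q (A : 'M[R]_(p, q)) i j : `|A i j| <= `|A|.
Proof.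
rewrite -[leRHS]/(mx_norm A) mx_normrE.
exact: (le_bigmax _ (fun ij : 'I_p * 'I_q => `|A ij.1 ij.2|) (i, j)).
Qed.

(** A common majorant of the largest-entry norm and of [enorm], whose square integrability is
    inherited from the entries. *)
Definition l1norm p q (A : 'M[R]_(p, q)) : R := \sum_i \sum_j `|A i j|.

Lemma entry_le_l1norm p q (A : 'M[R]_(p, q)) i j : `|A i j| <= l1norm A.
Proof.
rewrite /l1norm (bigD1 i)//= (bigD1 j)//= -addrA lerDl addr_ge0//.
  by apply: sumr_ge0 => k _; exact: normr_ge0.
by apply: sumr_ge0 => k _; apply: sumr_ge0 => l _; exact: normr_ge0.
Qed.

Lemma l1norm_ge0 p q (A : 'M[R]_(p, q)) : 0 <= l1norm A.
Proof. by apply: sumr_ge0 => i _; apply: sumr_ge0 => j _; exact: normr_ge0. Qed.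

Lemma norm_le_l1norm p q (A : 'M[R]_(p, q)) : `|A| <= l1norm A.
Proof.
rewrite -[leLHS]/(mx_norm A) mx_normrE; apply: bigmax_le; first exact: l1norm_ge0.
by move=> [i j] _; exact: entry_le_l1norm.
Qed.

Lemma enorm_le_l1norm p q (A : 'M[R]_(p, q)) : enorm A <= l1norm A.
Proof.
rewrite /enorm -(ger0_norm (l1norm_ge0 A)) -sqrtr_sqr; apply: ler_wsqrtr.
rewrite sqnormE expr2 /l1norm mulr_suml; apply: ler_sum => i _.
rewrite mulr_suml; apply: ler_sum => j _; rewrite -real_normK ?num_real// expr2.
by rewrite ler_wpM2l//; exact: entry_le_l1norm.
Qed.

Lemma C1_on_entry (V : normedModType R) p q (D : set V) (g : V -> 'M[R]_(p, q))
    (dg : V -> {linear V -> 'M[R]_(p, q)}) v i j : C1_on D g dg -> D v ->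
  rel_derivative D (fun w => g w i j) v (fun h => dg v h i j).
Proof.
move=> [dgP _] Dv e e0; apply: filterS (dgP v Dv e e0) => w hw Dw.
apply: le_trans (hw Dw); apply: le_trans (entry_le_norm _ i j).
by rewrite !mxE.
Qed.

Lemma homogeneous_entry (V : normedModType R) p q (L : {linear V -> 'M[R]_(p, q)}) i j :
  homogeneous (fun h => L h i j).
Proof. by move=> a h; rewrite linearZ mxE. Qed.

End entries.

Section convexity.
Context (R : realType).

Let convE (E : lmodType R) (u v : E) (s : R) (s0 : 0 <= s) (s1 : s <= 1) :
  conv (Itv01 s0 s1) (v : convex_lmodType E) (u : convex_lmodType E) =
  u + s *: (v - u) :> E.
Proof.
rewrite -[LHS]/(s *: v + (1 - s) *: u) scalerBl scale1r scalerBr.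
by rewrite addrCA.
Qed.

Lemma convex_set_segment (E : lmodType R) (U : set (convex_lmodType E)) (u v : E) (s : R) :
  convex_set U -> U u -> U v -> 0 <= s <= 1 -> U (u + s *: (v - u)).
Proof.
move=> cU Uu Uv /andP[s0 s1].
by have := cU v u (Itv01 s0 s1) (mem_set Uv) (mem_set Uu); rewrite inE convE.
Qed.

Lemma convex_function_segment (E : lmodType R) (U : set (convex_lmodType E))
    (F : E -> R) (u v : E) (s : R) : convex_function U F -> U u -> U v ->
  0 <= s <= 1 -> F (u + s *: (v - u)) - F u <= s * (F v - F u).
Proof.
move=> cF Uu Uv /andP[s0 s1].
have := cF (Itv01 s0 s1) v u (mem_set Uv) (mem_set Uu).
rewrite convE -[X in _ <= X]/(s * F v + (1 - s) * F u).
by lra.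
Qed.

End convexity.

(** * Partial gradients from a derivative relative to the domain *)

Section gradient.
Context (R : realType) (p q : nat) (V : normedModType R).
Variables (D : set V) (H : V -> R) (v : V) (L : V -> R).
Variables (iota : 'M[R]_(p, q) -> V) (F : 'M[R]_(p, q) -> R) (x : 'M[R]_(p, q)).
Hypotheses (dH : rel_derivative D H v L) (LZ : homogeneous L).
Hypothesis LD : forall h h', L (h + h') = L h + L h'.
Hypothesis iotaZ : forall (a : R) h, iota (a *: h) = a *: iota h.
Hypothesis iotaD : forall h h', iota (h + h') = iota h + iota h'.
Hypothesis FE : forall (s : R) e, F (x + s *: e) = H (v + s *: iota e).
Hypothesis Diota : forall (s : R) e, D (v + s *: iota e).

Let F0 : F x = H v.
Proof. by rewrite -[x]addr0 -(scale0r x) FE scale0r addr0. Qed.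

Let line e (c : R) : 0 < c -> \forall s \near (0 : R),
  `|F (x + s *: e) - F x - s * L (iota e)| <= c * `|s|.
Proof.
move=> c0; apply: filterS (rel_derivative_line (iota e) dH LZ c0) => s hs.
by rewrite FE F0; exact/hs/Diota.
Qed.

(** The whole line in the direction [iota e] stays in D, so the relative derivative of H is an
    ordinary two-sided directional derivative of F. *)
Lemma grad_entry i j : grad F x i j = L (iota (delta_mx i j)).
Proof.
rewrite mxE; have [_ //] := is_derive_line (line (delta_mx i j)).
Qed.

Let L0 : L (iota 0) = 0.
Proof. by rewrite -(scale0r (0 : 'M[R]_(p, q))) iotaZ LZ mul0r. Qed.

Let L_sum (I : Type) (s : seq I) (G : I -> 'M[R]_(p, q)) :
  L (iota (\sum_(i <- s) G i)) = \sum_(i <- s) L (iota (G i)).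
Proof.
elim: s => [|i s ih]; first by rewrite !big_nil L0.
by rewrite !big_cons iotaD LD ih.
Qed.

Lemma inner_grad h : inner (grad F x) h = L (iota h).
Proof.
rewrite innerE {2}(matrix_sum_delta h) L_sum; apply: eq_bigr => i _.
rewrite L_sum; apply: eq_bigr => j _.
by rewrite grad_entry iotaZ LZ mulrC.
Qed.

(** Presents the gradient as a sequential limit of difference quotients, so that it inherits
    measurability from F. *)
Lemma grad_entry_cvg i j :
  (F (x + n.+1%:R^-1 *: delta_mx i j) - F x) * n.+1%:R @[n --> \oo] --> grad F x i j.
Proof.
rewrite grad_entry; set e := delta_mx i j; apply/cvgrPdist_le => c c0.
have [r /= r0 hr] := line e c0.
have near_n : \forall n \near \oo, (n.+1%:R : R)^-1 < r := near_infty_natSinv_lt (PosNum r0).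
apply: filterS near_n => n nr.
have n0 : (0 : R) < n.+1%:R by rewrite ltr0n.
have := hr n.+1%:R^-1; rewrite /= sub0r normrN ger0_norm ?invr_ge0 ?(ltW n0)// => /(_ nr).
rewrite distrC ler_pdivlMr//.
rewrite -[X in _ * X](ger0_norm (ltW n0)) -normrM.
rewrite [X in `|X| <= c -> _](_ : _ = L (iota e) - (F (x + n.+1%:R^-1 *: e) - F x) * n.+1%:R)//.
by rewrite mulrBl mulrAC mulVf ?mul1r// gt_eqF.
Qed.

End gradient.

Section differentiable_convex.
Context (R : realType) (k : nat).
Implicit Types F : 'cV[R]_k -> R.

Lemma differentiable_rel_derivative F u : differentiable (F : _ -> R^o) u ->
  rel_derivative setT F u ('d (F : _ -> R^o) u).
Proof.
move=> dF e e0; have /eqaddoP/(_ e e0)/nbhs_ballP[r /= r0 hr] := diff_locally dF.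
apply/nbhs_ballP; exists r => //= w; rewrite -ball_normE /= => uw _.
have := hr (w - u); rewrite -ball_normE /= sub0r opprB => /(_ uw).
by rewrite !fctE /= subrK opprD addrA.
Qed.

Lemma homogeneous_diff F u : homogeneous ('d (F : _ -> R^o) u).
Proof. by move=> s h; rewrite linearZ. Qed.

Lemma inner_grad_diff F u h : differentiable (F : _ -> R^o) u ->
  inner (grad F u) h = 'd (F : _ -> R^o) u h.
Proof.
move=> dF; apply: (@inner_grad R k 1 _ setT F u _ id) => //.
- exact: differentiable_rel_derivative.
- exact: homogeneous_diff.
- by move=> h1 h2; rewrite linearD.
Qed.

(** By convexity each difference quotient along the segment towards v is at most F v - F u, and so
    is its limit. *)
Lemma convex_grad_le F u v : convex_function setT F ->
  differentiable (F : _ -> R^o) u -> inner (grad F u) (v - u) <= F v - F u.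
Proof.
move=> cF dF; rewrite inner_grad_diff//.
apply: (rel_derivative_le (differentiable_rel_derivative dF)) => //.
- exact: homogeneous_diff.
- by move=> s /andP[s0 s1]; apply: convex_function_segment; rewrite ?(ltW s0).
Qed.

End differentiable_convex.

(** * The Hamiltonian *)

Section hamiltonian_derivative.
Context (R : realType) (d n m k1 k2 : nat).
Local Notation point :=
  ('cV[R]_n * 'cV[R]_m * 'M[R]_(m, d) * 'cV[R]_k1 * 'cV[R]_k2)%type.
Variables (U1 : set 'cV[R]_k1) (U2 : set 'cV[R]_k2).
Variables (b : R -> point -> 'cV[R]_n) (sigma : R -> point -> 'M[R]_(n, d))
  (f : R -> point -> 'cV[R]_m) (l : R -> point -> R).
Variables (db : R -> point -> {linear point -> 'cV[R]_n})
  (dsigma : R -> point -> {linear point -> 'M[R]_(n, d)})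
  (df : R -> point -> {linear point -> 'cV[R]_m})
  (dl : R -> point -> {linear point -> R^o}).
Local Notation dom := (domain U1 U2 : set point).
Local Notation ham := (hamiltonian b sigma f l).

Definition ham_derivative t v p q k (h : point) : R :=
  inner k (- df t v h) + inner p (db t v h) + inner q (dsigma t v h) + dl t v h.

Definition x_dir (h : 'cV[R]_n) : point := (h, 0, 0, 0, 0).
Definition y_dir (h : 'cV[R]_m) : point := (0, h, 0, 0, 0).
Definition z_dir (h : 'M[R]_(m, d)) : point := (0, 0, h, 0, 0).

Section fixed_time.
Variable t : R.
Hypotheses (cb : C1_on dom (b t) (db t)) (csigma : C1_on dom (sigma t) (dsigma t))
  (cf : C1_on dom (f t) (df t)) (cl : C1_on dom (l t : _ -> R^o) (dl t)).
Variables (p : 'cV[R]_n) (q : 'M[R]_(n, d)) (k : 'cV[R]_m).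

Let rel_inner p' q' (c : 'M[R]_(p', q')) (g : point -> 'M[R]_(p', q'))
    (dg : point -> {linear point -> 'M[R]_(p', q')}) v : C1_on dom g dg -> dom v ->
  rel_derivative dom (fun w => inner c (g w)) v (fun h => inner c (dg v h)).
Proof.
move=> cg Dv.
have -> : (fun w => inner c (g w)) = fun w => \sum_i \sum_j c i j * g w i j.
  by apply/funext => w; rewrite innerE.
have -> : (fun h => inner c (dg v h)) = fun h => \sum_i \sum_j c i j * dg v h i j.
  by apply/funext => w; rewrite innerE.
apply: rel_derivative_sum => i; apply: rel_derivative_sum => j.
exact/rel_derivativeZ/C1_on_entry.
Qed.

Lemma ham_rel_derivative v : dom v ->
  rel_derivative dom (fun w => ham t w p q k) v (ham_derivative t v p q k).
Proof.
move=> Dv; rewrite /ham_derivative /hamiltonian.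
apply: rel_derivativeD; last by case: cl => + _; exact.
apply: rel_derivativeD; last exact: rel_inner.
apply: rel_derivativeD; last exact: rel_inner.
have -> : (fun w => inner k (- f t w)) = fun w => - 1 * inner k (f t w).
  by apply/funext => w; rewrite innerN mulN1r.
have -> : (fun w => inner k (- df t v w)) = fun w => - 1 * inner k (df t v w).
  by apply/funext => w; rewrite innerN mulN1r.
exact/rel_derivativeZ/rel_inner.
Qed.

Lemma ham_derivativeD v h h' : ham_derivative t v p q k (h + h') =
  ham_derivative t v p q k h + ham_derivative t v p q k h'.
Proof. by rewrite /ham_derivative !linearD/= !innerN !innerD; ring. Qed.

Lemma ham_derivativeZ v : homogeneous (ham_derivative t v p q k).
Proof.
by move=> a h; rewrite /ham_derivative !linearZ/= !innerN !innerZ /GRing.scale/=; ring.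
Qed.

Variables (x : 'cV[R]_n) (y : 'cV[R]_m) (z : 'M[R]_(m, d)) (u1 : 'cV[R]_k1) (u2 : 'cV[R]_k2).
Hypotheses (hu1 : U1 u1) (hu2 : U2 u2).
Let v : point := (x, y, z, u1, u2).
Let Dv : dom v. Proof. by []. Qed.
Let rd := ham_rel_derivative Dv.

Let pairD (a1 a2 : 'cV[R]_n) (b1 b2 : 'cV[R]_m) (c1 c2 : 'M[R]_(m, d))
    (e1 e2 : 'cV[R]_k1) (g1 g2 : 'cV[R]_k2) (s : R) :
  ((a1, b1, c1, e1, g1) : point) + s *: ((a2, b2, c2, e2, g2) : point) =
  (a1 + s *: a2, b1 + s *: b2, c1 + s *: c2, e1 + s *: e2, g1 + s *: g2).
Proof. by []. Qed.

Let x_dirE (s : R) e : v + s *: x_dir e = (x + s *: e, y, z, u1, u2).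
Proof. by rewrite pairD !scaler0 !addr0. Qed.

Let y_dirE (s : R) e : v + s *: y_dir e = (x, y + s *: e, z, u1, u2).
Proof. by rewrite pairD !scaler0 !addr0. Qed.

Let z_dirE (s : R) e : v + s *: z_dir e = (x, y, z + s *: e, u1, u2).
Proof. by rewrite pairD !scaler0 !addr0. Qed.

Let x_dirZ (s : R) e : x_dir (s *: e) = s *: x_dir e.
Proof. by rewrite -[RHS]add0r pairD !scaler0 !add0r. Qed.
Let y_dirZ (s : R) e : y_dir (s *: e) = s *: y_dir e.
Proof. by rewrite -[RHS]add0r pairD !scaler0 !add0r. Qed.
Let z_dirZ (s : R) e : z_dir (s *: e) = s *: z_dir e.
Proof. by rewrite -[RHS]add0r pairD !scaler0 !add0r. Qed.
Let x_dirD e e' : x_dir (e + e') = x_dir e + x_dir e'.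
Proof. by rewrite -[x_dir e']scale1r pairD !scale1r !addr0. Qed.
Let y_dirD e e' : y_dir (e + e') = y_dir e + y_dir e'.
Proof. by rewrite -[y_dir e']scale1r pairD !scale1r !addr0. Qed.
Let z_dirD e e' : z_dir (e + e') = z_dir e + z_dir e'.
Proof. by rewrite -[z_dir e']scale1r pairD !scale1r !addr0. Qed.

Local Notation Hx := (fun x' => ham t (x', y, z, u1, u2) p q k).
Local Notation Hy := (fun y' => ham t (x, y', z, u1, u2) p q k).
Local Notation Hz := (fun z' => ham t (x, y, z', u1, u2) p q k).
Local Notation L := (ham_derivative t v p q k).

Let FEx (s : R) e : Hx (x + s *: e) = ham t (v + s *: x_dir e) p q k.
Proof. by rewrite x_dirE. Qed.
Let FEy (s : R) e : Hy (y + s *: e) = ham t (v + s *: y_dir e) p q k.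
Proof. by rewrite y_dirE. Qed.
Let FEz (s : R) e : Hz (z + s *: e) = ham t (v + s *: z_dir e) p q k.
Proof. by rewrite z_dirE. Qed.
Let Dx (s : R) e : dom (v + s *: x_dir e). Proof. by rewrite x_dirE. Qed.
Let Dy (s : R) e : dom (v + s *: y_dir e). Proof. by rewrite y_dirE. Qed.
Let Dz (s : R) e : dom (v + s *: z_dir e). Proof. by rewrite z_dirE. Qed.

Lemma grad_ham_x i j : grad Hx x i j = L (x_dir (delta_mx i j)).
Proof. exact: (grad_entry rd (ham_derivativeZ _) FEx Dx). Qed.
Lemma grad_ham_y i j : grad Hy y i j = L (y_dir (delta_mx i j)).
Proof. exact: (grad_entry rd (ham_derivativeZ _) FEy Dy). Qed.
Lemma inner_grad_ham_x h : inner (grad Hx x) h = L (x_dir h).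
Proof. exact: (inner_grad rd (ham_derivativeZ _) (ham_derivativeD _) x_dirZ x_dirD FEx Dx). Qed.
Lemma inner_grad_ham_y h : inner (grad Hy y) h = L (y_dir h).
Proof. exact: (inner_grad rd (ham_derivativeZ _) (ham_derivativeD _) y_dirZ y_dirD FEy Dy). Qed.
Lemma inner_grad_ham_z h : inner (grad Hz z) h = L (z_dir h).
Proof. exact: (inner_grad rd (ham_derivativeZ _) (ham_derivativeD _) z_dirZ z_dirD FEz Dz). Qed.

Lemma grad_ham_x_cvg i j :
  (Hx (x + n0.+1%:R^-1 *: delta_mx i j) - Hx x) * n0.+1%:R @[n0 --> \oo] --> grad Hx x i j.
Proof. exact: (grad_entry_cvg rd (ham_derivativeZ _) FEx Dx). Qed.
Lemma grad_ham_y_cvg i j :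
  (Hy (y + n0.+1%:R^-1 *: delta_mx i j) - Hy y) * n0.+1%:R @[n0 --> \oo] --> grad Hy y i j.
Proof. exact: (grad_entry_cvg rd (ham_derivativeZ _) FEy Dy). Qed.
Section convexity_inequalities.
Variables (x' : 'cV[R]_n) (y' : 'cV[R]_m) (z' : 'M[R]_(m, d))
  (u1' : 'cV[R]_k1) (u2' : 'cV[R]_k2).

Let grads := inner (grad Hx x) (x' - x) + inner (grad Hy y) (y' - y) +
  inner (grad Hz z) (z' - z).

(* At a minimizer the control derivative is nonnegative on admissible
   directions, so convexity needs the state gradients only. *)
Lemma ham_convex_min1 : convex_set U1 -> U1 u1' ->
  convex_function [set w : 'cV[R]_n * 'cV[R]_m * 'M[R]_(m, d) * 'cV[R]_k1 | U1 w.2]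
    (fun w => ham t (w, u2) p q k) ->
  is_min_on U1 (fun w => ham t (x, y, z, w, u2) p q k) (ham t v p q k) ->
  grads <= ham t (x', y', z', u1', u2) p q k - ham t v p q k.
Proof.
move=> cU hu1' cH [_ minH].
pose c_dir : point := (0, 0, 0, u1' - u1, 0).
pose h : point := (x' - x, y' - y, z' - z, u1' - u1, 0).
have hE : h = x_dir (x' - x) + y_dir (y' - y) + z_dir (z' - z) + c_dir.
  rewrite /h /c_dir /x_dir /y_dir /z_dir.
  by rewrite -[X in X + _ + _ + _]scale1r; congr (_, _, _, _, _); rewrite /= ?scaler0 ?scale1r ?(addr0, add0r).
have seg (s : R) : 0 < s <= 1 -> U1 (u1 + s *: (u1' - u1)).
  by move=> /andP[s0 s1]; apply: convex_set_segment; rewrite ?(ltW s0).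
have c_ge0 : 0 <= L c_dir.
  apply: (rel_derivative_ge rd (ham_derivativeZ v)) => s s01.
    by rewrite pairD !scaler0 !addr0; split; [exact: seg|].
  rewrite mulr0 subr_ge0 pairD !scaler0 !addr0; apply: minH.
  by exists (u1 + s *: (u1' - u1)) => //; exact: seg.
have h_le : L h <= ham t (x', y', z', u1', u2) p q k - ham t v p q k.
  apply: (rel_derivative_le rd (ham_derivativeZ v)) => s s01.
    by rewrite pairD scaler0 addr0; split; [exact: seg|].
  have /andP[s0 s1] := s01.
  have := @convex_function_segment R _ _ _ (x, y, z, u1) (x', y', z', u1') s cH hu1 hu1'.
  by rewrite (ltW s0) => /(_ s1); rewrite pairD scaler0 addr0.
apply: le_trans h_le; rewrite hE !ham_derivativeD /grads.
by rewrite inner_grad_ham_x inner_grad_ham_y inner_grad_ham_z lerDl.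
Qed.

Lemma ham_convex_min2 : convex_set U2 -> U2 u2' ->
  convex_function [set w : 'cV[R]_n * 'cV[R]_m * 'M[R]_(m, d) * 'cV[R]_k2 | U2 w.2]
    (fun w => ham t (w.1, u1, w.2) p q k) ->
  is_min_on U2 (fun w => ham t (x, y, z, u1, w) p q k) (ham t v p q k) ->
  grads <= ham t (x', y', z', u1, u2') p q k - ham t v p q k.
Proof.
move=> cU hu2' cH [_ minH].
pose c_dir : point := (0, 0, 0, 0, u2' - u2).
pose h : point := (x' - x, y' - y, z' - z, 0, u2' - u2).
have hE : h = x_dir (x' - x) + y_dir (y' - y) + z_dir (z' - z) + c_dir.
  rewrite /h /c_dir /x_dir /y_dir /z_dir.
  by rewrite -[X in X + _ + _ + _]scale1r; congr (_, _, _, _, _); rewrite /= ?scaler0 ?scale1r ?(addr0, add0r).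
have seg (s : R) : 0 < s <= 1 -> U2 (u2 + s *: (u2' - u2)).
  by move=> /andP[s0 s1]; apply: convex_set_segment; rewrite ?(ltW s0).
have c_ge0 : 0 <= L c_dir.
  apply: (rel_derivative_ge rd (ham_derivativeZ v)) => s s01.
    by rewrite pairD !scaler0 !addr0; split => //; exact: seg.
  rewrite mulr0 subr_ge0 pairD !scaler0 !addr0; apply: minH.
  by exists (u2 + s *: (u2' - u2)) => //; exact: seg.
have h_le : L h <= ham t (x', y', z', u1, u2') p q k - ham t v p q k.
  apply: (rel_derivative_le rd (ham_derivativeZ v)) => s s01.
    by rewrite pairD scaler0 addr0; split => //; exact: seg.
  have /andP[s0 s1] := s01.
  have := @convex_function_segment R _ _ _ (x, y, z, u2) (x', y', z', u2') s cH hu2 hu2'.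
  by rewrite (ltW s0) => /(_ s1); rewrite pairD scaler0 addr0.
apply: le_trans h_le; rewrite hE !ham_derivativeD /grads.
by rewrite inner_grad_ham_x inner_grad_ham_y inner_grad_ham_z lerDl.
Qed.

End convexity_inequalities.
End fixed_time.
End hamiltonian_derivative.

(** * Measurability along processes *)

Section clamp.
Context (R : realType) (disp : measure_display) (Omega : measurableType disp).
Variable T : R.
Hypothesis T0 : 0 < T.

(** Extends a process from [0, T] to all times while keeping its values. Extension by 0 would not do
    before substitution in the coefficients, since 0 may lie outside the control sets. *)
Definition clamp (t : R) : R := Num.max 0 (Num.min t T).

Lemma clamp_itv t : 0 <= clamp t <= T.
Proof. by rewrite /clamp le_max lexx ge_max (ltW T0) ge_min lexx orbT. Qed.

Lemma clamp_id t : 0 <= t <= T -> clamp t = t.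
Proof. by move=> /andP[t0 tT]; rewrite /clamp (min_idPl tT) (max_idPr t0). Qed.

Lemma measurable_clamp : measurable_fun setT (clamp : measurableTypeR R -> measurableTypeR R).
Proof. by apply: measurable_maxr => //; apply: measurable_minr. Qed.

Local Notation strip := ((`[0, T] : set (measurableTypeR R)) `*` (setT : set Omega)).

Lemma measurable_clamped d' (E : measurableType d') (X : R -> Omega -> E) :
  measurable_fun strip (fun z => X z.1 z.2) ->
  measurable_fun setT (fun z : measurableTypeR R * Omega => X (clamp z.1) z.2).
Proof.
move=> mX; apply: (measurable_comp (F := strip) (f := fun z => X z.1 z.2)
    (g := fun z : measurableTypeR R * Omega => (clamp z.1 : measurableTypeR R, z.2))) => //.
- by apply: measurableX => //; exact: measurable_itv.
- by move=> _ [z _ <-]; split => //=; rewrite in_itv/=; exact: clamp_itv.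
- apply: measurable_fun_pair; last exact: measurable_snd.
  exact: (measurableT_comp measurable_clamp).
Qed.

Lemma measurable_zext_clamped (X : R -> Omega -> R) :
  measurable_fun setT (fun z : measurableTypeR R * Omega => X (clamp z.1) z.2) ->
  measurable_fun setT (zext T X).
Proof.
move=> mX; rewrite (_ : zext T X = fun z => (0 <= z.1 <= T)%R%:R * X (clamp z.1) z.2).
  apply: measurable_funM => //.
  by apply: measurable_fun_bool_natr; exact: measurable_itvT_fst.
apply/funext => z; rewrite /zext; have [tT|_] := boolP (0 <= z.1 <= T).
  by rewrite clamp_id.
by rewrite !mul0r.
Qed.

End clamp.

(** * Measurable functions of time, state, controls and adjoint variables *)

Section observables.
Context (R : realType) (d n m k1 k2 : nat) (T : R).
Hypothesis T0 : 0 < T.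
Local Notation point :=
  ('cV[R]_n * 'cV[R]_m * 'M[R]_(m, d) * 'cV[R]_k1 * 'cV[R]_k2)%type.
Variables (U1 : set 'cV[R]_k1) (U2 : set 'cV[R]_k2).
Local Notation dom := (domain U1 U2 : set point).

(* With S the product of time and Omega this yields joint measurability, with S
   the space Omega under the sigma-algebra of a fixed time it yields adaptedness. *)
Definition observable
    (G : R -> point -> 'cV[R]_n -> 'M[R]_(n, d) -> 'cV[R]_m -> R) :=
  forall d' (S : measurableType d') (tau : S -> measurableTypeR R)
    (x : S -> 'cV[R]_n) (y : S -> 'cV[R]_m) (z : S -> 'M[R]_(m, d))
    (u1 : S -> 'cV[R]_k1) (u2 : S -> 'cV[R]_k2)
    (p : S -> 'cV[R]_n) (q : S -> 'M[R]_(n, d)) (k : S -> 'cV[R]_m),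
  measurable_fun setT tau -> (forall s, 0 <= tau s <= T) ->
  measurable_fun setT x -> measurable_fun setT y -> measurable_fun setT z ->
  measurable_fun setT u1 -> measurable_fun setT u2 ->
  measurable_fun setT p -> measurable_fun setT q -> measurable_fun setT k ->
  (forall s, U1 (u1 s)) -> (forall s, U2 (u2 s)) ->
  measurable_fun setT (fun s => G (tau s) (x s, y s, z s, u1 s, u2 s) (p s) (q s) (k s)).

(** The substituted map takes all its values in the domain. There the preimage of Y coincides with a
    measurable set W, so the preimage under the composition is that of W. *)
Lemma measurable_coef_comp d1 (E : measurableType d1) (g : R -> point -> E)
    d' (S : measurableType d') (tau : S -> measurableTypeR R)
    (x : S -> 'cV[R]_n) (y : S -> 'cV[R]_m) (z : S -> 'M[R]_(m, d))
    (u1 : S -> 'cV[R]_k1) (u2 : S -> 'cV[R]_k2) :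
  measurable_coef T U1 U2 g ->
  measurable_fun setT tau -> (forall s, 0 <= tau s <= T) ->
  measurable_fun setT x -> measurable_fun setT y -> measurable_fun setT z ->
  measurable_fun setT u1 -> measurable_fun setT u2 ->
  (forall s, U1 (u1 s)) -> (forall s, U2 (u2 s)) ->
  measurable_fun setT (fun s => g (tau s) (x s, y s, z s, u1 s, u2 s)).
Proof.
move=> mg mtau tauT mx my mz mu1 mu2 hu1 hu2 _ Y mY.
have [W mW WE] := mg Y mY.
pose v s : measurableTypeR R * point := (tau s, (x s, y s, z s, u1 s, u2 s)).
have mv : measurable_fun setT v.
  by do ![apply: measurable_fun_pair => //].
rewrite (_ : _ `&` _ = setT `&` v @^-1` W); first exact: mv.
have vD s : [set tv | 0 <= tv.1 <= T /\ dom tv.2] (v s).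
  by split; [exact: tauT|split; [exact: hu1|exact: hu2]].
apply/seteqP; split => s [_ /=] hs; split => //.
  suff : (([set tv | 0 <= tv.1 <= T /\ dom tv.2] `&` (fun tv => g tv.1 tv.2) @^-1` Y)) (v s).
    by rewrite WE => -[].
  by split.
suff : (([set tv | 0 <= tv.1 <= T /\ dom tv.2] `&` W)) (v s).
  by rewrite -WE => -[].
by split.
Qed.

Lemma observable_entry p' q' (g : R -> point -> 'M[R]_(p', q')) i j :
  measurable_coef T U1 U2 g -> observable (fun t v _ _ _ => g t v i j).
Proof.
move=> mg ? S tau x y z u1 u2 p q k mtau tauT mx my mz mu1 mu2 mp mq mk hu1 hu2.
apply: (measurableT_comp (measurable_entry i j)).
exact: (measurable_coef_comp mg).
Qed.

Lemma observable_scalar (g : R -> point -> R) :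
  measurable_coef T U1 U2 (g : R -> _ -> measurableTypeR R) ->
  observable (fun t v _ _ _ => g t v).
Proof.
move=> mg ? S tau x y z u1 u2 p q k mtau tauT mx my mz mu1 mu2 mp mq mk hu1 hu2.
exact: (measurable_coef_comp mg).
Qed.

Section along_processes.
Context (disp : measure_display) (Omega : measurableType disp).
Variables (P : probability Omega R) (B : R -> Omega -> 'cV[R]_d).

Definition good_process p q (X : R -> Omega -> 'M[R]_(p, q)) :=
  measurable_fun ((`[0, T] : set (measurableTypeR R)) `*` setT)
    (fun tw : measurableTypeR R * Omega => X tw.1 tw.2) /\ adapted P B T X.

Lemma M2_good p q (X : R -> Omega -> 'M[R]_(p, q)) : M2 P B T X -> good_process X.
Proof. by move=> []. Qed.

Lemma S2_good p q (X : R -> Omega -> 'M[R]_(p, q)) : measure_is_complete P ->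
  brownian_motion P B -> S2 P B T X -> good_process X.
Proof.
move=> cP hB sX; split; last by case: sX.
apply/measurable_fun_mxP => i j; apply/(measurable_zextP T (fun t w => X t w i j)).
exact: measurable_S2 sX.
Qed.

Variables (x : R -> Omega -> 'cV[R]_n) (y : R -> Omega -> 'cV[R]_m)
  (z : R -> Omega -> 'M[R]_(m, d)) (u1 : R -> Omega -> 'cV[R]_k1)
  (u2 : R -> Omega -> 'cV[R]_k2) (p : R -> Omega -> 'cV[R]_n)
  (q : R -> Omega -> 'M[R]_(n, d)) (k : R -> Omega -> 'cV[R]_m).
Hypotheses (gx : good_process x) (gy : good_process y) (gz : good_process z)
  (gu1 : good_process u1) (gu2 : good_process u2) (gp : good_process p)
  (gq : good_process q) (gk : good_process k).
Hypotheses (hu1 : forall t w, 0 <= t <= T -> U1 (u1 t w))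
  (hu2 : forall t w, 0 <= t <= T -> U2 (u2 t w)).

Lemma observable_joint G : observable G -> measurable_fun setT (zext T (fun t w =>
  G t (x t w, y t w, z t w, u1 t w, u2 t w) (p t w) (q t w) (k t w))).
Proof.
move=> oG; apply: measurable_zext_clamped.
have mc p' q' (X : R -> Omega -> 'M[R]_(p', q')) : good_process X ->
    measurable_fun setT (fun z : measurableTypeR R * Omega => X (clamp T z.1) z.2).
  by move=> [mX _]; exact: measurable_clamped.
apply: oG; do ?exact: mc.
- exact: (measurableT_comp (measurable_clamp T)).
- by move=> s; exact: clamp_itv.
- by move=> s; apply: hu1; exact: clamp_itv.
- by move=> s; apply: hu2; exact: clamp_itv.
Qed.

Lemma observable_adapted G s : observable G -> 0 <= s <= T -> fmeasurable P B s (fun w =>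
  G s (x s w, y s w, z s w, u1 s w, u2 s w) (p s w) (q s w) (k s w)).
Proof.
move=> oG sT.
have ma p' q' (X : R -> Omega -> 'M[R]_(p', q')) : good_process X ->
    measurable_fun [set: filtration_type P B s] (X s).
  by move=> [_ aX] _ Y mY; rewrite setTI; exact: (aX s sT).
apply: (oG _ (filtration_type P B s) (fun=> s)); do ?exact: ma.
- exact: measurable_cst.
- by [].
- by move=> w; exact: hu1.
- by move=> w; exact: hu2.
Qed.

End along_processes.
End observables.

(* Round the vector to a finer and finer grid. *)
Lemma continuous_measurable_comp (R : realType) d (S : measurableType d) (N : nat)
    (F : 'cV[R]_N -> R) (X : S -> 'cV[R]_N) :
  continuous F -> measurable_fun setT X -> measurable_fun setT (fun w => F (X w)).
Proof.
move=> cF mX.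
have mXi i : measurable_fun setT (fun w => X w i 0) by exact: (measurable_fun_mxP _ _).1.
pose Z n w : 'cV[int]_N := \matrix_(i, j) Num.floor (X w i j * n.+1%:R).
pose r n (c : 'cV[int]_N) : 'cV[R]_N := \matrix_(i, j) ((c i j)%:~R / n.+1%:R).
have mZ n c : measurable [set w | Z n w = c].
  rewrite (_ : [set w | _] = \bigcap_(i in [set: 'I_N])
    [set w | (c i 0)%:~R <= X w i 0 * n.+1%:R < (c i 0 + 1)%:~R]).
    apply: fin_bigcap_measurable; first exact: finite_finset.
    move=> i _.
    have mf : measurable_fun setT (fun w => X w i 0 * (n.+1%:R : R)) by exact: measurable_funM.
    have mb : measurable_fun setT (fun w => (c i 0)%:~R <= X w i 0 * n.+1%:R < (c i 0 + 1)%:~R).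
      by apply: measurable_and; [exact: measurable_fun_ler|exact: measurable_fun_ltr].
    by have := mb measurableT [set true]; rewrite setTI; apply.
  apply/seteqP; split=> w /=.
    by move=> <- i _ /=; rewrite !mxE floor_itv.
  move=> h; apply/matrixP => i j; rewrite [j]ord1 mxE.
  by apply/floor_def; exact: h.
(* Rounded vectors take countably many values, so this holds for any F; continuity enters in the
   limit only. *)
have mFZ n : measurable_fun setT (fun w => F (r n (Z n w))).
  move=> _ A mA; rewrite setTI.
  rewrite (_ : _ @^-1` A = \bigcup_c ([set w | Z n w = c] `&` [set w | A (F (r n c))])).
    apply: countable_bigcupT_measurable; first exact: countableP.
    move=> c; apply: measurableI => //; have [AF|AF] := pselect (A (F (r n c))).
      by rewrite (_ : [set w | _] = setT)//; apply/seteqP; split.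
    by rewrite (_ : [set w | _] = set0)//; apply/seteqP; split.
  by apply/seteqP; split => w /= => [Aw|[c _ [<- //]]]; exists (Z n w).
apply: (measurable_fun_cvg mFZ) => w _.
apply: (cvg_comp (fun n => r n (Z n w)) F _ (cF (X w))).
apply/cvgrPdist_le => e e0.
have near_n : \forall n \near \oo, (n.+1%:R : R)^-1 < e := near_infty_natSinv_lt (PosNum e0).
apply: filterS near_n => n ne.
rewrite -[leLHS]/(mx_norm _) mx_normrE; apply: bigmax_le; first exact: ltW.
move=> [i j] _ /=; rewrite !mxE; apply: le_trans (ltW ne).
have n0 : (0 : R) < n.+1%:R by rewrite ltr0n.
have /andP[f1 f2] := floor_itv (X w i j * n.+1%:R).
have -> : X w i j - (Num.floor (X w i j * n.+1%:R))%:~R / n.+1%:R =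
    (X w i j * n.+1%:R - (Num.floor (X w i j * n.+1%:R))%:~R) * n.+1%:R^-1.
  by field; rewrite gt_eqF.
rewrite ger0_norm; last by rewrite mulr_ge0 ?subr_ge0// invr_ge0 ltW.
rewrite ler_piMl ?invr_ge0 ?(ltW n0)//.
by move: f2; rewrite intrD; lra.
Qed.

Lemma inner_le (R : realType) p q (A C : 'M[R]_(p, q)) : `|inner A C| <= l1norm A * `|C|.
Proof.
rewrite innerE /l1norm mulr_suml; apply: le_trans (ler_norm_sum _ _ _) _.
apply: ler_sum => i _; rewrite mulr_suml; apply: le_trans (ler_norm_sum _ _ _) _.
apply: ler_sum => j _; rewrite normrM ler_wpM2l//; exact: entry_le_norm.
Qed.

Lemma norm_pair_le (R : realType) (V W : normedModType R) (v : V) (w : W) :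
  `|(v, w)| <= `|v| + `|w|.
Proof. by rewrite prod_normE /= ge_max lerDl lerDr !normr_ge0. Qed.

(** * Measurability and growth of the Hamiltonian and its gradients *)

Section observable_hamiltonian.
Context (R : realType) (d n m k1 k2 : nat) (T : R).
Local Notation point :=
  ('cV[R]_n * 'cV[R]_m * 'M[R]_(m, d) * 'cV[R]_k1 * 'cV[R]_k2)%type.
Variables (U1 : set 'cV[R]_k1) (U2 : set 'cV[R]_k2).
Variables (b : R -> point -> 'cV[R]_n) (sigma : R -> point -> 'M[R]_(n, d))
  (f : R -> point -> 'cV[R]_m) (l : R -> point -> R).
Hypotheses (mb : measurable_coef T U1 U2 b) (msigma : measurable_coef T U1 U2 sigma)
  (mf : measurable_coef T U1 U2 f)
  (ml : measurable_coef T U1 U2 (l : R -> _ -> measurableTypeR R)).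
Variables (db : R -> point -> {linear point -> 'cV[R]_n})
  (dsigma : R -> point -> {linear point -> 'M[R]_(n, d)})
  (df : R -> point -> {linear point -> 'cV[R]_m})
  (dl : R -> point -> {linear point -> R^o}).
Local Notation dom := (domain U1 U2 : set point).
Local Notation ham := (hamiltonian b sigma f l).
Hypotheses (cb : forall t, 0 <= t <= T -> C1_on dom (b t) (db t))
  (csigma : forall t, 0 <= t <= T -> C1_on dom (sigma t) (dsigma t))
  (cf : forall t, 0 <= t <= T -> C1_on dom (f t) (df t))
  (cl : forall t, 0 <= t <= T -> C1_on dom (l t : _ -> R^o) (dl t)).

Lemma observable_ham : observable T U1 U2 ham.
Proof.
move=> ? S tau x y z u1 u2 p q k mtau tauT mx my mz mu1 mu2 mp mq mk hu1 hu2.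
have mob G (oG : observable T U1 U2 G) :=
  oG _ S _ _ _ _ _ _ _ _ _ mtau tauT mx my mz mu1 mu2 mp mq mk hu1 hu2.
have minner p' q' (X : S -> 'M[R]_(p', q')) (g : R -> point -> 'M[R]_(p', q')) :
    measurable_fun setT X -> measurable_coef T U1 U2 g ->
    measurable_fun setT (fun s => inner (X s) (g (tau s) (x s, y s, z s, u1 s, u2 s))).
  move=> mX mg; under eq_fun do rewrite innerE.
  apply: measurable_sum => i; apply: measurable_sum => j; apply: measurable_funM.
    exact: (measurable_fun_mxP _ _).1.
  exact: (mob _ (observable_entry i j mg)).
rewrite /hamiltonian; apply: measurable_funD; last exact: (mob _ (observable_scalar ml)).
apply: measurable_funD; last exact: minner.
apply: measurable_funD; last exact: minner.
rewrite (_ : (fun s => _) = fun s => - inner (k s) (f (tau s) (x s, y s, z s, u1 s, u2 s))).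
  by apply: measurable_funN; exact: minner.
by apply/funext => s; rewrite innerN.
Qed.

Let measurable_shift d' (S : measurableType d') p q (X : S -> 'M[R]_(p, q)) (A : 'M[R]_(p, q)) :
  measurable_fun setT X -> measurable_fun setT (fun s => X s + A).
Proof.
move=> /measurable_fun_mxP mX; apply/measurable_fun_mxP => i j.
by under eq_fun do rewrite mxE; exact: measurable_funD.
Qed.

(** A limit of difference quotients of H; shifting x does not leave the domain, which restricts the
    controls alone. *)
Lemma observable_grad_x i j : observable T U1 U2 (fun t v p q k =>
  grad (fun x' => ham t (x', v.1.1.1.2, v.1.1.2, v.1.2, v.2) p q k) v.1.1.1.1 i j).
Proof.
move=> ? S tau x y z u1 u2 p q k mtau tauT mx my mz mu1 mu2 mp mq mk hu1 hu2 /=.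
apply: measurable_fun_cvg => [N|s _]; last first.
  exact: (grad_ham_x_cvg (cb (tauT s)) (csigma (tauT s)) (cf (tauT s)) (cl (tauT s))).
apply: measurable_funM => //; apply: measurable_funB; apply: observable_ham => //.
exact: measurable_shift.
Qed.

Lemma observable_grad_y i j : observable T U1 U2 (fun t v p q k =>
  grad (fun y' => ham t (v.1.1.1.1, y', v.1.1.2, v.1.2, v.2) p q k) v.1.1.1.2 i j).
Proof.
move=> ? S tau x y z u1 u2 p q k mtau tauT mx my mz mu1 mu2 mp mq mk hu1 hu2 /=.
apply: measurable_fun_cvg => [N|s _]; last first.
  exact: (grad_ham_y_cvg (cb (tauT s)) (csigma (tauT s)) (cf (tauT s)) (cl (tauT s))).
apply: measurable_funM => //; apply: measurable_funB; apply: observable_ham => //.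
exact: measurable_shift.
Qed.

Variables (Cb Cs Cf Cl : R).
Hypotheses (bb : forall t v h, 0 <= t <= T -> dom v -> `|db t v h| <= Cb * `|h|)
  (bs : forall t v h, 0 <= t <= T -> dom v -> `|dsigma t v h| <= Cs * `|h|)
  (bf : forall t v h, 0 <= t <= T -> dom v -> `|df t v h| <= Cf * `|h|).
Hypothesis bl : forall t (x : 'cV[R]_n) (y : 'cV[R]_m) (z : 'M[R]_(m, d))
  (u1 : 'cV[R]_k1) (u2 : 'cV[R]_k2) e, 0 <= t <= T -> U1 u1 -> U2 u2 ->
  `|dl t (x, y, z, u1, u2) e| <=
    Cl * (1 + enorm x + enorm y + enorm z + enorm u1 + enorm u2) * `|e|.

Definition total_norm (x : 'cV[R]_n) (y : 'cV[R]_m) (z : 'M[R]_(m, d))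
    (u1 : 'cV[R]_k1) (u2 : 'cV[R]_k2) (p : 'cV[R]_n) (q : 'M[R]_(n, d)) (k : 'cV[R]_m) : R :=
  1 + l1norm x + l1norm y + l1norm z + l1norm u1 + l1norm u2 +
  (l1norm p + l1norm q + l1norm k).

(** The derivatives of b, sigma and f are bounded and are multiplied by the adjoint variables, while
    the derivative of l grows linearly. The bound is thus linear in the processes, which makes it
    square integrable along them. *)
Lemma ham_derivative_bound t x y z u1 u2 p q k h : 0 <= t <= T -> U1 u1 -> U2 u2 ->
  `|ham_derivative db dsigma df dl t (x, y, z, u1, u2) p q k h| <=
  (`|Cb| + `|Cs| + `|Cf| + `|Cl|) * total_norm x y z u1 u2 p q k * `|h|.
Proof.
move=> tT hu1 hu2; set v := (x, y, z, u1, u2); have Dv : dom v by [].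
have nx := l1norm_ge0 x; have ny := l1norm_ge0 y; have nz := l1norm_ge0 z.
have n1 := l1norm_ge0 u1; have n2 := l1norm_ge0 u2; have np := l1norm_ge0 p.
have nq := l1norm_ge0 q; have nk := l1norm_ge0 k.
have step p' q' (c g : 'M[R]_(p', q')) C : `|g| <= C * `|h| ->
    l1norm c <= total_norm x y z u1 u2 p q k ->
    `|inner c g| <= `|C| * total_norm x y z u1 u2 p q k * `|h|.
  move=> gC cN; apply: le_trans (inner_le _ _) _.
  apply: (@le_trans _ _ (l1norm c * (`|C| * `|h|))).
    apply: ler_wpM2l; first exact: l1norm_ge0.
    by apply: le_trans gC _; rewrite ler_wpM2r// ler_norm.
  by rewrite mulrCA mulrA ler_wpM2r// ler_wpM2l.
have hl : `|dl t v h| <= `|Cl| * total_norm x y z u1 u2 p q k * `|h|.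
  apply: le_trans (bl x y z h tT hu1 hu2) _; rewrite ler_wpM2r//.
  have ex := enorm_le_l1norm x; have ey := enorm_le_l1norm y; have ez := enorm_le_l1norm z.
  have e1 := enorm_le_l1norm u1; have e2 := enorm_le_l1norm u2.
  have [s0x s0y s0z] : [/\ 0 <= enorm x, 0 <= enorm y & 0 <= enorm z] by split; exact: sqrtr_ge0.
  have [s01 s02] : 0 <= enorm u1 /\ 0 <= enorm u2 by split; exact: sqrtr_ge0.
  apply: (@le_trans _ _ (`|Cl| * (1 + enorm x + enorm y + enorm z + enorm u1 + enorm u2))).
    by rewrite ler_wpM2r ?ler_norm//; lra.
  by rewrite ler_wpM2l// /total_norm; lra.
have hf : `|inner k (- df t v h)| <= `|Cf| * total_norm x y z u1 u2 p q k * `|h|.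
  by apply: step; [rewrite normrN; exact: bf|rewrite /total_norm; lra].
have hb : `|inner p (db t v h)| <= `|Cb| * total_norm x y z u1 u2 p q k * `|h|.
  by apply: step; [exact: bb|rewrite /total_norm; lra].
have hs : `|inner q (dsigma t v h)| <= `|Cs| * total_norm x y z u1 u2 p q k * `|h|.
  by apply: step; [exact: bs|rewrite /total_norm; lra].
rewrite /ham_derivative -/v !mulrDl; apply: le_trans (ler_normD _ _) _.
have := ler_normD (inner k (- df t v h) + inner p (db t v h)) (inner q (dsigma t v h)).
have := ler_normD (inner k (- df t v h)) (inner p (db t v h)).
by move: hl hf hb hs => /=; lra.
Qed.

(** Convexity of the control sets keeps the segment between the two points in the domain, where the
    derivative is bounded. *)
Lemma coef_lipschitz p' q' (g : R -> point -> 'M[R]_(p', q'))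
    (dg : R -> point -> {linear point -> 'M[R]_(p', q')}) (C : R) t
    (x x' : 'cV[R]_n) (y y' : 'cV[R]_m) (z z' : 'M[R]_(m, d))
    (u1 u1' : 'cV[R]_k1) (u2 u2' : 'cV[R]_k2) i j :
  convex_set U1 -> convex_set U2 -> C1_on dom (g t) (dg t) ->
  (forall v h, dom v -> `|dg t v h| <= C * `|h|) ->
  U1 u1 -> U2 u2 -> U1 u1' -> U2 u2' ->
  `|g t (x', y', z', u1', u2') i j - g t (x, y, z, u1, u2) i j| <=
  `|C| * (l1norm (x' - x) + l1norm (y' - y) + l1norm (z' - z) +
          l1norm (u1' - u1) + l1norm (u2' - u2)).
Proof.
move=> c1 c2 cg bg h1 h2 h1' h2'.
pose v : point := (x, y, z, u1, u2); pose v' : point := (x', y', z', u1', u2').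
apply: (@le_trans _ _ (C * `|v' - v|)).
  apply: (rel_derivative_lipschitz (D := dom) (g := fun w => g t w i j)
    (dg := fun w h => dg t w h i j)).
  - by move=> u Du; exact: C1_on_entry.
  - by move=> u; exact: homogeneous_entry.
  - by move=> u Du h; apply: le_trans (entry_le_norm _ _ _) (bg _ _ Du).
  - by move=> s s01; split; apply: convex_set_segment.
apply: (@le_trans _ _ (`|C| * `|v' - v|)); first by rewrite ler_wpM2r// ler_norm.
rewrite ler_wpM2l//.
apply: le_trans (norm_pair_le _ _) _; apply: lerD; last exact: norm_le_l1norm.
apply: le_trans (norm_pair_le _ _) _; apply: lerD; last exact: norm_le_l1norm.
apply: le_trans (norm_pair_le _ _) _; apply: lerD; last exact: norm_le_l1norm.
apply: le_trans (norm_pair_le _ _) _.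
by apply: lerD; exact: norm_le_l1norm.
Qed.

End observable_hamiltonian.

(** * Comparison of costs *)

Section sqint_process_closure.
Context (R : realType) (disp : measure_display) (Omega : measurableType disp).
Variables (P : probability Omega R) (T : R).
Hypothesis T0 : 0 < T.
Local Notation mP := (@lebesgue_measure R \x P)%E.
Local Notation sqp := (sqint_process P T).
Implicit Types X Y : R -> Omega -> R.

Lemma sqint_process_le X Y : measurable_fun setT (zext T X) -> sqp Y ->
  (forall t w, 0 <= t <= T -> `|X t w| <= `|Y t w|) -> sqp X.
Proof.
move=> mX sY XY; apply: sqint_le mX sY _ => -[t w].
have [tT|tT] := boolP (0 <= t <= T); first by rewrite !zext_itv//; exact: XY.
by rewrite zext_out// normr0.
Qed.

Lemma sqint_processD X Y : sqp X -> sqp Y -> sqp (fun t w => X t w + Y t w).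
Proof.
move=> sX sY; have := sqintD sX sY; congr (sqintble mP _); apply/funext => z.
by rewrite zextD.
Qed.

Lemma sqint_processZ (c : R) X : sqp X -> sqp (fun t w => c * X t w).
Proof.
move=> sX; have := sqintZ c sX; congr (sqintble mP _); apply/funext => z.
by rewrite /zext mulrCA.
Qed.

Lemma sqint_process_l1norm p q (X : R -> Omega -> 'M[R]_(p, q)) :
  (forall i j, sqp (fun t w => X t w i j)) -> sqp (fun t w => l1norm (X t w)).
Proof.
move=> sX.
have : sqintble mP (fun z => \sum_i \sum_j `|zext T (fun t w => X t w i j) z|).
  apply: sqint_sum => i _; apply: sqint_sum => j _; apply: sqint_le (sX i j) _.
    by apply: measurableT_comp => //; case: (sX i j).
  by move=> z; rewrite normr_id.
congr (sqintble mP _); apply/funext => z; rewrite /zext /l1norm mulr_sumr.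
apply: eq_bigr => i _; rewrite mulr_sumr; apply: eq_bigr => j _.
by rewrite normrM ger0_norm.
Qed.

End sqint_process_closure.

Section drifts.
Context (R : realType) (disp : measure_display) (Omega : measurableType disp).
Variables (P : probability Omega R) (T : R).
Hypotheses (cP : measure_is_complete P) (T0 : 0 < T).
Context (d n m k1 k2 : nat).
Variable B : R -> Omega -> 'cV[R]_d.
Hypothesis hB : brownian_motion P B.
Local Notation point :=
  ('cV[R]_n * 'cV[R]_m * 'M[R]_(m, d) * 'cV[R]_k1 * 'cV[R]_k2)%type.
Local Notation sqp := (sqint_process P T).
Variables (U1 : set 'cV[R]_k1) (U2 : set 'cV[R]_k2).
Local Notation dom := (domain U1 U2 : set point).
Variables (u1 : R -> Omega -> 'cV[R]_k1) (u2 : R -> Omega -> 'cV[R]_k2)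
  (x : R -> Omega -> 'cV[R]_n) (y : R -> Omega -> 'cV[R]_m)
  (z : R -> Omega -> 'M[R]_(m, d)).
Hypotheses (adm1 : admissible P B T U1 u1) (adm2 : admissible P B T U2 u2)
  (Sx : S2 P B T x) (Sy : S2 P B T y) (Mz : M2 P B T z).

Variables (p : R -> Omega -> 'cV[R]_n) (q : R -> Omega -> 'M[R]_(n, d))
  (k : R -> Omega -> 'cV[R]_m).
Hypotheses (Sp : S2 P B T p) (Mq : M2 P B T q) (Sk : S2 P B T k).

Let hu1 : forall t w, 0 <= t <= T -> U1 (u1 t w). Proof. by case: adm1. Qed.
Let hu2 : forall t w, 0 <= t <= T -> U2 (u2 t w). Proof. by case: adm2. Qed.
Let gu1 := M2_good adm1.1.
Let gu2 := M2_good adm2.1.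
Let gx := S2_good cP hB Sx.
Let gy := S2_good cP hB Sy.
Let gz := M2_good Mz.
Let gp := S2_good cP hB Sp.
Let gq := M2_good Mq.
Let gk := S2_good cP hB Sk.

Lemma observable_joint_state G : observable T U1 U2 G ->
  measurable_fun setT (zext T (fun t w =>
    G t (x t w, y t w, z t w, u1 t w, u2 t w) (p t w) (q t w) (k t w))).
Proof. exact: (observable_joint T0 gx gy gz gu1 gu2 gp gq gk hu1 hu2). Qed.

Lemma observable_adapted_state G s : observable T U1 U2 G -> 0 <= s <= T ->
  fmeasurable P B s (fun w =>
    G s (x s w, y s w, z s w, u1 s w, u2 s w) (p s w) (q s w) (k s w)).
Proof. exact: (observable_adapted gx gy gz gu1 gu2 gp gq gk hu1 hu2). Qed.

Section cost_density.
Variable l : R -> point -> R.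
Hypothesis ml : measurable_coef T U1 U2 (l : R -> _ -> measurableTypeR R).
Variable C : R.
Hypothesis bl : forall t (x : 'cV[R]_n) (y : 'cV[R]_m) (z : 'M[R]_(m, d))
  (u1 : 'cV[R]_k1) (u2 : 'cV[R]_k2), 0 <= t <= T -> U1 u1 -> U2 u2 ->
  `|l t (x, y, z, u1, u2)| <=
    C * (1 + sqnorm x + sqnorm y + sqnorm z + sqnorm u1 + sqnorm u2).

Lemma intble_cost_density : intble (@lebesgue_measure R \x P)%E
  (zext T (fun t w => l t (x t w, y t w, z t w, u1 t w, u2 t w))).
Proof.
have sx i j := S2_sqint_process cP hB i j Sx.
have sy i j := S2_sqint_process cP hB i j Sy.
have sz i j := M2_sqint_process i j Mz.
have s1 i j := M2_sqint_process i j adm1.1.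
have s2 i j := M2_sqint_process i j adm2.1.
have i1 : intble (@lebesgue_measure R \x P)%E (zext T (fun _ (_ : Omega) => 1)).
  apply: sqint_process_intble => //; apply: sqint_process_cst => //; split => //.
  exact: finite_measure_integrable_cst.
have := intbleD (intbleD (intbleD (intbleD (intbleD i1 (intble_inner_process sx sx))
  (intble_inner_process sy sy)) (intble_inner_process sz sz))
  (intble_inner_process s1 s1)) (intble_inner_process s2 s2).
move=> /(intbleZ C) h; apply: (intble_le _ h).
  exact: (observable_joint_state (observable_scalar ml)).
move=> [t w]; rewrite -!zextD.
have [tT|tT] := boolP (0 <= t <= T); last by rewrite !zext_out// normr0 mulr0.
by rewrite !zext_itv//; apply: bl => //; [exact: hu1|exact: hu2].
Qed.

End cost_density.

Section coefficients.
Variables (b : R -> point -> 'cV[R]_n) (sigma : R -> point -> 'M[R]_(n, d))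
  (f : R -> point -> 'cV[R]_m) (l : R -> point -> R).
Hypotheses (mb : measurable_coef T U1 U2 b) (msigma : measurable_coef T U1 U2 sigma)
  (mf : measurable_coef T U1 U2 f)
  (ml : measurable_coef T U1 U2 (l : R -> _ -> measurableTypeR R)).
Variables (db : R -> point -> {linear point -> 'cV[R]_n})
  (dsigma : R -> point -> {linear point -> 'M[R]_(n, d)})
  (df : R -> point -> {linear point -> 'cV[R]_m})
  (dl : R -> point -> {linear point -> R^o}).
Local Notation ham := (hamiltonian b sigma f l).
Hypotheses (cb : forall t, 0 <= t <= T -> C1_on dom (b t) (db t))
  (csigma : forall t, 0 <= t <= T -> C1_on dom (sigma t) (dsigma t))
  (cf : forall t, 0 <= t <= T -> C1_on dom (f t) (df t))
  (cl : forall t, 0 <= t <= T -> C1_on dom (l t : _ -> R^o) (dl t)).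
Variables (Cb Cs Cf Cl : R).
Hypotheses (bb : forall t v h, 0 <= t <= T -> dom v -> `|db t v h| <= Cb * `|h|)
  (bs : forall t v h, 0 <= t <= T -> dom v -> `|dsigma t v h| <= Cs * `|h|)
  (bf : forall t v h, 0 <= t <= T -> dom v -> `|df t v h| <= Cf * `|h|).
Hypothesis bl : forall t (x : 'cV[R]_n) (y : 'cV[R]_m) (z : 'M[R]_(m, d))
  (u1 : 'cV[R]_k1) (u2 : 'cV[R]_k2) e, 0 <= t <= T -> U1 u1 -> U2 u2 ->
  `|dl t (x, y, z, u1, u2) e| <=
    Cl * (1 + enorm x + enorm y + enorm z + enorm u1 + enorm u2) * `|e|.

Let sx i j := S2_sqint_process cP hB i j Sx.
Let sy i j := S2_sqint_process cP hB i j Sy.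
Let sz i j := M2_sqint_process i j Mz.
Let s1 i j := M2_sqint_process i j adm1.1.
Let s2 i j := M2_sqint_process i j adm2.1.
Let sp i j := S2_sqint_process cP hB i j Sp.
Let sq i j := M2_sqint_process i j Mq.
Let sk i j := S2_sqint_process cP hB i j Sk.

Let sqint_total_norm : sqp (fun t w =>
  total_norm (x t w) (y t w) (z t w) (u1 t w) (u2 t w) (p t w) (q t w) (k t w)).
Proof.
have i1 : sqp (fun _ (_ : Omega) => 1).
  apply: sqint_process_cst => //; split => //.
  exact: finite_measure_integrable_cst.
by do ![apply: sqint_processD|apply: sqint_process_l1norm].
Qed.

(** The common core of the x and y gradients: each entry is the derivative of H in a fixed
    coordinate direction h. *)
Let sqint_derivative (G : R -> point -> 'cV[R]_n -> 'M[R]_(n, d) -> 'cV[R]_m -> R) h :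
  observable T U1 U2 G ->
  (forall t w, 0 <= t <= T ->
    G t (x t w, y t w, z t w, u1 t w, u2 t w) (p t w) (q t w) (k t w) =
    ham_derivative db dsigma df dl t (x t w, y t w, z t w, u1 t w, u2 t w)
      (p t w) (q t w) (k t w) h) ->
  sqp (fun t w => G t (x t w, y t w, z t w, u1 t w, u2 t w) (p t w) (q t w) (k t w)).
Proof.
move=> oG GE.
have := sqint_processZ ((`|Cb| + `|Cs| + `|Cf| + `|Cl|) * `|h|) sqint_total_norm => sN.
apply: (sqint_process_le _ sN); first exact: observable_joint_state.
move=> t w tT; rewrite GE// mulrAC; apply: le_trans _ (ler_norm _).
by apply: (ham_derivative_bound bb bs bf bl) => //; [exact: hu1|exact: hu2].
Qed.

Lemma sqint_grad_x i j : sqp (fun t w =>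
  grad (fun x' => ham t (x', y t w, z t w, u1 t w, u2 t w) (p t w) (q t w) (k t w)) (x t w) i j).
Proof.
apply: (sqint_derivative (observable_grad_x mb msigma mf ml cb csigma cf cl i j)) => t w tT.
exact: (grad_ham_x (cb tT) (csigma tT) (cf tT) (cl tT) _ _ _ _ _ _ (hu1 w tT) (hu2 w tT)).
Qed.

Lemma sqint_grad_y i j : sqp (fun t w =>
  grad (fun y' => ham t (x t w, y', z t w, u1 t w, u2 t w) (p t w) (q t w) (k t w)) (y t w) i j).
Proof.
apply: (sqint_derivative (observable_grad_y mb msigma mf ml cb csigma cf cl i j)) => t w tT.
exact: (grad_ham_y (cb tT) (csigma tT) (cf tT) (cl tT) _ _ _ _ _ _ (hu1 w tT) (hu2 w tT)).
Qed.

End coefficients.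
End drifts.

Lemma ae_imply d (S : measurableType d) (R : realType)
    (m : {measure set S -> \bar R}) (p q : S -> Prop) :
  {ae m, forall x, p x} -> (forall x, p x -> q x) -> {ae m, forall x, q x}.
Proof. by move=> hp pq; apply: filterS hp. Qed.

Lemma le_Rintegral_ae d (S : measurableType d) (R : realType)
    (m : {measure set S -> \bar R}) (f g : S -> R) :
  intble m f -> intble m g -> {ae m, forall x, f x <= g x} ->
  \int[m]_x f x <= \int[m]_x g x.
Proof.
move=> If Ig fg; rewrite -subr_ge0 -RintegralB//.
have mgf := intble_meas (intbleB Ig If).
rewrite (_ : Rintegral _ _ _ = \int[m]_x `|g x - f x|); first by apply: Rintegral_ge0.
apply: ae_eq_Rintegral => //; first exact: measurableT_comp.
by apply: filterS fg => x fgx; rewrite ger0_norm// subr_ge0.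
Qed.

(** * Duality between state and adjoint, and the cost inequality *)

Section comparison.
Context (R : realType) (disp : measure_display) (Omega : measurableType disp).
Variables (P : probability Omega R) (T : R).
Hypotheses (cP : measure_is_complete P) (T0 : 0 < T).
Context (d n m k1 k2 : nat).
Variable B : R -> Omega -> 'cV[R]_d.
Hypothesis hB : brownian_motion P B.
Local Notation point :=
  ('cV[R]_n * 'cV[R]_m * 'M[R]_(m, d) * 'cV[R]_k1 * 'cV[R]_k2)%type.
Local Notation mu := (@lebesgue_measure R).
Local Notation mP := (mu \x P)%E.
Local Notation sqp := (sqint_process P T).
Variables (U1 : set 'cV[R]_k1) (U2 : set 'cV[R]_k2).
Hypotheses (U1_convex : convex_set U1) (U2_convex : convex_set U2).
Local Notation dom := (domain U1 U2 : set point).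

Section cost_value.
Variables (u1 : R -> Omega -> 'cV[R]_k1) (u2 : R -> Omega -> 'cV[R]_k2)
  (x : R -> Omega -> 'cV[R]_n) (y : R -> Omega -> 'cV[R]_m)
  (z : R -> Omega -> 'M[R]_(m, d)).
Variables (l : R -> point -> R) (phi : 'cV[R]_n -> R) (h : 'cV[R]_m -> R).
Hypothesis il : intble mP (zext T (fun t w => l t (x t w, y t w, z t w, u1 t w, u2 t w))).
Hypotheses (iphi : intble P (fun w => phi (x T w))) (ih : intble P (fun w => h (y 0 w))).

(** Fubini turns the cost into a sum of real integrals, so that two costs can be compared through
    their difference. *)
Lemma cost_fin : cost P T l phi h u1 u2 x y z =
  (\int[mP]_s zext T (fun t w => l t (x t w, y t w, z t w, u1 t w, u2 t w)) s +
   \int[P]_w phi (x T w) + \int[P]_w h (y 0 w))%:E.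
Proof.
set L := fun t w => l t (x t w, y t w, z t w, u1 t w, u2 t w).
have TT : 0 <= T <= T by rewrite lexx ltW.
have LE w : \int[mu]_(t in `[0, T]) L t w = \int[mu]_t zext T L (t, w).
  rewrite (Rintegral_itv_zext L w TT); apply: eq_Rintegral => s _.
  rewrite /zext /=; case: (leP s T) => sT; rewrite ?mul1r// mul0r andbF mul0r//.
have iL : intble P (fun w => \int[mu]_t zext T L (t, w)) by exact: intble_int_fst il.
have i2 := intbleD (intbleD iL iphi) ih.
have e : (fun w => \int[mu]_(t in `[0, T]) l t (x t w, y t w, z t w, u1 t w, u2 t w) +
    phi (x T w) + h (y 0 w)) = fun w => \int[mu]_t zext T L (t, w) + phi (x T w) + h (y 0 w).
  by apply/funext => w; rewrite -LE.
rewrite /cost e unlock Rintegral_prod_fst// -!RintegralD//; last exact: intbleD.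
by rewrite fineK//; exact: integrable_fin_num i2.
Qed.

End cost_value.

Lemma intble_growth N (F : 'cV[R]_N -> R) (C : R) (X : R -> Omega -> 'cV[R]_N) t :
  C1_everywhere F -> (forall v, `|F v| <= C * (1 + sqnorm v)) -> S2 P B T X ->
  0 <= t <= T -> intble P (fun w => F (X t w)).
Proof.
move=> [dF _] FC SX tT; have /andP[t0 _] := tT.
have sX i j : sqintble P (fun w => X t w i j).
  by have [K hK] := S2_sqint cP hB i j SX; case: (hK t tT).
have i1 : intble P (fun _ : Omega => (1 : R)) by exact: finite_measure_integrable_cst.
have := intbleZ C (intbleD i1 (intble_inner sX sX)) => iC.
apply: (intble_le _ iC) => [|w]; last exact: FC.
apply: continuous_measurable_comp.
  by move=> v; exact: (differentiable_continuous (dF v)).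
by apply: (measurable_at_measurable cP hB t0); case: SX => _ /(_ t tT).
Qed.

Variables (u1 ub1 : R -> Omega -> 'cV[R]_k1) (u2 ub2 : R -> Omega -> 'cV[R]_k2)
  (x xb : R -> Omega -> 'cV[R]_n) (y yb : R -> Omega -> 'cV[R]_m)
  (z zb : R -> Omega -> 'M[R]_(m, d)).
Hypotheses (adm1 : admissible P B T U1 u1) (adm2 : admissible P B T U2 u2)
  (admb1 : admissible P B T U1 ub1) (admb2 : admissible P B T U2 ub2).

Section coefficient_difference.
Hypotheses (Sx : S2 P B T x) (Sy : S2 P B T y) (Mz : M2 P B T z)
  (Sxb : S2 P B T xb) (Syb : S2 P B T yb) (Mzb : M2 P B T zb).
Variables (p : R -> Omega -> 'cV[R]_n) (q : R -> Omega -> 'M[R]_(n, d))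
  (k : R -> Omega -> 'cV[R]_m).
Hypotheses (Sp : S2 P B T p) (Mq : M2 P B T q) (Sk : S2 P B T k).
Variables (N : nat) (g : R -> point -> 'cV[R]_N)
  (dg : R -> point -> {linear point -> 'cV[R]_N}) (C : R).
Hypotheses (mg : measurable_coef T U1 U2 g)
  (cg : forall t, 0 <= t <= T -> C1_on dom (g t) (dg t))
  (bg : forall t v h, 0 <= t <= T -> dom v -> `|dg t v h| <= C * `|h|).

Let Dg i t w := g t (x t w, y t w, z t w, u1 t w, u2 t w) i 0 -
  g t (xb t w, yb t w, zb t w, ub1 t w, ub2 t w) i 0.

Lemma adapted_coef_diff i s : 0 <= s <= T -> fmeasurable P B s (Dg i s).
Proof.
move=> sT; apply: (@measurable_funB _ (filtration_type P B s)).
  exact: (observable_adapted_state cP hB adm1 adm2 Sx Sy Mz Sp Mq Sk (observable_entry i 0 mg) sT).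
exact: (observable_adapted_state cP hB admb1 admb2 Sxb Syb Mzb Sp Mq Sk (observable_entry i 0 mg) sT).
Qed.

(** Meant for the drifts b and f; the differences of sigma and of z are Ito integrands and lie in M2
    already. *)
Lemma sqint_coef_diff i : sqp (Dg i).
Proof.
have [[_ hu1] [_ hu2] [_ hub1]] := And3 adm1 adm2 admb1; have [_ hub2] := admb2.
have diff p' q' (X Y : R -> Omega -> 'M[R]_(p', q')) :
    (forall i j, sqp (fun t w => X t w i j)) -> (forall i j, sqp (fun t w => Y t w i j)) ->
    sqp (fun t w => l1norm (X t w - Y t w)).
  move=> sX sY; apply: sqint_process_l1norm => i' j.
  have := sqint_processB (sX i' j) (sY i' j); congr (sqp _).
  by apply/funext => t; apply/funext => w; rewrite !mxE.
have S p' q' (X : R -> Omega -> 'M[R]_(p', q')) (SX : S2 P B T X) i' j :=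
  S2_sqint_process cP hB i' j SX.
have M p' q' (X : R -> Omega -> 'M[R]_(p', q')) (MX : M2 P B T X) i' j :=
  M2_sqint_process i' j MX.
have := sqint_processZ `|C| (sqint_processD (sqint_processD (sqint_processD (sqint_processD
  (diff _ _ _ _ (S _ _ _ Sx) (S _ _ _ Sxb)) (diff _ _ _ _ (S _ _ _ Sy) (S _ _ _ Syb)))
  (diff _ _ _ _ (M _ _ _ Mz) (M _ _ _ Mzb))) (diff _ _ _ _ (M _ _ _ adm1.1) (M _ _ _ admb1.1)))
  (diff _ _ _ _ (M _ _ _ adm2.1) (M _ _ _ admb2.1))) => sN.
apply: (sqint_process_le _ sN).
  rewrite (_ : zext T _ = fun s =>
      zext T (fun t w => g t (x t w, y t w, z t w, u1 t w, u2 t w) i 0) s -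
      zext T (fun t w => g t (xb t w, yb t w, zb t w, ub1 t w, ub2 t w) i 0) s); last first.
    by apply/funext => s; rewrite /zext mulrBr.
  apply: measurable_funB.
    exact: (observable_joint_state cP T0 hB adm1 adm2 Sx Sy Mz Sp Mq Sk (observable_entry i 0 mg)).
  exact: (observable_joint_state cP T0 hB admb1 admb2 Sxb Syb Mzb Sp Mq Sk (observable_entry i 0 mg)).
move=> t w tT; apply: le_trans _ (ler_norm _).
apply: (coef_lipschitz _ _ _ _ _ _ _ _ U1_convex U2_convex (cg tT)).
- by move=> v h' Dv; exact: bg.
- exact: hub1.
- exact: hub2.
- exact: hu1.
- exact: hu2.
Qed.

End coefficient_difference.

Variables (b : R -> point -> 'cV[R]_n) (sigma : R -> point -> 'M[R]_(n, d))
  (f : R -> point -> 'cV[R]_m) (l : R -> point -> R)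
  (phi : 'cV[R]_n -> R) (h : 'cV[R]_m -> R).
Hypotheses (mb : measurable_coef T U1 U2 b) (msigma : measurable_coef T U1 U2 sigma)
  (mf : measurable_coef T U1 U2 f)
  (ml : measurable_coef T U1 U2 (l : R -> _ -> measurableTypeR R)).
Hypotheses (Lb : C1_bounded T U1 U2 b) (Lsigma : C1_bounded T U1 U2 sigma)
  (Lf : C1_bounded T U1 U2 f) (A2 : assumption_A2 T U1 U2 l phi h).
Variables (a : 'cV[R]_n) (xi : Omega -> 'cV[R]_m).
Hypotheses (st : state_process P B T b sigma f a xi u1 u2 x y z)
  (stb : state_process P B T b sigma f a xi ub1 ub2 xb yb zb).
Variables (p : R -> Omega -> 'cV[R]_n) (q : R -> Omega -> 'M[R]_(n, d))
  (k : R -> Omega -> 'cV[R]_m).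
Hypothesis adj : adjoint_process P B T b sigma f l phi h ub1 ub2 xb yb zb p q k.
Local Notation ham := (hamiltonian b sigma f l).

Let Sx := state_x_S2 st.
Let Sy := state_y_S2 st.
Let Mz := state_z_M2 st.
Let Sxb := state_x_S2 stb.
Let Syb := state_y_S2 stb.
Let Mzb := state_z_M2 stb.
Let Sp := adjoint_p_S2 adj.
Let Mq := adjoint_q_M2 adj.
Let Sk := adjoint_k_S2 adj.

Let v t w : point := (x t w, y t w, z t w, u1 t w, u2 t w).
Let vb t w : point := (xb t w, yb t w, zb t w, ub1 t w, ub2 t w).
Let Hx t w := grad (fun x' => ham t
  (x', yb t w, zb t w, ub1 t w, ub2 t w) (p t w) (q t w) (k t w)) (xb t w).
Let Hy t w := grad (fun y' => ham t
  (xb t w, y', zb t w, ub1 t w, ub2 t w) (p t w) (q t w) (k t w)) (yb t w).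
Let Hz t w := grad (fun z' => ham t
  (xb t w, yb t w, z', ub1 t w, ub2 t w) (p t w) (q t w) (k t w)) (zb t w).

(** The z gradient is absent because, up to sign, it is the Ito integrand in the equation of k and
    therefore belongs to M2. *)
Let grads : (forall i, sqp (fun t w => Hx t w i 0) /\ forall s, 0 <= s <= T ->
    fmeasurable P B s (fun w => Hx s w i 0)) /\
  (forall i, sqp (fun t w => Hy t w i 0) /\ forall s, 0 <= s <= T ->
    fmeasurable P B s (fun w => Hy s w i 0)).
Proof.
have [Cb [db hb]] := Lb; have [Cs [ds hs]] := Lsigma; have [Cf [df hf]] := Lf.
have [Cl [dl [cl _ bl _ _]]] := A2.
have cb t tT := (hb t tT).1; have cs t tT := (hs t tT).1; have cf t tT := (hf t tT).1.
have bb t w e tT Dw := (hb t tT).2 w Dw e.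
have bs t w e tT Dw := (hs t tT).2 w Dw e.
have bf t w e tT Dw := (hf t tT).2 w Dw e.
have bl' t x' y' z' u1' u2' e tT h1 h2 := (bl t x' y' z' u1' u2' tT h1 h2).2 e.
split=> i; split.
- exact: (sqint_grad_x cP T0 hB admb1 admb2 Sxb Syb Mzb Sp Mq Sk mb msigma mf ml cb cs cf cl bb bs bf bl').
- move=> s sT; exact: (observable_adapted_state cP hB admb1 admb2 Sxb Syb Mzb Sp Mq Sk
    (observable_grad_x mb msigma mf ml cb cs cf cl i 0) sT).
- exact: (sqint_grad_y cP T0 hB admb1 admb2 Sxb Syb Mzb Sp Mq Sk mb msigma mf ml cb cs cf cl bb bs bf bl').
- move=> s sT; exact: (observable_adapted_state cP hB admb1 admb2 Sxb Syb Mzb Sp Mq Sk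
    (observable_grad_y mb msigma mf ml cb cs cf cl i 0) sT).
Qed.

Let diff N (g : R -> point -> 'cV[R]_N) : measurable_coef T U1 U2 g ->
  C1_bounded T U1 U2 g -> forall i, sqp (fun t w => g t (v t w) i 0 - g t (vb t w) i 0) /\
    forall s, 0 <= s <= T -> fmeasurable P B s (fun w => g s (v s w) i 0 - g s (vb s w) i 0).
Proof.
move=> mg [C [dg hg]] i; have cg t tT := (hg t tT).1; have bg t w e tT Dw := (hg t tT).2 w Dw e.
split; first exact: (sqint_coef_diff Sx Sy Mz Sxb Syb Mzb Sp Mq Sk mg cg bg).
exact: (adapted_coef_diff Sx Sy Mz Sxb Syb Mzb Sp Mq Sk mg).
Qed.

Let sqN (X : R -> Omega -> R) : sqp X -> sqp (fun t w => - X t w).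
Proof.
by move=> /(sqint_processZ (-1)); congr (sqp _); apply/funext => t; apply/funext => w; rewrite mulN1r.
Qed.

Let fN s (X : Omega -> R) : fmeasurable P B s X -> fmeasurable P B s (fun w => - X w).
Proof. exact: (@measurable_funN _ (filtration_type P B s)). Qed.

Let TT : 0 <= T <= T. Proof. by rewrite lexx ltW. Qed.
Let T00 : (0 : R) <= 0 <= T. Proof. by rewrite lexx ltW. Qed.

Let sS2 N (X : R -> Omega -> 'cV[R]_N) t i j : S2 P B T X -> 0 <= t <= T ->
  sqintble P (fun w => X t w i j).
Proof. by move=> SX tT; have [K hK] := S2_sqint cP hB i j SX; case: (hK t tT). Qed.

Let sdiff N (X Y : R -> Omega -> 'cV[R]_N) t i j : S2 P B T X -> S2 P B T Y -> 0 <= t <= T ->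
  sqintble P (fun w => (X t w - Y t w) i j).
Proof.
move=> SX SY tT; under [X in sqintble _ X]eq_fun do rewrite !mxE.
by apply: sqintB; exact: sS2.
Qed.

(** Both states start at a, so the boundary term at time 0 is 0. *)
Let forward_duality : \int[P]_w inner (x T w - xb T w) (p T w) =
  \int[mP]_s zext T (fun t w => inner (x t w - xb t w) (- Hx t w)) s +
  \int[mP]_s zext T (fun t w => inner (p t w) (b t (v t w) - b t (vb t w))) s +
  \int[mP]_s zext T (fun t w => inner (sigma t (v t w) - sigma t (vb t w)) (q t w)) s.
Proof.
have [gH _] := grads; have db := diff mb Lb.
rewrite (ito_duality cP hB T0 Sx Sxb Sp (state_forward st) (state_forward stb)
  (adjoint_backward adj)).
- rewrite [X in X + _](_ : _ = 0) ?add0r//.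
  transitivity (\int[P]_w (0 : R)); last by rewrite Rintegral_cst// mul0r.
  apply: ae_eq_Rintegral => //.
    by apply: intble_meas; apply: intble_inner => i j; [exact: sdiff|exact: sS2].
  apply: filterS2 (state_initial st) (state_initial stb) => w -> ->.
  by rewrite subrr innerC inner0.
- by move=> i; exact: (db i).1.
- by move=> i; under [X in sqp X]eq_fun do under eq_fun do rewrite mxE; exact: (sqN (gH i).1).
- by move=> i s sT; exact: (db i).2.
- by move=> i s sT; under [X in fmeasurable _ _ _ X]eq_fun do rewrite mxE; exact: (fN ((gH i).2 s sT)).
Qed.

(** Both backward components end at [xi], so the boundary term at T is 0. The term at time 0 remains
    and is matched with the cost h. *)
Let backward_duality : 0 = \int[P]_w inner (y 0 w - yb 0 w) (k 0 w) +
  (\int[mP]_s zext T (fun t w => inner (y t w - yb t w) (- Hy t w)) s +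
  \int[mP]_s zext T (fun t w => inner (k t w) (- f t (v t w) - - f t (vb t w))) s +
  \int[mP]_s zext T (fun t w => inner (z t w - zb t w) (- Hz t w)) s).
Proof.
have [_ gH] := grads; have df := diff mf Lf.
rewrite -(ito_duality cP hB T0 Sy Syb Sk (state_backward st) (state_backward stb)
  (adjoint_forward adj)).
- transitivity (\int[P]_w (0 : R)); first by rewrite Rintegral_cst// mul0r.
  apply: ae_eq_Rintegral => //.
    by apply: intble_meas; apply: intble_inner => i j; [exact: sdiff|exact: sS2].
  apply: filterS2 (state_terminal st) (state_terminal stb) => w -> ->.
  by rewrite subrr innerC inner0.
- move=> i; have := sqN (df i).1; congr (sqp _); apply/funext => t; apply/funext => w.
  by rewrite !mxE opprB opprK addrC.
- by move=> i; under [X in sqp X]eq_fun do under eq_fun do rewrite mxE; exact: (sqN (gH i).1).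
- move=> i s sT; have := fN ((df i).2 s sT); congr (fmeasurable _ _ _ _); apply/funext => w.
  by rewrite !mxE opprB opprK addrC.
- by move=> i s sT; under [X in fmeasurable _ _ _ X]eq_fun do rewrite mxE; exact: (fN ((gH i).2 s sT)).
Qed.


Hypotheses (phi_convex : convex_function setT phi) (h_convex : convex_function setT h).
Hypothesis ham_ge : {ae mP, forall s, 0 <= s.1 <= T ->
  inner (Hx s.1 s.2) (x s.1 s.2 - xb s.1 s.2) + inner (Hy s.1 s.2) (y s.1 s.2 - yb s.1 s.2) +
  inner (Hz s.1 s.2) (z s.1 s.2 - zb s.1 s.2) <=
  ham s.1 (v s.1 s.2) (p s.1 s.2) (q s.1 s.2) (k s.1 s.2) -
  ham s.1 (vb s.1 s.2) (p s.1 s.2) (q s.1 s.2) (k s.1 s.2)}.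

(** Stated for an arbitrary pair of competing controls: the two players differ in the way [ham_ge]
    is obtained. *)
Lemma cost_le : (cost P T l phi h ub1 ub2 xb yb zb <= cost P T l phi h u1 u2 x y z)%E.
Proof.
have [C [dl [_ [C1phi C1h] bl bphi bh]]] := A2.
have bl' t x' y' z' u1' u2' tT h1 h2 := (bl t x' y' z' u1' u2' tT h1 h2).1.
have bphi' w := (bphi w).1; have bh' w := (bh w).1.
have il := intble_cost_density cP T0 hB adm1 adm2 Sx Sy Mz Sp Mq Sk ml bl'.
have ilb := intble_cost_density cP T0 hB admb1 admb2 Sxb Syb Mzb Sp Mq Sk ml bl'.
have iphi := intble_growth C1phi bphi' Sx TT; have iphib := intble_growth C1phi bphi' Sxb TT.
have ih := intble_growth C1h bh' Sy T00; have ihb := intble_growth C1h bh' Syb T00.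
rewrite !cost_fin// lee_fin.
have hphi : \int[P]_w inner (x T w - xb T w) (p T w) <=
    \int[P]_w phi (x T w) - \int[P]_w phi (xb T w).
  rewrite -RintegralB//; apply: le_Rintegral_ae; [|exact: intbleB|].
    by apply: intble_inner => i j; [exact: sdiff|exact: sS2].
  apply: filterS (adjoint_terminal adj) => w ->; rewrite innerC.
  by apply: convex_grad_le => //; case: C1phi.
have hh : - (\int[P]_w inner (y 0 w - yb 0 w) (k 0 w)) <=
    \int[P]_w h (y 0 w) - \int[P]_w h (yb 0 w).
  have i0 : intble P (fun w => inner (y 0 w - yb 0 w) (k 0 w)).
    by apply: intble_inner => i j; [exact: sdiff|exact: sS2].
  (* Since k_0 = - grad h, the tangent inequality for h appears with reversed sign. *)
  rewrite lerNl opprB -RintegralB//; apply: le_Rintegral_ae; [exact: intbleB|exact: i0|].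
  apply: filterS (adjoint_initial adj) => w ->; rewrite innerN innerC -lerN2 opprK opprB.
  by apply: convex_grad_le => //; case: C1h.
have [gHx gHy] := grads; have db := diff mb Lb; have df := diff mf Lf.
have sS N (X Y : R -> Omega -> 'cV[R]_N) i j : S2 P B T X -> S2 P B T Y ->
    sqp (fun t w => (X t w - Y t w) i j).
  move=> SX SY; under [X in sqp X]eq_fun do under eq_fun do rewrite !mxE.
  by apply: sqint_processB; [exact: (S2_sqint_process cP hB i j SX)|exact: (S2_sqint_process cP hB i j SY)].
have sM N N' (X Y : R -> Omega -> 'M[R]_(N, N')) i j : M2 P B T X -> M2 P B T Y ->
    sqp (fun t w => (X t w - Y t w) i j).
  move=> MX MY; under [X in sqp X]eq_fun do under eq_fun do rewrite !mxE.
  by apply: sqint_processB; [exact: (M2_sqint_process i j MX)|exact: (M2_sqint_process i j MY)].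
have [_ [_ [Msigma _ _ _] _]] := state_forward st.
have [_ [_ [Msigmab _ _ _] _]] := state_forward stb.
have [_ [_ [MHz _ _ _] _]] := adjoint_forward adj.
have i1 : intble mP (zext T (fun t w => inner (x t w - xb t w) (- Hx t w))).
  apply: intble_inner_process => i j; first exact: (sS _ _ _ i j Sx Sxb).
  by rewrite [j]ord1; under [X in sqp X]eq_fun do under eq_fun do rewrite mxE; exact: (sqN (gHx i).1).
have i2 : intble mP (zext T (fun t w => inner (p t w) (b t (v t w) - b t (vb t w)))).
  apply: intble_inner_process => i j; first exact: (S2_sqint_process cP hB i j Sp).
  by rewrite [j]ord1; under [X in sqp X]eq_fun do under eq_fun do rewrite !mxE; exact: (db i).1.
have i3 : intble mP (zext T (fun t w => inner (sigma t (v t w) - sigma t (vb t w)) (q t w))).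
  by apply: intble_inner_process => i j; [exact: (sM _ _ _ _ i j Msigma Msigmab)|exact: (M2_sqint_process i j Mq)].
have i4 : intble mP (zext T (fun t w => inner (y t w - yb t w) (- Hy t w))).
  apply: intble_inner_process => i j; first exact: (sS _ _ _ i j Sy Syb).
  by rewrite [j]ord1; under [X in sqp X]eq_fun do under eq_fun do rewrite mxE; exact: (sqN (gHy i).1).
have i5 : intble mP (zext T (fun t w => inner (k t w) (- f t (v t w) - - f t (vb t w)))).
  apply: intble_inner_process => i j; first exact: (S2_sqint_process cP hB i j Sk).
  rewrite [j]ord1; have := sqN (df i).1; congr (sqp _); apply/funext => t; apply/funext => w.
  by rewrite !mxE opprB opprK addrC.
have i6 : intble mP (zext T (fun t w => inner (z t w - zb t w) (- Hz t w))).
  by apply: intble_inner_process => i j; [exact: (sM _ _ _ _ i j Mz Mzb)|exact: (M2_sqint_process i j MHz)].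
have i12 := intbleD i1 i2; have i123 := intbleD i12 i3.
have i45 := intbleD i4 i5; have i456 := intbleD i45 i6.
have i16 := intbleD i123 i456; have i7 := intbleB il ilb.
(* On [0, T] the integrand is the increment of H minus the pairing of its state gradients with the
   state differences, with l restored; outside [0, T] it is 0. *)
have total : 0 <= \int[mP]_s ((zext T (fun t w => l t (v t w)) s - zext T (fun t w => l t (vb t w)) s) +
    (zext T (fun t w => inner (x t w - xb t w) (- Hx t w)) s +
     zext T (fun t w => inner (p t w) (b t (v t w) - b t (vb t w))) s +
     zext T (fun t w => inner (sigma t (v t w) - sigma t (vb t w)) (q t w)) s +
     (zext T (fun t w => inner (y t w - yb t w) (- Hy t w)) s +
      zext T (fun t w => inner (k t w) (- f t (v t w) - - f t (vb t w))) s +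
      zext T (fun t w => inner (z t w - zb t w) (- Hz t w)) s))).
  apply: le_trans (_ : 0 <= \int[mP]_s (0 : R)) _; first by apply: Rintegral_ge0.
  apply: le_Rintegral_ae.
  - exact: intble0.
  - exact: intbleD i7 i16.
  apply: (ae_imply ham_ge) => -[t w] /= hge.
  have [tT|tT] := boolP (0 <= t <= T); last by rewrite !zext_out// !addr0 subr0.
  rewrite !zext_itv//; have := hge tT; rewrite /hamiltonian.
  rewrite !innerN !innerB !innerN !(innerC _ (Hx t w)) !(innerC _ (Hy t w)) !(innerC _ (Hz t w)).
  rewrite !innerB [inner _ (q t w)]innerC innerB; lra.
move: total; rewrite (RintegralD measurableT i7 i16) (RintegralB measurableT il ilb).
rewrite (RintegralD measurableT i123 i456) (RintegralD measurableT i12 i3) (RintegralD measurableT i1 i2).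
rewrite (RintegralD measurableT i45 i6) (RintegralD measurableT i4 i5) -forward_duality.
by have := backward_duality; lra.
Qed.

End comparison.

(** The candidate's cost is a lower bound because [cost_le] applies to every competitor and every
    state process of it. It is at least the infimum because it is itself one of the values, with the
    given state process as witness. *)
Theorem theorem3p1 (R : realType) (disp : measure_display)
    (Omega : measurableType disp) (P : probability Omega R)
    (P_complete : measure_is_complete P)
    (d n m k1 k2 : nat) (B : R -> Omega -> 'cV[R]_d)
    (B_brownian : brownian_motion P B)
    (T : R) (T_gt0 : 0 < T)
    (U1 : set 'cV[R]_k1) (U2 : set 'cV[R]_k2)
    (U1_convex : convex_set U1) (U1_neq0 : U1 !=set0)
    (U2_convex : convex_set U2) (U2_neq0 : U2 !=set0)
    (a : 'cV[R]_n) (xi : Omega -> 'cV[R]_m) (xi_L2 : L2_terminal P B T xi)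
    (b : R -> 'cV[R]_n * 'cV[R]_m * 'M[R]_(m, d) * 'cV[R]_k1 * 'cV[R]_k2 ->
         'cV[R]_n)
    (sigma : R -> 'cV[R]_n * 'cV[R]_m * 'M[R]_(m, d) * 'cV[R]_k1 * 'cV[R]_k2 ->
         'M[R]_(n, d))
    (f : R -> 'cV[R]_n * 'cV[R]_m * 'M[R]_(m, d) * 'cV[R]_k1 * 'cV[R]_k2 ->
         'cV[R]_m)
    (b_meas : measurable_coef T U1 U2 b)
    (sigma_meas : measurable_coef T U1 U2 sigma)
    (f_meas : measurable_coef T U1 U2 f)
    (l1 l2 : R -> 'cV[R]_n * 'cV[R]_m * 'M[R]_(m, d) * 'cV[R]_k1 * 'cV[R]_k2 ->
         R)
    (l1_meas : measurable_coef T U1 U2 (l1 : R -> _ -> measurableTypeR R))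
    (l2_meas : measurable_coef T U1 U2 (l2 : R -> _ -> measurableTypeR R))
    (phi1 phi2 : 'cV[R]_n -> R) (h1 h2 : 'cV[R]_m -> R)
    (hA1 : assumption_A1 P B T U1 U2 b sigma f)
    (hA2_1 : assumption_A2 T U1 U2 l1 phi1 h1)
    (hA2_2 : assumption_A2 T U1 U2 l2 phi2 h2)
    (ub1 : R -> Omega -> 'cV[R]_k1) (ub2 : R -> Omega -> 'cV[R]_k2)
    (ub1_adm : admissible P B T U1 ub1) (ub2_adm : admissible P B T U2 ub2)
    (xb : R -> Omega -> 'cV[R]_n) (yb : R -> Omega -> 'cV[R]_m)
    (zb : R -> Omega -> 'M[R]_(m, d))
    (state_b : state_process P B T b sigma f a xi ub1 ub2 xb yb zb)
    (pb1 pb2 : R -> Omega -> 'cV[R]_n) (qb1 qb2 : R -> Omega -> 'M[R]_(n, d))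
    (kb1 kb2 : R -> Omega -> 'cV[R]_m)
    (adjoint_b1 : adjoint_process P B T b sigma f l1 phi1 h1
       ub1 ub2 xb yb zb pb1 qb1 kb1)
    (adjoint_b2 : adjoint_process P B T b sigma f l2 phi2 h2
       ub1 ub2 xb yb zb pb2 qb2 kb2)
    (H_convex : {ae (lebesgue_measure \x P)%E, forall tw, 0 <= tw.1 <= T ->
       convex_function
         [set v : 'cV[R]_n * 'cV[R]_m * 'M[R]_(m, d) * 'cV[R]_k1 | U1 v.2]
         (fun v => hamiltonian b sigma f l1 tw.1 (v, ub2 tw.1 tw.2)
            (pb1 tw.1 tw.2) (qb1 tw.1 tw.2) (kb1 tw.1 tw.2)) /\
       convex_function
         [set v : 'cV[R]_n * 'cV[R]_m * 'M[R]_(m, d) * 'cV[R]_k2 | U2 v.2]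
         (fun v => hamiltonian b sigma f l2 tw.1 (v.1, ub1 tw.1 tw.2, v.2)
            (pb2 tw.1 tw.2) (qb2 tw.1 tw.2) (kb2 tw.1 tw.2))})
    (phi1_convex : convex_function setT phi1)
    (phi2_convex : convex_function setT phi2)
    (h1_convex : convex_function setT h1)
    (h2_convex : convex_function setT h2)
    (H_min : {ae (lebesgue_measure \x P)%E, forall tw, 0 <= tw.1 <= T ->
       is_min_on U1
         (fun u1 => hamiltonian b sigma f l1 tw.1
            (xb tw.1 tw.2, yb tw.1 tw.2, zb tw.1 tw.2, u1, ub2 tw.1 tw.2)
            (pb1 tw.1 tw.2) (qb1 tw.1 tw.2) (kb1 tw.1 tw.2))
         (hamiltonian b sigma f l1 tw.1
            (xb tw.1 tw.2, yb tw.1 tw.2, zb tw.1 tw.2,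
             ub1 tw.1 tw.2, ub2 tw.1 tw.2)
            (pb1 tw.1 tw.2) (qb1 tw.1 tw.2) (kb1 tw.1 tw.2)) /\
       is_min_on U2
         (fun u2 => hamiltonian b sigma f l2 tw.1
            (xb tw.1 tw.2, yb tw.1 tw.2, zb tw.1 tw.2, ub1 tw.1 tw.2, u2)
            (pb2 tw.1 tw.2) (qb2 tw.1 tw.2) (kb2 tw.1 tw.2))
         (hamiltonian b sigma f l2 tw.1
            (xb tw.1 tw.2, yb tw.1 tw.2, zb tw.1 tw.2,
             ub1 tw.1 tw.2, ub2 tw.1 tw.2)
            (pb2 tw.1 tw.2) (qb2 tw.1 tw.2) (kb2 tw.1 tw.2))}) :
  cost P T l1 phi1 h1 ub1 ub2 xb yb zb =
    ereal_inf [set c | exists2 u1, admissible P B T U1 u1 &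
                 J_value P B T b sigma f a xi l1 phi1 h1 u1 ub2 c] /\
  cost P T l2 phi2 h2 ub1 ub2 xb yb zb =
    ereal_inf [set c | exists2 u2, admissible P B T U2 u2 &
                 J_value P B T b sigma f a xi l2 phi2 h2 ub1 u2 c].
Proof.
have [b1 b2 b3 _] := hA1.
split; apply/eqP; rewrite eq_le; apply/andP; split.
- apply: le_ereal_inf_tmp => _ [u1 adm1 [x [y [z [st ->]]]]].
  apply: (cost_le P_complete T_gt0 B_brownian U1_convex U2_convex adm1 ub2_adm ub1_adm ub2_adm
    b_meas sigma_meas f_meas l1_meas b1 b2 b3 hA2_1 st state_b adjoint_b1 phi1_convex h1_convex).
  have [Cb [db hb]] := b1; have [Cs [ds hs]] := b2; have [Cf [df hf]] := b3.
  have [Cl [dl [cl _ _ _ _]]] := hA2_1.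
  apply: (ae_imply (ae_conj H_convex H_min)) => -[t w] /= [hc hm] tT.
  have [_ hu1] := adm1; have [_ hub1] := ub1_adm; have [_ hub2] := ub2_adm.
  apply: (ham_convex_min1 (hb t tT).1 (hs t tT).1 (hf t tT).1 (cl t tT)) => //.
  + exact: hub1.
  + exact: hub2.
  + exact: hu1.
  + exact: (hc tT).1.
  + exact: (hm tT).1.
- apply: ereal_inf_lbound; exists ub1 => //.
  by exists xb, yb, zb.
- apply: le_ereal_inf_tmp => _ [u2 adm2 [x [y [z [st ->]]]]].
  apply: (cost_le P_complete T_gt0 B_brownian U1_convex U2_convex ub1_adm adm2 ub1_adm ub2_adm
    b_meas sigma_meas f_meas l2_meas b1 b2 b3 hA2_2 st state_b adjoint_b2 phi2_convex h2_convex).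
  have [Cb [db hb]] := b1; have [Cs [ds hs]] := b2; have [Cf [df hf]] := b3.
  have [Cl [dl [cl _ _ _ _]]] := hA2_2.
  apply: (ae_imply (ae_conj H_convex H_min)) => -[t w] /= [hc hm] tT.
  have [_ hu2] := adm2; have [_ hub1] := ub1_adm; have [_ hub2] := ub2_adm.
  apply: (ham_convex_min2 (hb t tT).1 (hs t tT).1 (hf t tT).1 (cl t tT)) => //.
  + exact: hub1.
  + exact: hub2.
  + exact: hu2.
  + exact: (hc tT).2.
  + exact: (hm tT).2.
- apply: ereal_inf_lbound; exists ub2 => //.
  by exists xb, yb, zb.
Qed.
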